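(* For all $f\in L^2(\mathbb{R}^d)$ and all $\tau\in(0,1)$, $$WF_G(f)\subset WF_\tau(f).$$
   Context: $\tau$-Wigner distribution: $W_\tau f(x,\xi)=\int_{\mathbb{R}^d}e^{-2\pi it\cdot\xi}f(x+\tau t)\overline{f(x-(1-\tau)t)}\,dt$. $\tau$-Wigner wave front set: for $f\in L^2(\mathbb{R}^d)$, $0<\tau<1$, $WF_\tau(f)\subset\mathbb{R}^{2d}\setminus\{0\}$ is defined by: $z_0\in\mathbb{R}^{2d}\setminus\{0\}$ is not in $WF_\tau(f)$ if there is a conic open neighbourhood $\Gamma_{z_0}\subset\mathbb{R}^{2d}$ of $z_0$ such that $\int_{\Gamma_{z_0}}|z|^{2N}|W_\tau f(z)|^2dz<\infty$ for every integer $N\ge0$. Global (Gabor) wave front set of H\''ormander: let $V_gf(x,\xi)=\int_{\mathbb{R}^d}f(t)\overline{g(t-x)}e^{-2\pi it\cdot\xi}dt$ with $g\in\mathcal{S}(\mathbb{R}^d)\setminus\{0\}$. For $f\in L^2(\mathbb{R}^d)$, a point $z_0\ne0$ is not in $WF_G(f)\subset\mathbb{R}^{2d}\setminus\{0\}$ if there is an open conic neighbourhood $\Gamma_{z_0}\subset\mathbb{R}^{2d}$ of $z_0$ such that $\int_{\Gamma_{z_0}}|z|^{2N}|V_gf(z)|^2dz<\infty$ for every integer $N\ge0$. This definition does not depend on the choice of $g\in\mathcal{S}(\mathbb{R}^d)\setminus\{0\}$. *)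

(* Defs.v *)
From HB Require Import structures.
From mathcomp Require Import all_boot all_order all_algebra.
From mathcomp Require Import complex.
From mathcomp Require Import all_classical all_reals all_analysis.

Set Implicit Arguments.
Unset Strict Implicit.
Unset Printing Implicit Defensive.
Import Order.TTheory GRing.Theory Num.Theory.
Import numFieldNormedType.Exports.
Local Open Scope classical_set_scope.
Local Open Scope ring_scope.

Definition measure_mx_display : measure_display -> measure_display.
Proof. exact. Qed.

Section matrix_measurable.
Context {d : measure_display} {T : measurableType d} (m n : nat).

(* The sigma-algebra on matrices generated by the entries: for T = R it is the
   Borel sigma-algebra of R^(m * n). *)
Definition measurable_mx : set (set 'M[T]_(m, n)) :=
  <<s \bigcup_(ij in [set: 'I_m * 'I_n])
        preimage_set_system setT (fun A : 'M[T]_(m, n) => A ij.1 ij.2)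
          measurable >>.

Let measurable_mx0 : measurable_mx set0.
Proof. exact: sigma_algebra0. Qed.

Let measurable_mxC A : measurable_mx A -> measurable_mx (~` A).
Proof. exact: sigma_algebraC. Qed.

Let measurable_mxU (F : (set 'M[T]_(m, n))^nat) :
  (forall i, measurable_mx (F i)) -> measurable_mx (\bigcup_i F i).
Proof. exact: sigma_algebra_bigcup. Qed.

HB.instance Definition _ := @isMeasurable.Build (measure_mx_display d)
  'M[T]_(m, n) measurable_mx measurable_mx0 measurable_mxC measurable_mxU.

Lemma measurable_coord (i : 'I_m) (j : 'I_n) :
  measurable_fun [set: 'M[T]_(m, n)] (fun A => A i j).
Proof.
move=> _ Y mY; apply: sub_sigma_algebra.
by exists (i, j) => //; exists Y.
Qed.

Lemma measurable_fun_mx d' (U : measurableType d') (f : U -> 'M[T]_(m, n)) :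
  (forall i j, measurable_fun [set: U] (fun x => f x i j)) ->
  measurable_fun [set: U] f.
Proof.
move=> mf; pose G := \bigcup_(ij in [set: 'I_m * 'I_n])
  preimage_set_system setT (fun A : 'M[T]_(m, n) => A ij.1 ij.2) measurable.
apply: (@measurability _ _ _ _ _ _ G) => // _ [_ [[i j] _ [Y mY <-]] <-].
by have := mf i j measurableT _ mY; rewrite !setTI.
Qed.

End matrix_measurable.

(* The library proves this too, but the sigma-finite instance that it attaches
   to \x is shadowed by the one for products of subprobabilities. *)
Lemma sigma_finite_prod d1 d2 (T1 : measurableType d1) (T2 : measurableType d2)
    (R : realType) (m1 : {sigma_finite_measure set T1 -> \bar R})
    (m2 : {sigma_finite_measure set T2 -> \bar R}) :
  sigma_finite setT (m1 \x m2)%E.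
Proof.
have /sigma_finiteP[F [TF ndF Foo]] := sigma_finiteT m1.
have /sigma_finiteP[G [TG ndG Goo]] := sigma_finiteT m2.
exists (fun n => F n `*` G n).
  rewrite -setXTT TF TG; apply/seteqP; split=> -[x y] /=.
    move=> [[n _ Fnx] [k _ Gky]]; exists (maxn n k) => //; split.
      by move: x Fnx; exact/subsetPset/ndF/leq_maxl.
    by move: y Gky; exact/subsetPset/ndG/leq_maxr.
  by move=> [n _ []/= ? ?]; split; exists n.
move=> k; have [? ?] := Foo k; have [? ?] := Goo k.
split; first exact: measurableX.
by rewrite product_measure1E// lte_mul_pinfty// ge0_fin_numE.
Qed.

Section lebesgue_measure_rV.
Context {R : realType}.

(* (x_0, (x_1, ..., x_d)) |-> (x_0, x_1, ..., x_d) *)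
Definition cons_rV d (p : measurableTypeR R * 'rV[R]_d) : 'rV[R]_d.+1 :=
  row_mx (const_mx p.1 : 'rV_1) p.2.

Lemma cons_rV0 d p : @cons_rV d p 0 0 = p.1.
Proof.
have -> : (0 : 'I_d.+1) = lshift d (0 : 'I_1) by exact/val_inj.
by rewrite /cons_rV (row_mxEl (const_mx p.1 : 'rV_1)) mxE.
Qed.

Lemma cons_rVS d p j : @cons_rV d p 0 (lift 0 j) = p.2 0 j.
Proof.
have -> : lift 0 j = rshift 1 j by exact/val_inj.
by rewrite /cons_rV (row_mxEr (const_mx p.1 : 'rV_1)).
Qed.

Let uncons_rV d (x : 'rV[R]_d.+1) : measurableTypeR R * 'rV[R]_d :=
  (x 0 0, \row_j x 0 (lift 0 j)).

Let cons_rVK d : cancel (@cons_rV d) (@uncons_rV d).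
Proof.
move=> [a v]; rewrite /uncons_rV cons_rV0; congr pair.
by apply/rowP => j; rewrite mxE cons_rVS.
Qed.

Lemma measurable_cons_rV d : measurable_fun [set: _] (@cons_rV d).
Proof.
apply: measurable_fun_mx => i j; rewrite ord1.
case: (unliftP 0 j) => [k ->|->].
- under eq_fun do rewrite cons_rVS.
  exact: (measurableT_comp (measurable_coord _ _) measurable_snd).
- under eq_fun do rewrite cons_rV0.
  exact: measurable_fst.
Qed.

Let measurable_uncons_rV d : measurable_fun [set: _] (@uncons_rV d).
Proof.
apply/measurable_fun_pairP; split; first exact: measurable_coord.
apply: measurable_fun_mx => i j; rewrite /comp/=.
under eq_fun do rewrite mxE.
exact: measurable_coord.
Qed.

(* Lebesgue measure on R^d, as the d-fold product of that of R. *)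
Fixpoint lebesgue_rV (d : nat) : set 'rV[R]_d -> \bar R :=
  match d with
  | 0%N => \d_(0 : 'rV[R]_0)
  | d'.+1 =>
      pushforward (lebesgue_measure \x (@lebesgue_rV d'))%E (@cons_rV d')
  end.

Section cons_measure.
Local Open Scope ereal_scope.
Context (d : nat) (m : {sigma_finite_measure set 'rV[R]_d -> \bar R}).

Let mu := pushforward (lebesgue_measure \x m) (@cons_rV d).

Let mf := @measurable_cons_rV d.

Let mu0 : mu set0 = 0. Proof. exact: measure0. Qed.

Let mu_ge0 A : 0 <= mu A. Proof. exact: measure_ge0. Qed.

Let mu_sigma_additive : semi_sigma_additive mu.
Proof. exact: measure_semi_sigma_additive. Qed.

HB.instance Definition _ := isMeasure.Build _ _ _ mu
  mu0 mu_ge0 mu_sigma_additive.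

Let mu_sigma_finite : sigma_finite setT mu.
Proof.
have [F FT Ffin] := sigma_finite_prod (@lebesgue_measure R) m.
exists (fun i => @uncons_rV d @^-1` F i).
  by rewrite -preimage_bigcup -FT preimage_setT.
move=> i; have [mF Foo] := Ffin i; split.
  by rewrite -[X in measurable X]setTI; exact: measurable_uncons_rV.
rewrite /mu /pushforward -comp_preimage.
by rewrite (_ : _ \o _ = id)//; apply/funext => x /=; rewrite cons_rVK.
Qed.

HB.instance Definition _ := @Measure_isSigmaFinite.Build _ _ _ mu
  mu_sigma_finite.

Definition cons_measure : {sigma_finite_measure set 'rV[R]_d.+1 -> \bar R} :=
  mu.

End cons_measure.

Let lebesgue_rV_sigma_finite_measure d :
  {m : {sigma_finite_measure set 'rV[R]_d -> \bar R} | @lebesgue_rV d = m}.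
Proof.
elim: d => [|d [m lm]]; first by exists (\d_(0 : 'rV[R]_0)).
by exists (cons_measure m); rewrite /= lm.
Qed.

Let lebesgue_rV0 d : @lebesgue_rV d set0 = 0%E.
Proof. by have [m ->] := lebesgue_rV_sigma_finite_measure d. Qed.

Let lebesgue_rV_ge0 d A : (0 <= @lebesgue_rV d A)%E.
Proof. by have [m ->] := lebesgue_rV_sigma_finite_measure d. Qed.

Let lebesgue_rV_sigma_additive d : semi_sigma_additive (@lebesgue_rV d).
Proof.
have [m ->] := lebesgue_rV_sigma_finite_measure d.
exact: measure_semi_sigma_additive.
Qed.

HB.instance Definition _ d := isMeasure.Build _ _ _ (@lebesgue_rV d)
  (@lebesgue_rV0 d) (@lebesgue_rV_ge0 d) (@lebesgue_rV_sigma_additive d).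

Let lebesgue_rV_sigma_finite d : sigma_finite setT (@lebesgue_rV d).
Proof.
have [m ->] := lebesgue_rV_sigma_finite_measure d.
exact: sigma_finiteT.
Qed.

HB.instance Definition _ d := @Measure_isSigmaFinite.Build _ _ _
  (@lebesgue_rV d) (@lebesgue_rV_sigma_finite d).

Lemma lebesgue_rV_box d (A : 'I_d -> set (measurableTypeR R)) :
  (forall i, measurable (A i)) ->
  lebesgue_rV [set x : 'rV[R]_d | forall i, A i (x 0 i)] =
  \big[*%E/1%E]_(i < d) lebesgue_measure (A i).
Proof.
elim: d A => [|d IH] A mA.
  rewrite big_ord0 /= diracE.
  by rewrite mem_set// => -[].
rewrite big_ord_recl /= /pushforward -IH; last by move=> i; exact: mA.
rewrite -product_measure1E//; last first.
  rewrite [X in measurable X](_ : _ =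
      \bigcap_(i in [set: 'I_d]) [set x : 'rV[R]_d | A (lift 0 i) (x 0 i)]).
    apply: fin_bigcap_measurable => // i _.
    rewrite -[X in measurable X]setTI.
    exact: (@measurable_coord _ R 1 d 0 i measurableT _ (mA (lift 0 i))).
  by apply/seteqP; split=> x /= Ax i => [_|]; [exact: Ax|exact: (Ax i I)].
congr product_measure1; apply/seteqP; split=> -[a v] /=.
- move=> Aav; split=> [|i]; first by have := Aav 0; rewrite cons_rV0.
  by have := Aav (lift 0 i); rewrite cons_rVS.
- move=> [Aa Av] i; case: (unliftP 0 i) => [j ->|->].
    by rewrite cons_rVS; exact: Av.
  by rewrite cons_rV0.
Qed.

End lebesgue_measure_rV.
Arguments lebesgue_rV {R} d.

Section wave_front_sets.
Context {R : realType} {d : nat}.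
Local Open Scope complex_scope.

Local Notation Rd := 'rV[R]_d.
Local Notation R2d := ('rV[R]_d * 'rV[R]_d)%type.

(* Lebesgue measure on R^2d, for z = (x, xi). *)
Definition lebesgue_phase : set R2d -> \bar R :=
  (lebesgue_rV d \x lebesgue_rV d)%E.

HB.instance Definition _ := Measure.on lebesgue_phase.

HB.instance Definition _ := @Measure_isSigmaFinite.Build _ _ _
  lebesgue_phase (sigma_finite_prod (lebesgue_rV d) (lebesgue_rV d)).

Definition dot (x y : Rd) : R := \sum_(i < d) x 0 i * y 0 i.

(* The Euclidean norm on R^2d; the norm `|z| of the library is the max norm. *)
Definition enorm (z : R2d) : R := Num.sqrt (dot z.1 z.1 + dot z.2 z.2).

Definition cis (t : R) : R[i] := cos t +i* sin t.

Definition cintegral (F : Rd -> R[i]) : R[i] :=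
  (\int[lebesgue_rV d]_t complex.Re (F t))%R +i*
  (\int[lebesgue_rV d]_t complex.Im (F t))%R.

(* A function of L^2(R^d) is given by a Borel measurable representative. *)
Definition L2 (f : Rd -> R[i]) : Prop :=
  [/\ measurable_fun setT (fun x => complex.Re (f x)),
      measurable_fun setT (fun x => complex.Im (f x)) &
      (\int[lebesgue_rV d]_x (Normc.normc (f x) ^+ 2)%:E < +oo)%E].

(* The multi-index of the derivative is listed as a sequence of coordinates:
   iter_partial [:: i; j] u is the derivative of u along e_j, then e_i. *)
Definition iter_partial (s : seq 'I_d) (u : Rd -> R) : Rd -> R :=
  foldr (fun i v => 'D_(delta_mx 0 i) v) u s.

Definition smooth (u : Rd -> R) : Prop :=
  forall (s : seq 'I_d) (x : Rd), differentiable (iter_partial s u) x.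

Definition real_schwartz (u : Rd -> R) : Prop :=
  smooth u /\
  forall (a : 'I_d -> nat) (s : seq 'I_d), exists C : R, forall x : Rd,
    `|(\prod_(i < d) x 0 i ^+ a i) * iter_partial s u x| <= C.

Definition schwartz (g : Rd -> R[i]) : Prop :=
  real_schwartz (fun x => complex.Re (g x)) /\
  real_schwartz (fun x => complex.Im (g x)).

Definition stft (g f : Rd -> R[i]) (z : R2d) : R[i] :=
  cintegral (fun t => f t * (g (t - z.1))^* * cis (- (2 * pi * dot t z.2))).

Definition tau_wigner (tau : R) (f : Rd -> R[i]) (z : R2d) : R[i] :=
  cintegral (fun t => cis (- (2 * pi * dot t z.2)) *
    f (z.1 + tau *: t) * (f (z.1 - (1 - tau) *: t))^*).

Definition open_conic_nbhd (z0 : R2d) (G : set R2d) : Prop :=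
  [/\ open G, G z0 & forall (t : R) (z : R2d), 0 < t -> G z -> G (t *: z)].

(* The directions in which F does not decay rapidly in the L^2 sense. *)
Definition wave_front (F : R2d -> R[i]) : set R2d :=
  [set z0 | z0 != 0 /\
    ~ exists G : set R2d, open_conic_nbhd z0 G /\
      forall N : nat,
        (\int[lebesgue_phase]_(z in G)
           (enorm z ^+ (2 * N) * Normc.normc (F z) ^+ 2)%:E < +oo)%E].

Definition WF_tau (tau : R) (f : Rd -> R[i]) : set R2d :=
  wave_front (tau_wigner tau f).

(* The window g is kept explicit: independence of g is a theorem. *)
Definition WF_G (g f : Rd -> R[i]) : set R2d := wave_front (stft g f).

End wave_front_sets.

(* Main.v *)
Require Import Defs.
From HB Require Import structures.
From mathcomp Require Import all_boot all_order all_algebra.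
From mathcomp Require Import complex.
From mathcomp Require Import all_classical all_reals all_analysis.
From mathcomp Require Import measurable_realfun ring lra.

Set Implicit Arguments.
Unset Strict Implicit.
Unset Printing Implicit Defensive.
Import Order.TTheory GRing.Theory Num.Theory.
Import numFieldNormedType.Exports.
Local Open Scope classical_set_scope.
Local Open Scope ring_scope.

(** Let V be the short-time Fourier transform of f with window g, and let W be
    the tau-Wigner distribution of f.  The idea is to write the spectrogram
    |V|^2 as a convolution of W with a rapidly decaying kernel: rapid decay of W
    in an open cone around z0 is then inherited, in a smaller cone, by |V|^2.

    To obtain the convolution, expand V(z) times its conjugate as a double
    integral over (s, s') and substitute s = y + tau t, s' = y - (1 - tau) t
    (cint_autocorrelation).  This separates f from g: for z = (x, xi),

      |V(z)|^2 = int_y int_t F_y(t) G_{y-x}(t) exp(-2 pi i t.xi) dt dy,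

    with F_y(t) = f(y + tau t) conj f(y - (1 - tau) t), whose Fourier transform
    is W(y, .), and G_u(t) = conj g(u + tau t) g(u - (1 - tau) t).  Writing G_u
    as the inverse Fourier transform of its Fourier transform G_u^ gives

      |V(z)|^2 = int_y int_eta G_{y-x}^(eta) W(y, xi - eta) deta dy.

    Three facts about Fourier transforms carry this out.  The first is Fourier
    inversion (fourier_inversion), proved by regularizing with the kernel
    exp(-|eta|_1), whose transform is an explicit product of Poisson kernels.
    The second is that G_u^(eta) decays rapidly in (u, eta) jointly
    (fourier_window_product_decay).  Decay in u is immediate, because u and t
    are combinations of the two points at which g is evaluated; decay in eta
    comes from integrating by parts, which replaces G_u by similar products
    built from derivatives of g.  The third is that F_y is integrable for every
    y, with a bound that does not depend on y (integral_pair_product_le); in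
    particular W is bounded.  Together they give, for every m,

      |V(z)|^2 <= C int_w (1 + |w - z|)^(-m) |W(w)| dw      (stft_sqr_le).

    It remains to integrate |z|^(2N) |V(z)|^2 over a small cone G' around z0
    (convolution_rapid_decay).  Let G be the cone on which W decays.  Points w
    of G contribute a finite amount because |z|^(2N) is at most a constant times
    (1 + |w|)^(2N) (1 + |w - z|)^(2N), and (1 + |w|)^(2N) |W(w)| is integrable
    on G by the Cauchy-Schwarz inequality.  For w outside G and z in G' one has
    |w - z| >= c |z| (cone_separation), so the kernel alone compensates the
    factor |z|^(2N), and boundedness of W is enough. *)

(** * Affine changes of variables *)

Section image_measure.
Context d d' (T1 : measurableType d) (T2 : measurableType d') (R : realType).

(** The measurability proof is an argument, which makes the image measure a
    term of the type of measures. *)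
Definition image_measure (m : {measure set T1 -> \bar R}) (f : T1 -> T2)
    (mf : measurable_fun setT f) : {measure set T2 -> \bar R} :=
  measure_function_pushforward__canonical__measure_function_Measure m mf.

End image_measure.

Section affine_line.
Context {R : realType}.
Implicit Types (r c : R).

Lemma measurable_affine r c :
  measurable_fun setT ((fun x => r * x + c) : measurableTypeR R -> measurableTypeR R).
Proof. by apply: measurable_funD => //; exact: measurable_funM. Qed.

(** Both sides are measures in A, so it suffices to compare them on the
    intervals ]a, b]; for r < 0 the preimage has the form [_, _[, which has the
    same length as ]_, _]. *)
Lemma lebesgue_measure_affine r c (A : set (measurableTypeR R)) : r != 0 ->
  measurable A ->
  (lebesgue_measure A =
   `|r|%:E * lebesgue_measure ((fun x => (r * x + c)%R) @^-1` A))%E.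
Proof.
move=> r0 mA.
have mf := measurable_affine r c.
pose m := mscale (NngNum (normr_ge0 r))
  (image_measure lebesgue_measure mf).
have -> : (`|r|%:E * lebesgue_measure ((fun x => (r * x + c)%R) @^-1` A))%E = m A.
  by [].
apply: lebesgue_measure_unique => // _ [[a b] _ <-].
change (lebesgue_measure (`]a, b]%classic : set R) =
  (`|r|%:E * lebesgue_measure ((fun x => (r * x + c)%R) @^-1` `]a, b]))%E).
rewrite lebesgue_measure_itv/= lte_fin.
case: (ltgtP r 0) r0 => // [r_lt0|r_gt0] _.
- rewrite (_ : _ @^-1` _ = `[(b - c) / r, (a - c) / r[%classic); last first.
    apply/seteqP; split=> x /=; rewrite !in_itv/=.
      by rewrite ler_ndivrMr// ltr_ndivlMr// => /andP[]; lra.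
    by rewrite ler_ndivrMr// ltr_ndivlMr// => /andP[]; lra.
  rewrite lebesgue_measure_itv/= lte_fin ltr_ndivrMr// mulfVK ?lt_eqF//.
  rewrite ltrD2r; case: ifPn => ab; last by rewrite mule0.
  rewrite -!EFinB -EFinM ltr0_norm//; congr EFin.
  by field; rewrite lt_eqF.
- rewrite (_ : _ @^-1` _ = `](a - c) / r, (b - c) / r]%classic); last first.
    apply/seteqP; split=> x /=; rewrite !in_itv/=.
      by rewrite ler_pdivlMr// ltr_pdivrMr// => /andP[]; lra.
    by rewrite ler_pdivlMr// ltr_pdivrMr// => /andP[]; lra.
  rewrite lebesgue_measure_itv/= lte_fin ltr_pdivrMr// mulfVK ?gt_eqF//.
  rewrite ltrD2r; case: ifPn => ab; last by rewrite mule0.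
  rewrite -!EFinB -EFinM gtr0_norm//; congr EFin.
  by field; rewrite gt_eqF.
Qed.

Lemma ge0_integral_affine1 r c (h : R -> \bar R) : r != 0 ->
  measurable_fun [set: R] h -> (forall x, 0 <= h x)%E ->
  (\int[lebesgue_measure]_x h x =
   `|r|%:E * \int[lebesgue_measure]_x h (r * x + c)%R)%E.
Proof.
move=> r0 mh h0; have mf := measurable_affine r c.
pose m := mscale (NngNum (normr_ge0 r))
  (image_measure lebesgue_measure mf).
rewrite (eq_measure_integral m); last first.
  by move=> A mA _; apply: lebesgue_measure_affine.
by rewrite ge0_integral_mscale// ge0_integral_pushforward.
Qed.

End affine_line.

Section space.
Context {R : realType}.
Local Notation mu d := (@lebesgue_rV R d).
Local Open Scope ereal_scope.

Lemma measurable_rV_affine d (r : R) (c : 'rV[R]_d) :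
  measurable_fun setT (fun x : 'rV[R]_d => (r *: x + c)%R).
Proof.
apply: measurable_fun_mx => i j.
under eq_fun do rewrite !mxE.
by apply: measurable_funD => //; apply: measurable_funM => //; exact: measurable_coord.
Qed.

Lemma ge0_integral_cons d (h : 'rV[R]_d.+1 -> \bar R) :
  measurable_fun setT h -> (forall x, 0 <= h x) ->
  \int[mu d.+1]_x h x = \int[lebesgue_measure]_a \int[mu d]_v h (cons_rV (a, v)).
Proof.
move=> mh h0.
rewrite (_ : \int[mu d.+1]_x h x = \int[pushforward (lebesgue_measure \x mu d) (@cons_rV
    R d)]_x h x)//.
rewrite ge0_integral_pushforward//=.
  rewrite preimage_setT fubini_tonelli1 //.
  by apply: measurableT_comp => //; exact: measurable_cons_rV.
exact: measurable_cons_rV.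
Qed.

(** Induction on d, splitting off the leading coordinate.  Translations,
    reflections and dilations are the only changes of variables on R^d used
    below. *)
Lemma ge0_integral_affine d (r : R) (c : 'rV[R]_d) (h : 'rV[R]_d -> \bar R) : r != 0%R ->
  measurable_fun setT h -> (forall x, 0 <= h x) ->
  \int[mu d]_x h x = (`|r| ^+ d)%:E * \int[mu d]_x h (r *: x + c)%R.
Proof.
move=> r0; elim: d c h => [|d IH] c h mh h0.
  rewrite expr0 mul1e; apply: eq_integral => x _; congr h.
  by apply/rowP => -[].
pose c' := (\row_j c 0 (lift 0 j))%R : 'rV[R]_d.
have E a v : (r *: cons_rV (a, v) + c = cons_rV (r * a + c ord0 ord0, r *: v + c'))%R.
  apply/rowP => i; rewrite mxE [X in (X + _)%R]mxE.
  case: (unliftP 0%R i) => [j|] ->; first by rewrite !cons_rVS /= !mxE.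
  by rewrite !cons_rV0.
have mhc : measurable_fun setT (h \o @cons_rV R d).
  by apply: measurableT_comp => //; exact: measurable_cons_rV.
rewrite ge0_integral_cons// ge0_integral_cons//; last first.
  by apply: measurableT_comp => //; exact: measurable_rV_affine.
have mH : measurable_fun [set: R] (fun a : R => \int[mu d]_v h (cons_rV (a, v))).
  by apply: (measurable_fun_fubini_tonelli_F (h \o @cons_rV R d)) => //= x.
rewrite (@ge0_integral_affine1 _ r (c ord0 ord0) _ r0 mH); last first.
  by move=> a; apply: integral_ge0.
rewrite exprS EFinM -muleA; congr (_ * _).
rewrite -ge0_integralZl//; last 2 first.
- apply: (measurable_fun_fubini_tonelli_F (fun p => h (r *: cons_rV p + c)%R)) => //.
  apply: (measurableT_comp mh).
  apply: (measurableT_comp (measurable_rV_affine r c)).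
  exact: measurable_cons_rV.
- by move=> a _; apply: integral_ge0.
apply: eq_integral => a _.
rewrite (IH c')//; last first.
  by apply: (measurableT_comp mhc); exact: measurable_pair1.
by congr (_ * _); apply: eq_integral => v _; rewrite E.
Qed.

(** No integrability is needed: the positive and the negative part are
    transported separately. *)
Lemma integral_shift d (c : 'rV[R]_d) (h : 'rV[R]_d -> \bar R) :
  measurable_fun setT h ->
  \int[mu d]_x h (x + c)%R = \int[mu d]_x h x.
Proof.
move=> mh; rewrite integralE [RHS]integralE.
have key (k : 'rV[R]_d -> \bar R) : measurable_fun setT k -> (forall x, 0 <= k x) ->
    \int[mu d]_x k (x + c)%R = \int[mu d]_x k x.
  move=> mk k0; rewrite [RHS](ge0_integral_affine c (oner_neq0 R))// normr1 expr1n mul1e.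
  by apply: eq_integral => x _; rewrite scale1r.
congr (_ - _).
  rewrite -(key _ (measurable_funepos mh) (fun x => funepos_ge0 h x)).
  by apply: eq_integral => x _; rewrite !funeposE.
rewrite -(key _ (measurable_funeneg mh) (fun x => funeneg_ge0 h x)).
by apply: eq_integral => x _; rewrite !funenegE.
Qed.

Lemma integral_reflect d (c : 'rV[R]_d) (h : 'rV[R]_d -> \bar R) :
  measurable_fun setT h ->
  \int[mu d]_x h (c - x)%R = \int[mu d]_x h x.
Proof.
move=> mh; rewrite integralE [RHS]integralE.
have key (k : 'rV[R]_d -> \bar R) : measurable_fun setT k -> (forall x, 0 <= k x) ->
    \int[mu d]_x k (c - x)%R = \int[mu d]_x k x.
  move=> mk k0; have N1 : (- 1 != 0 :> R)%R by rewrite oppr_eq0 oner_neq0.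
  rewrite [RHS](ge0_integral_affine c N1)//.
  rewrite normrN normr1 expr1n mul1e.
  by apply: eq_integral => x _; rewrite scaleN1r addrC.
congr (_ - _).
  rewrite -(key _ (measurable_funepos mh) (fun x => funepos_ge0 h x)).
  by apply: eq_integral => x _; rewrite !funeposE.
rewrite -(key _ (measurable_funeneg mh) (fun x => funeneg_ge0 h x)).
by apply: eq_integral => x _; rewrite !funenegE.
Qed.

End space.

(** * Measurability of open sets; the weight 1 + |x| *)

Section open_measurable.
Context {R : realType}.

(** The measurable structures of R^d and of phase space are generated by
    coordinates; their open sets are measurable because they are countable
    unions of balls centred at rational points.  The balls are a parameter so
    that the argument serves both spaces. *)
Lemma separable_open_measurable dd (T : measurableType dd) (I : countType)
    (ball : T -> R -> T -> Prop) (q : I -> T) (U : set T) :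
  (forall x y z e1 e2, ball x e1 y -> ball y e2 z -> ball x (e1 + e2) z) ->
  (forall x y e, ball x e y -> ball y e x) ->
  (forall x (e1 e2 : R), e1 <= e2 -> ball x e1 `<=` ball x e2) ->
  (forall x (e : R), 0 < e -> exists i, ball x e (q i)) ->
  (forall i (e : R), 0 < e -> measurable (ball (q i) e)) ->
  (forall x, U x -> exists2 e : R, 0 < e & ball x e `<=` U) ->
  measurable U.
Proof.
move=> btri bsym ble qdense mball Uopen.
have -> : U = \bigcup_(p in [set p : I * nat | ball (q p.1) p.2.+1%:R^-1 `<=` U])
    ball (q p.1) p.2.+1%:R^-1.
  apply/seteqP; split=> [x Ux|x [p /= pU bx]]; last exact: pU.
  have [e e0 xeU] := Uopen _ Ux.
  have e2 : 0 < e / 2 by rewrite divr_gt0.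
  have [n _ /(_ n (leqnn n))/= ne] := near_infty_natSinv_lt (PosNum e2).
  have n0 : 0 < n.+1%:R^-1 :> R by rewrite invr_gt0.
  have [i xqi] := qdense x _ n0.
  exists (i, n) => /=; last exact: bsym.
  move=> y qy; apply/xeU/(ble _ (n.+1%:R^-1 + n.+1%:R^-1)).
    by rewrite [leRHS](splitr e) lerD// ltW.
  exact: btri qy.
rewrite bigcup_mkcond; apply: countable_bigcupT_measurable.
  exact: countableP.
move=> p; case: ifPn => // _; apply: mball.
by rewrite invr_gt0.
Qed.

Lemma rV_ball_measurable d (c : 'rV[R]_d) (e : R) : measurable (ball c e).
Proof.
have [e0|e0] := ltP 0 e; last first.
  rewrite (_ : ball c e = set0)//; apply/seteqP; split=> // x [e1 _].
  by move: e1; rewrite ltNge e0.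
rewrite (_ : ball c e = \bigcap_(i in [set: 'I_d]) [set x | ball (c 0 i) e (x 0 i)]).
  apply: fin_bigcap_measurable => // i _.
  rewrite -[X in measurable X]setTI.
  exact: (@measurable_coord _ R 1 d 0 i measurableT _ (measurable_ball (c 0 i) e)).
apply/seteqP; split=> [x [_ H] i _|x H]; first exact: H.
by split=> // i j; rewrite ord1; exact: H.
Qed.

Lemma rV_ball_dense d (c : 'rV[R]_d) (e : R) : 0 < e ->
  exists q : 'rV[rat]_d, ball c e (map_mx ratr q).
Proof.
move=> e0.
have H i : exists q : rat, ball (c 0 i) e (ratr q).
  have /rat_in_itvoo[q] : c 0 i - e < c 0 i + e by lra.
  rewrite in_itv/= => /andP[? ?]; exists q.
  by rewrite /ball/= ltr_distlC; apply/andP; split; lra.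
exists (\row_i projT1 (cid (H i))); split=> // i j; rewrite ord1 !mxE.
by case: cid.
Qed.

Lemma rV_open_measurable d (U : set 'rV[R]_d) : open U -> measurable U.
Proof.
move=> oU.
refine (@separable_open_measurable _ 'rV[R]_d 'rV[rat]_d (fun (x : 'rV[R]_d) e => ball x
    e) (map_mx ratr) U _ _ _ _ _ _).
- by move=> *; apply: ball_triangle; eassumption.
- by move=> *; exact: ball_sym.
- by move=> *; exact: le_ball.
- by move=> *; exact: rV_ball_dense.
- by move=> *; exact: rV_ball_measurable.
- move=> x Ux; have /nbhs_ballP[e e0 H] := open_nbhs_nbhs (conj oU Ux).
  by exists e.
Qed.

Lemma phase_open_measurable d (U : set ('rV[R]_d * 'rV[R]_d)) :
  open U -> measurable U.
Proof.
move=> oU.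
refine (@separable_open_measurable _ ('rV[R]_d * 'rV[R]_d)%type ('rV[rat]_d *
    'rV[rat]_d)%type
  (fun (x : 'rV[R]_d * 'rV[R]_d) e => ball x e)
  (fun q => (map_mx ratr q.1, map_mx ratr q.2)) U _ _ _ _ _ _).
- by move=> *; apply: ball_triangle; eassumption.
- by move=> *; exact: ball_sym.
- by move=> *; exact: le_ball.
- move=> [x y] e e0; have [q1 H1] := rV_ball_dense x e0.
  by have [q2 H2] := rV_ball_dense y e0; exists (q1, q2); split.
- move=> [q1 q2] e e0.
  rewrite [X in measurable X](_ : _ =
    ball (map_mx ratr q1 : 'rV[R]_d) e `*` ball (map_mx ratr q2 : 'rV[R]_d) e)//.
  by apply: measurableX; exact: rV_ball_measurable.
- move=> x Ux; have /nbhs_ballP[e e0 H] := open_nbhs_nbhs (conj oU Ux).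
  by exists e.
Qed.

Lemma open_continuous_measurable_comp dd (T : measurableType dd) (X : topologicalType)
    (c : T -> X) (f : X -> R) :
  (forall U : set X, open U -> measurable (c @^-1` U)) ->
  continuous f -> measurable_fun setT (f \o c).
Proof.
move=> oM cf; apply: (measurability _ (RGenOInfty.measurableE R)) => //.
move=> _ [_ [a ->] <-]; rewrite setTI comp_preimage; apply: oM.
by apply: open_comp => // x _; exact: cf.
Qed.

Lemma rV_continuous_measurable_fun d (f : 'rV[R]_d -> R) :
  continuous f -> measurable_fun setT f.
Proof.
move=> cf; apply: (@open_continuous_measurable_comp _ _ 'rV[R]_d id f) => // U.
exact: rV_open_measurable.
Qed.

End open_measurable.

Section weights.
Context {R : realType}.
Local Notation mu d := (@lebesgue_rV R d).

(** A weight equivalent to the Japanese bracket of x.  It is at least 1 and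
    submultiplicative (bracketD), which replaces any discussion of whether x is
    small or large. *)
Definition bracket (V : normedZmodType R) (x : V) : R := 1 + `|x|.

Lemma bracket_ge1 (V : normedZmodType R) (x : V) : 1 <= bracket x.
Proof. by rewrite /bracket lerDl. Qed.

Lemma bracket_gt0 (V : normedZmodType R) (x : V) : 0 < bracket x.
Proof. exact: lt_le_trans (bracket_ge1 x). Qed.

Lemma bracket_ge0 (V : normedZmodType R) (x : V) : 0 <= bracket x.
Proof. exact: ltW (bracket_gt0 x). Qed.

Lemma bracketN (V : normedZmodType R) (x : V) : bracket (- x) = bracket x.
Proof. by rewrite /bracket normrN. Qed.

Lemma bracketD (V : normedZmodType R) (x y : V) :
  bracket (x + y) <= bracket x * bracket y.
Proof.
rewrite /bracket; have := ler_normD x y.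
have := mulr_ge0 (normr_ge0 x) (normr_ge0 y); nra.
Qed.

Lemma bracket_exp_le (V : normedZmodType R) (x : V) m n : (m <= n)%N ->
  (bracket x ^+ n)^-1 <= (bracket x ^+ m)^-1.
Proof.
move=> mn; rewrite lef_pV2 ?posrE ?exprn_gt0 ?bracket_gt0//.
by rewrite ler_weXn2l// bracket_ge1.
Qed.

Lemma rV_coord_le_norm d (x : 'rV[R]_d) i : `|x 0 i| <= `|x|.
Proof.
have : `|x 0 i| <= mx_norm x; last by [].
by rewrite mx_normrE; exact: (le_bigmax _ (fun ij => `|x ij.1 ij.2|) (0, i)).
Qed.

End weights.

(** * Integrals of products of one-variable functions *)

Section product_integrals.
Context {R : realType}.
Local Notation mu d := (@lebesgue_rV R d).

Lemma measurable_rV_prod d (phi : R -> R) : measurable_fun setT phi ->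
  measurable_fun setT (fun x : 'rV[R]_d => \prod_(i < d) phi (x 0 i)).
Proof.
move=> mphi; elim: (index_enum _) => [|i s IH].
  by under eq_fun do rewrite big_nil; exact: measurable_cst.
under eq_fun do rewrite big_cons.
by apply: measurable_funM => //; apply: (measurableT_comp mphi); exact: measurable_coord.
Qed.

Lemma ge0_integral_rV_prod d (phi : R -> R) (I : R) :
  measurable_fun setT phi -> (forall t, 0 <= phi t) ->
  (\int[lebesgue_measure]_t (phi t)%:E = I%:E)%E ->
  (\int[mu d]_x (\prod_(i < d) phi (x 0 i))%:E = (I ^+ d)%:E)%E.
Proof.
move=> mphi phi0 phiI; have mp n := @measurable_rV_prod n phi mphi.
elim: d => [|d IH].
  rewrite integral_dirac//= ?diracT ?mul1e ?big_ord0//.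
  by apply/measurable_EFinP; exact: mp.
rewrite ge0_integral_cons//; first last.
- by move=> x; rewrite lee_fin prodr_ge0.
- by apply/measurable_EFinP; exact: mp.
under eq_integral => a _.
  under eq_integral => v _.
    rewrite big_ord_recl cons_rV0 /=.
    under eq_bigr do rewrite cons_rVS /=.
    rewrite EFinM.
    over.
  rewrite ge0_integralZl//; first last.
  - by rewrite lee_fin.
  - by move=> x _; rewrite lee_fin prodr_ge0.
  - by apply/measurable_EFinP; exact: mp.
  rewrite IH.
  over.
rewrite ge0_integralZr//; first last.
- have : 0 <= I by rewrite -lee_fin -phiI; apply: integral_ge0 => x _; rewrite lee_fin.
  by move=> I0; rewrite lee_fin exprn_ge0.
- by move=> x _; rewrite lee_fin.
- exact/measurable_EFinP.
by rewrite phiI -EFinM exprS.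
Qed.

Lemma integral_oneDsqrV :
  (\int[@lebesgue_measure R]_t ((1 + t ^+ 2)^-1)%:E = (@pi R)%:E)%E.
Proof.
have ge0 (x : R) : 0 <= (1 + x ^+ 2)^-1.
  by rewrite invr_ge0 addr_ge0// sqr_ge0.
rewrite (ge0_symfun_integralT ge0); first last.
- by move=> x /=; rewrite sqrrN.
- exact: continuous_oneDsqrV.
rewrite (_ : [set x | 0 <= x] = `[0, +oo[%classic); last by rewrite set_itvcy.
by rewrite (@integral0y_oneDsqr R) -EFinM mulrC divfK.
Qed.

Lemma oneDsqrV_measurable : measurable_fun setT (fun t : R => (1 + t ^+ 2)^-1).
Proof. by apply: continuous_measurable_fun; exact: continuous_oneDsqrV. Qed.

Lemma continuous_bracketV (V : normedModType R) m :
  continuous (fun x : V => (bracket x ^+ m)^-1).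
Proof.
move=> x; apply: cvgV; first by rewrite expf_neq0// gt_eqF// bracket_gt0.
apply: (@continuous_comp _ _ _ (@bracket _ V) (fun t : R => t ^+ m)).
  by apply: cvgD; [exact: cvg_cst|exact: norm_continuous].
exact: exprn_continuous.
Qed.

Lemma measurable_bracketV d m :
  measurable_fun setT (fun x : 'rV[R]_d => (bracket x ^+ m)^-1).
Proof. by apply: rV_continuous_measurable_fun; exact: continuous_bracketV. Qed.

Lemma bracket_pair_le d (p q : 'rV[R]_d) : bracket ((p, q) : 'rV[R]_d * 'rV[R]_d) <=
    bracket p * bracket q.
Proof.
rewrite /bracket prod_normE /=.
have := normr_ge0 p; have := normr_ge0 q => q0 p0.
have := mulr_ge0 p0 q0.
by case: (leP `|p| `|q|) => _; nra.
Qed.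

Lemma measurable_bracketV_pair d m (z : 'rV[R]_d * 'rV[R]_d) :
  measurable_fun setT (fun w : 'rV[R]_d * 'rV[R]_d => (bracket (w - z) ^+ m)^-1).
Proof.
apply: (@open_continuous_measurable_comp _ _ _ ('rV[R]_d * 'rV[R]_d)%type id
  (fun w : 'rV[R]_d * 'rV[R]_d => (bracket (w - z) ^+ m)^-1)) => [U|w].
  exact: phase_open_measurable.
apply: (@continuous_comp _ _ _ (fun w : 'rV[R]_d * 'rV[R]_d => w - z) (fun w => (bracket
    w ^+ m)^-1)).
  by apply: cvgB; [exact: cvg_id|exact: cvg_cst].
exact: continuous_bracketV.
Qed.

(** Comparison with a product reduces integrability of the weight over R^d to
    that of 1 / (1 + t ^ 2) over R. *)
Lemma bracket_le_prod d (x : 'rV[R]_d) :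
  (bracket x ^+ (2 * d))^-1 <= \prod_(i < d) (1 + x 0 i ^+ 2)^-1.
Proof.
rewrite prodfV lef_pV2 ?posrE ?exprn_gt0 ?bracket_gt0//; last first.
  by apply: prodr_gt0 => i _; rewrite ltr_wpDr// sqr_ge0.
rewrite exprM -[X in _ <= _ ^+ X](card_ord d) -prodr_const.
apply: ler_prod => i _; rewrite addr_ge0 ?sqr_ge0//=.
have := rV_coord_le_norm x i; rewrite /bracket -[x 0 i ^+ 2]real_normK ?num_real//.
by have := normr_ge0 (x 0 i); nra.
Qed.

Lemma integral_bracket_lty d m : (2 * d <= m)%N ->
  (\int[mu d]_x ((bracket x ^+ m)^-1)%:E < +oo)%E.
Proof.
move=> dm.
apply: (@le_lt_trans _ _ (\int[mu d]_x (\prod_(i < d) (1 + x 0 i ^+ 2)^-1)%:E)%E).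
  apply: ge0_le_integral => //.
  - by move=> x _; rewrite lee_fin invr_ge0 exprn_ge0 ?bracket_ge0.
  - by apply/measurable_EFinP; exact: measurable_bracketV.
  - apply/measurable_EFinP.
    exact: (@measurable_rV_prod d _ oneDsqrV_measurable).
  - move=> x _; rewrite lee_fin; apply: le_trans (bracket_le_prod x).
    exact: bracket_exp_le.
rewrite (ge0_integral_rV_prod d oneDsqrV_measurable _ integral_oneDsqrV) ?ltry//.
by move=> t; rewrite invr_ge0 addr_ge0 ?sqr_ge0.
Qed.

Lemma integral_bracketM_lty d (C : R) m : 0 <= C -> (2 * d <= m)%N ->
  (\int[mu d]_t (C * (bracket t ^+ m)^-1)%:E < +oo)%E.
Proof.
move=> C0 dm; under eq_integral do rewrite EFinM.
rewrite ge0_integralZl//; last 2 first.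
- by apply/measurable_EFinP; exact: measurable_bracketV.
- by move=> t _; rewrite lee_fin invr_ge0 exprn_ge0 ?bracket_ge0.
by apply: lte_mul_pinfty => //; exact: integral_bracket_lty.
Qed.

End product_integrals.

(** * Complex-valued functions and their integrals *)

Section complex_values.
Context {R : realType}.
Local Open Scope complex_scope.
Local Notation Re := complex.Re.
Local Notation Im := complex.Im.
Local Notation normc := Normc.normc.
Implicit Types x y : R[i].

Lemma complex_ext x y : Re x = Re y -> Im x = Im y -> x = y.
Proof. by case: x => a b; case: y => a' b' /= -> ->. Qed.

Lemma ReM x y : Re (x * y) = Re x * Re y - Im x * Im y.
Proof. by case: x; case: y. Qed.

Lemma ImM x y : Im (x * y) = Re x * Im y + Im x * Re y.
Proof. by case: x; case: y. Qed.

Lemma ReMr x (r : R) : Re (x * r%:C) = Re x * r.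
Proof. by rewrite ReM /= mulr0 subr0. Qed.

Lemma ImMr x (r : R) : Im (x * r%:C) = Im x * r.
Proof. by rewrite ImM /= mulr0 add0r. Qed.

(** Two presentations of complex conjugation that share a notation. *)
Lemma num_conjE x : Num.conj x = conjc x. Proof. by []. Qed.

Lemma ReJ x : Re x^* = Re x. Proof. by case: x. Qed.

Lemma ImJ x : Im x^* = - Im x. Proof. by case: x. Qed.

Lemma normc_sqr x : normc x ^+ 2 = Re x ^+ 2 + Im x ^+ 2.
Proof. by case: x => a b /=; rewrite sqr_sqrtr// addr_ge0 ?sqr_ge0. Qed.

Lemma normc_ge0 x : 0 <= normc x.
Proof. by case: x => a b /=; exact: sqrtr_ge0. Qed.

Lemma conjcM (x y : R[i]) : conjc (x * y) = conjc x * conjc y.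
Proof. exact: (rmorphM (@conjc R)). Qed.

Lemma normcJ x : normc x^* = normc x.
Proof. by case: x => a b /=; rewrite sqrrN. Qed.

Lemma Re_le_normc x : `|Re x| <= normc x.
Proof.
rewrite -(@ler_pXn2r _ 2)// ?nnegrE ?normc_ge0//.
by rewrite normc_sqr real_normK ?num_real// lerDl sqr_ge0.
Qed.

Lemma Im_le_normc x : `|Im x| <= normc x.
Proof.
rewrite -(@ler_pXn2r _ 2)// ?nnegrE ?normc_ge0//.
by rewrite normc_sqr real_normK ?num_real// lerDr sqr_ge0.
Qed.

Lemma normc_le_ReIm x : normc x <= `|Re x| + `|Im x|.
Proof.
rewrite -(@ler_pXn2r _ 2)// ?nnegrE ?normc_ge0 ?addr_ge0//.
rewrite normc_sqr sqrrD !real_normK ?num_real//.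
by rewrite -addrA lerD2l lerDr mulrn_wge0// mulr_ge0.
Qed.

Lemma normc_cis (t : R) : normc (cis t) = 1.
Proof. by rewrite /= cos2Dsin2 sqrtr1. Qed.

Lemma cisD (s t : R) : cis (s + t) = cis s * cis t.
Proof.
apply: complex_ext; rewrite ?ReM ?ImM /= ?cosD ?sinD//.
by rewrite addrC.
Qed.

Lemma cisN (t : R) : cis (- t) = (cis t)^*.
Proof. by rewrite /cis /= cosN sinN. Qed.

Lemma normc_real (r : R) : normc r%:C = `|r|.
Proof. by rewrite /= expr0n addr0 sqrtr_sqr. Qed.

End complex_values.

Section complex_integral.
Context {R : realType}.
Local Open Scope complex_scope.
Local Notation Re := complex.Re.
Local Notation Im := complex.Im.
Local Notation normc := Normc.normc.

Definition cmeasurable dd (T : measurableType dd) (F : T -> R[i]) :=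
  measurable_fun setT (fun x => Re (F x)) /\
  measurable_fun setT (fun x => Im (F x)).

Section cmeasurable.
Context dd (T : measurableType dd).
Implicit Types F G : T -> R[i].

Lemma cmeasurable_cst (c : R[i]) : cmeasurable (fun _ : T => c).
Proof. by split; exact: measurable_cst. Qed.

Lemma cmeasurableM F G : cmeasurable F -> cmeasurable G ->
  cmeasurable (fun x => F x * G x).
Proof.
move=> [F1 F2] [G1 G2]; split.
  under eq_fun do rewrite ReM.
  by apply: measurable_funB; apply: measurable_funM.
under eq_fun do rewrite ImM.
by apply: measurable_funD; apply: measurable_funM.
Qed.

Lemma cmeasurableJ F : cmeasurable F -> cmeasurable (fun x => (F x)^*).
Proof.
move=> [F1 F2]; split; first by under eq_fun do rewrite ReJ.
under eq_fun do rewrite ImJ.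
exact: measurableT_comp.
Qed.

Lemma cmeasurable_cis (h : T -> R) : measurable_fun setT h ->
  cmeasurable (fun x => cis (h x)).
Proof.
move=> mh; split => /=; apply: measurableT_comp => //.
  by apply: continuous_measurable_fun; exact: continuous_cos.
by apply: continuous_measurable_fun; exact: continuous_sin.
Qed.

Lemma cmeasurable_real (h : T -> R) : measurable_fun setT h ->
  cmeasurable (fun x => (h x)%:C).
Proof. by move=> mh; split => //=; exact: measurable_cst. Qed.

Lemma measurable_normc F : cmeasurable F -> measurable_fun setT (fun x => normc (F x)).
Proof.
move=> [F1 F2].
rewrite (_ : (fun x => normc (F x)) =
    Num.sqrt \o (fun x => Re (F x) ^+ 2 + Im (F x) ^+ 2)); last first.
  by apply/funext => x /=; case: (F x).
apply: measurableT_comp.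
  by apply: continuous_measurable_fun; exact: sqrt_continuous.
by apply: measurable_funD; apply: measurable_funX.
Qed.

End cmeasurable.

Lemma cmeasurable_comp dd (T : measurableType dd) dd' (T' : measurableType dd')
    (F : T -> R[i]) (h : T' -> T) :
  cmeasurable F -> measurable_fun setT h -> cmeasurable (fun x => F (h x)).
Proof.
by move=> [F1 F2] mh; split; [exact: (measurableT_comp F1 mh)|exact: (measurableT_comp F2
    mh)].
Qed.

Definition cint dd (T : measurableType dd) (mu : {measure set T -> \bar R}) (F : T ->
    R[i]) : R[i] :=
  (\int[mu]_x Re (F x))%R +i* (\int[mu]_x Im (F x))%R.

Definition cintegrable dd (T : measurableType dd) (mu : {measure set T -> \bar R}) (F : T
    -> R[i]) :=
  cmeasurable F /\ (\int[mu]_x (normc (F x))%:E < +oo)%E.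

Section cint.
Context dd (T : measurableType dd) (mu : {measure set T -> \bar R}).
Implicit Types F G : T -> R[i].

Lemma ge0_le_integral_EFin (f g : T -> R) :
  measurable_fun setT f -> measurable_fun setT g -> (forall x, 0 <= f x) ->
  (forall x, f x <= g x) -> (\int[mu]_x (f x)%:E <= \int[mu]_x (g x)%:E)%E.
Proof.
move=> mf mg f0 fg; apply: ge0_le_integral => //.
- by move=> x _; rewrite lee_fin.
- exact/measurable_EFinP.
- exact/measurable_EFinP.
- by move=> x _; rewrite lee_fin.
Qed.

Lemma cintegrable_Re F : cintegrable mu F -> mu.-integrable setT (fun x => (Re (F x))%:E).
Proof.
move=> [mF iF]; apply/integrableP; split; first by apply/measurable_EFinP; case: mF.
apply: le_lt_trans iF; apply: ge0_le_integral_EFin => //.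
- by apply: measurableT_comp => //; case: mF.
- exact: measurable_normc.
- by move=> x; exact: Re_le_normc.
Qed.

Lemma cintegrable_Im F : cintegrable mu F -> mu.-integrable setT (fun x => (Im (F x))%:E).
Proof.
move=> [mF iF]; apply/integrableP; split; first by apply/measurable_EFinP; case: mF.
apply: le_lt_trans iF; apply: ge0_le_integral_EFin => //.
- by apply: measurableT_comp => //; case: mF.
- exact: measurable_normc.
- by move=> x; exact: Im_le_normc.
Qed.

Lemma le_cintegrable F (h : T -> R) : cmeasurable F -> measurable_fun setT h ->
  (forall x, normc (F x) <= h x) -> (\int[mu]_x (h x)%:E < +oo)%E ->
  cintegrable mu F.
Proof.
move=> mF mh Fh ih; split => //; apply: le_lt_trans ih.
by apply: ge0_le_integral_EFin => //; [exact: measurable_normc|move=> x; exact: normc_ge0].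
Qed.

Lemma cintegrableJ F : cintegrable mu F -> cintegrable mu (fun x => (F x)^*).
Proof.
move=> [mF iF]; split; first exact: cmeasurableJ.
by under eq_integral do rewrite normcJ.
Qed.

Lemma cintMl c F : cintegrable mu F -> cint mu (fun x => c * F x) = c * cint mu F.
Proof.
move=> iF; have iR := cintegrable_Re iF; have iI := cintegrable_Im iF.
apply: complex_ext; rewrite ?ReM ?ImM /=.
- under eq_Rintegral do rewrite ReM.
  rewrite RintegralB//; last 2 first.
  + exact: (integrableZl measurableT (Re c) iR).
  + exact: (integrableZl measurableT (Im c) iI).
  by rewrite !RintegralZl.
- under eq_Rintegral do rewrite ImM.
  rewrite RintegralD//; last 2 first.
  + exact: (integrableZl measurableT (Re c) iI).
  + exact: (integrableZl measurableT (Im c) iR).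
  by rewrite !RintegralZl.
Qed.

Lemma eq_cint F G : F =1 G -> cint mu F = cint mu G.
Proof. by move=> FG; congr cint; apply/funext. Qed.

Lemma cintMr c F : cintegrable mu F -> cint mu (fun x => F x * c) = cint mu F * c.
Proof.
move=> iF; rewrite mulrC -cintMl//; apply: eq_cint => x; exact: mulrC.
Qed.

Lemma cintJ F : cintegrable mu F -> cint mu (fun x => (F x)^*) = (cint mu F)^*.
Proof.
move=> iF; apply: complex_ext; rewrite ?ReJ ?ImJ /=.
  by under eq_Rintegral do rewrite ReJ.
under eq_Rintegral do rewrite ImJ -mulN1r.
by rewrite RintegralZl ?mulN1r//; exact: cintegrable_Im.
Qed.

(** The factor 2 comes from estimating the real and imaginary parts
    separately. *)
Lemma normc_cint_le F : cmeasurable F ->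
  ((normc (cint mu F))%:E <= 2%:E * \int[mu]_x (normc (F x))%:E)%E.
Proof.
move=> mF; have [iF|] := ltP (\int[mu]_x (normc (F x))%:E)%E +oo%E; last first.
  by rewrite leye_eq => /eqP ->; rewrite gt0_muley ?leey// lte_fin.
have {mF iF} iF : cintegrable mu F by [].
have iR := cintegrable_Re iF; have iI := cintegrable_Im iF.
apply: (@le_trans _ _ (`|Re (cint mu F)|%:E + `|Im (cint mu F)|%:E)%E).
  by rewrite -EFinD lee_fin normc_le_ReIm.
rewrite mule_natl mule2n /= !EFin_normr_Rintegral//; apply: leeD.
  apply: le_trans (le_abse_integral _ _ _) _ => //; first exact: measurable_int iR.
  apply: ge0_le_integral_EFin => //.
  - by apply: measurableT_comp => //; case: iF => -[].
  - by apply: measurable_normc; case: iF.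
  - by move=> x; exact: Re_le_normc.
apply: le_trans (le_abse_integral _ _ _) _ => //; first exact: measurable_int iI.
apply: ge0_le_integral_EFin => //.
- by apply: measurableT_comp => //; case: iF => -[].
- by apply: measurable_normc; case: iF.
- by move=> x; exact: Im_le_normc.
Qed.

Lemma Rintegral_dct (f_ : nat -> T -> R) (f h : T -> R) :
  (forall n, measurable_fun setT (f_ n)) -> measurable_fun setT f ->
  (forall x, f_ ^~ x @ \oo --> f x) ->
  measurable_fun setT h -> (\int[mu]_x (h x)%:E < +oo)%E ->
  (forall n x, `|f_ n x| <= h x) ->
  (\int[mu]_x f_ n x)%R @[n --> \oo] --> (\int[mu]_x f x)%R.
Proof.
move=> mf_ mf cf mh ih fh.
have ihI : mu.-integrable setT (EFin \o h).
  apply/integrableP; split; first exact/measurable_EFinP.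
  rewrite (eq_integral (fun x => (h x)%:E))// => x _ /=.
  by rewrite ger0_norm// (le_trans _ (fh 0%N x)).
have mE n : measurable_fun setT (EFin \o f_ n) by exact/measurable_EFinP.
have mfE : measurable_fun setT (EFin \o f) by exact/measurable_EFinP.
have cE : {ae mu, forall x, setT x -> (EFin \o f_ n) x @[n --> \oo] --> (EFin \o f) x}.
  by apply: aeW => x _; apply/fine_cvgP; split; [exact: nearW|exact: cf].
have bE : {ae mu, forall x n, setT x -> (`|(EFin \o f_ n) x| <= (EFin \o h) x)%E}.
  by apply: aeW => x n _; rewrite lee_fin.
have [iF _ H] := dominated_convergence measurableT mE mfE cE ihI bE.
apply: fine_cvg; rewrite fineK//; exact: integrable_fin_num.
Qed.

End cint.
End complex_integral.

(** * Integrals depending on a parameter, and the Fubini theorem *)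

Section parametric_integral.
Context {R : realType}.
Local Open Scope complex_scope.
Local Notation Re := complex.Re.
Local Notation Im := complex.Im.
Local Notation normc := Normc.normc.
Context d1 d2 (T1 : measurableType d1) (T2 : measurableType d2).

Lemma measurable_Rintegral2 (m2 : {sigma_finite_measure set T2 -> \bar R})
    (f : T1 * T2 -> R) : measurable_fun setT f ->
  measurable_fun setT (fun x => (\int[m2]_y f (x, y))%R).
Proof.
move=> mf; apply: (measurableT_comp (fine_measurable measurableT)).
rewrite (_ : (fun x => _) = ((fun x => \int[m2]_y (EFin \o f)^\+ (x, y)) \-
    (fun x => \int[m2]_y (EFin \o f)^\- (x, y)))%E); last first.
  apply/funext => x; rewrite integralE; congr (_ - _)%E.
    by apply: eq_integral => y _; rewrite !funeposE.
  by apply: eq_integral => y _; rewrite !funenegE.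
have mEf : measurable_fun setT (EFin \o f) by exact/measurable_EFinP.
apply: emeasurable_funB.
  apply: (measurable_fun_fubini_tonelli_F ((EFin \o f)^\+)%E) => //.
  exact: measurable_funepos.
apply: (measurable_fun_fubini_tonelli_F ((EFin \o f)^\-)%E) => //.
exact: measurable_funeneg.
Qed.

Lemma cmeasurable_cint (m2 : {sigma_finite_measure set T2 -> \bar R})
    (F : T1 * T2 -> R[i]) : cmeasurable F ->
  cmeasurable (fun x => cint m2 (fun y => F (x, y))).
Proof.
by move=> [mF1 mF2]; split => /=; [exact: (measurable_Rintegral2 m2 mF1)
                                  |exact: (measurable_Rintegral2 m2 mF2)].
Qed.

Variables (m1 : {sigma_finite_measure set T1 -> \bar R})
          (m2 : {sigma_finite_measure set T2 -> \bar R}).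

(** The inner integral may be infinite on a null set, where its real value is
    0 by convention; this does not affect the outer integral. *)
Lemma Rintegral_fubini (f : T1 * T2 -> R) :
  (m1 \x m2)%E.-integrable setT (EFin \o f) ->
  (\int[m1]_x \int[m2]_y f (x, y))%R = (\int[m2]_y \int[m1]_x f (x, y))%R.
Proof.
move=> intf; have mf : measurable_fun setT f.
  by apply/measurable_EFinP; exact: measurable_int intf.
congr fine.
transitivity (\int[m1]_x \int[m2]_y (f (x, y))%:E)%E.
  apply: ae_eq_integral => //.
  - by apply/measurable_EFinP; exact: measurable_Rintegral2.
  - exact: (measurable_fubini_F intf).
  - apply: filterS (ae_integrable1 intf) => x /= ix _.
    by rewrite fineK//; exact: integrable_fin_num ix.
rewrite (Fubini intf); apply: ae_eq_integral => //.
- exact: (measurable_fubini_G intf).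
- apply/measurable_EFinP; apply: (measurableT_comp (fine_measurable measurableT)).
  exact: (measurable_fubini_G intf).
- apply: filterS (ae_integrable2 intf) => y /= iy _.
  by rewrite fineK//; exact: integrable_fin_num iy.
Qed.

Lemma cint_fubini (F : T1 * T2 -> R[i]) : cmeasurable F ->
  (\int[m1]_x \int[m2]_y (normc (F (x, y)))%:E < +oo)%E ->
  cint m1 (fun x => cint m2 (fun y => F (x, y))) =
  cint m2 (fun y => cint m1 (fun x => F (x, y))).
Proof.
move=> mF iF.
have I : cintegrable (m1 \x m2)%E F.
  split => //; rewrite fubini_tonelli1//.
    by apply/measurable_EFinP; exact: measurable_normc.
  by move=> x; rewrite lee_fin normc_ge0.
apply: complex_ext => /=.
  exact: (@Rintegral_fubini (fun p => Re (F p)) (cintegrable_Re I)).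
exact: (@Rintegral_fubini (fun p => Im (F p)) (cintegrable_Im I)).
Qed.

End parametric_integral.

Section space_change_of_variables.
Context {R : realType}.
Local Open Scope complex_scope.
Local Notation Re := complex.Re.
Local Notation Im := complex.Im.
Local Notation normc := Normc.normc.
Local Notation mu d := (@lebesgue_rV R d).

Lemma cint_shift d (c : 'rV[R]_d) (F : 'rV[R]_d -> R[i]) : cmeasurable F ->
  cint (mu d) (fun x => F (x + c)) = cint (mu d) F.
Proof.
move=> [F1 F2]; apply: complex_ext; congr fine.
  by apply: (@integral_shift _ _ c (fun x => (Re (F x))%:E)); exact/measurable_EFinP.
by apply: (@integral_shift _ _ c (fun x => (Im (F x))%:E)); exact/measurable_EFinP.
Qed.

Lemma cint_reflect d (c : 'rV[R]_d) (F : 'rV[R]_d -> R[i]) : cmeasurable F ->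
  cint (mu d) (fun x => F (c - x)) = cint (mu d) F.
Proof.
move=> [F1 F2]; apply: complex_ext; congr fine.
  by apply: (@integral_reflect _ _ c (fun x => (Re (F x))%:E)); exact/measurable_EFinP.
by apply: (@integral_reflect _ _ c (fun x => (Im (F x))%:E)); exact/measurable_EFinP.
Qed.

End space_change_of_variables.

(** * The Poisson kernel on the line *)

Section poisson_line.
Context {R : realType}.
Local Notation leb := (@lebesgue_measure R).

(* A primitive of exp(- x) (1 + cos(a x)). *)
Let prim (a x : R) : R :=
  expR (- x) * ((a * sin (a * x) - cos (a * x)) / (1 + a ^+ 2) - 1).

Let is_derive_prim (a x : R) : is_derive x (1 : R) (prim a) (expR (- x) * (1 + cos (a *
    x))).
Proof.
have da : 1 + a ^+ 2 != 0 by rewrite gt_eqF// ltr_pwDl// sqr_ge0.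
have H0 : is_derive x 1 (fun x : R => a * x) a.
  by apply: is_derive_eq; rewrite /GRing.scale/= mulr1.
have H1 : is_derive x 1 (fun x : R => - x) (-1) by apply: is_derive_eq.
have H2 : is_derive x 1 (fun x : R => expR (- x)) (expR (- x) * -1).
  exact: (@is_derive1_comp _ expR (fun x : R => - x)).
have H3 : is_derive x 1 (fun x : R => sin (a * x)) (cos (a * x) * a).
  exact: (@is_derive1_comp _ sin (fun x : R => a * x)).
have H4 : is_derive x 1 (fun x : R => cos (a * x)) (- sin (a * x) * a).
  exact: (@is_derive1_comp _ cos (fun x : R => a * x)).
rewrite /prim; apply: is_derive_eq; rewrite /GRing.scale/=.
by field.
Qed.

(** Adding 1 to the cosine makes the integrand nonnegative, so that the
    fundamental theorem of calculus applies directly on a half-line; the extra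
    term is subtracted in integral_expRNabs_cos. *)
Lemma integral0y_expR_cos (a : R) :
  (\int[leb]_(x in `[0%R, +oo[) (expR (- x) * (1 + cos (a * x)))%:E =
   (1 + (1 + a ^+ 2)^-1)%:E)%E.
Proof.
have cf : continuous (fun x : R => expR (- x) * (1 + cos (a * x))).
  move=> x; apply: cvgM.
    by apply: (@continuous_comp _ _ _ -%R expR); [exact: opp_continuous|exact:
        continuous_expR].
  apply: cvgD; first exact: cvg_cst.
  by apply: (@continuous_comp _ _ _ ( *%R a) cos); [exact: mulrl_continuous|exact:
      continuous_cos].
rewrite (@ge0_continuous_FTC2y _ _ (prim a) _ 0).
- rewrite /prim mulr0 oppr0 expR0 sin0 cos0 mulr0 mul1r -EFinB; congr EFin.
  by field; rewrite gt_eqF// ltr_pwDl// sqr_ge0.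
- by move=> x _; rewrite mulr_ge0 ?expR_ge0//; have := cos_geN1 (a * x); lra.
- exact: continuous_subspaceT.
- apply: (@squeeze_cvgr _ _ _ _ (fun x => - ((`|a| + 2) * expR (- x)))
     (fun x => (`|a| + 2) * expR (- x))).
  + apply: nearW => x; rewrite -ler_norml /prim [X in `|X|]mulrC normrM (ger0_norm
      (expR_ge0 _)).
    rewrite ler_wpM2r ?expR_ge0//.
    apply: le_trans (ler_normB _ _) _; rewrite normr1.
    rewrite (_ : `|a| + 2 = `|a| + 1 + 1); last by ring.
    rewrite lerD2r normrM normfV.
    have a1 : 1 <= `|1 + a ^+ 2| by rewrite ger0_norm ?addr_ge0 ?sqr_ge0// lerDl sqr_ge0.
    rewrite ler_pdivrMr ?(lt_le_trans _ a1)//.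
    apply: (@le_trans _ _ (`|a| + 1)); last by rewrite ler_peMr// addr_ge0.
    apply: le_trans (ler_normB _ _) _; rewrite normrM lerD//.
      by rewrite ler_piMr// ler_norml sin_geN1 sin_le1.
    by rewrite ler_norml cos_geN1 cos_le1.
  + rewrite -[X in _ --> X]oppr0 -[X in - X](mulr0 (`|a| + 2)).
    by apply: cvgN; apply: cvgMr; exact: cvgr_expR.
  + rewrite -[X in _ --> X](mulr0 (`|a| + 2)).
    by apply: cvgMr; exact: cvgr_expR.
- by move=> x _; case: (is_derive_prim a x).
- apply: cvg_at_right_filter; apply: differentiable_continuous.
  by apply/derivable1_diffP; case: (is_derive_prim a 0).
- by move=> x _; rewrite derive1E; case: (is_derive_prim a x).
Qed.

Let integral_expR_cosD1 (a : R) :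
  (\int[leb]_x (expR (- `|x|) * (1 + cos (a * x)))%:E =
   (2 * (1 + (1 + a ^+ 2)^-1))%:E)%E.
Proof.
have ge0 (x : R) : 0 <= expR (- `|x|) * (1 + cos (a * x)).
  by rewrite mulr_ge0 ?expR_ge0//; have := cos_geN1 (a * x); lra.
rewrite (ge0_symfun_integralT ge0); first last.
- by move=> x /=; rewrite normrN mulrN cosN.
- move=> x; apply: cvgM.
    apply: (@continuous_comp _ _ _ (fun x : R => - `|x|) expR).
      by apply: cvgN; exact: norm_continuous.
    exact: continuous_expR.
  apply: cvgD; first exact: cvg_cst.
  by apply: (@continuous_comp _ _ _ ( *%R a) cos); [exact: mulrl_continuous|exact:
      continuous_cos].
rewrite (_ : [set x | 0 <= x] = `[0, +oo[%classic); last by rewrite set_itvcy.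
rewrite EFinM -integral0y_expR_cos; congr (_ * _)%E.
apply: eq_integral => x; rewrite inE/= in_itv/= andbT => x0.
by rewrite ger0_norm.
Qed.

Lemma continuous_expRNabs : continuous (fun x : R => expR (- `|x|)).
Proof.
move=> x; apply: (@continuous_comp _ _ _ (fun x : R => - `|x|) expR).
  by apply: cvgN; exact: norm_continuous.
exact: continuous_expR.
Qed.

Lemma measurable_expRNabs : measurable_fun setT (fun x : R => expR (- `|x|)).
Proof. by apply: continuous_measurable_fun; exact: continuous_expRNabs. Qed.

Lemma integral_expRNabs : (\int[leb]_x (expR (- `|x|))%:E = 2%:E)%E.
Proof.
have /esym := integral_expR_cosD1 0; rewrite expr0n addr0 invr1.
under eq_integral do rewrite mul0r cos0 EFinM.
rewrite ge0_integralZr//; first last.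
- by apply/measurable_EFinP; exact: measurable_expRNabs.
set I := (\int[_]_x _)%E => H.
have : I \is a fin_num.
  rewrite ge0_fin_numE; last by apply: integral_ge0 => x _; rewrite lee_fin expR_ge0.
  rewrite ltey; apply/eqP => Ioo; move: H; rewrite Ioo mulyr gtr0_sg//.
  by rewrite mul1e.
by move: H; case: I => // r /= [H] _; congr EFin; lra.
Qed.

Lemma integrable_expRNabs : leb.-integrable setT (fun x : R => (expR (- `|x|))%:E).
Proof.
apply/integrableP; split; first by apply/measurable_EFinP; exact: measurable_expRNabs.
under eq_integral do rewrite /= ger0_norm ?expR_ge0//.
by rewrite integral_expRNabs ltry.
Qed.

Lemma integral_expRNabs_cos (a : R) :
  (\int[leb]_x (expR (- `|x|) * cos (a * x))%:E = (2 * (1 + a ^+ 2)^-1)%:E)%E.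
Proof.
have mc : measurable_fun setT (fun x : R => cos (a * x)).
  apply: continuous_measurable_fun => x.
  by apply: (@continuous_comp _ _ _ ( *%R a) cos); [exact: mulrl_continuous|exact:
      continuous_cos].
have iC : leb.-integrable setT (fun x : R => (expR (- `|x|) * cos (a * x))%:E).
  apply: le_integrable integrable_expRNabs => //.
    by apply/measurable_EFinP; apply: measurable_funM => //; exact: measurable_expRNabs.
  move=> x _ /=; rewrite lee_fin normrM ler_piMr//.
  by rewrite ler_norml cos_geN1 cos_le1.
have := integral_expR_cosD1 a.
under eq_integral do rewrite mulrDr mulr1 EFinD.
rewrite (integralD measurableT integrable_expRNabs iC) integral_expRNabs.
have := integrable_fin_num measurableT iC.
set I := (\int[_]_x _)%E; case: I => // r _ [H]; congr EFin.
by move: H; rewrite mulrDr mulr1 => /addrI.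
Qed.

End poisson_line.

(** * Changes of variables for integrable functions *)

Section space_integrals.
Context {R : realType}.
Local Open Scope complex_scope.
Local Notation Re := complex.Re.
Local Notation Im := complex.Im.
Local Notation normc := Normc.normc.
Local Notation mu d := (@lebesgue_rV R d).

Lemma lty_pmull (k : R) (x : \bar R) : 0 < k -> (k%:E * x < +oo)%E = (x < +oo)%E.
Proof.
move=> k0; case: x => [r| |]; rewrite -?EFinM ?ltry//.
  by rewrite gt0_muley ?lte_fin.
by rewrite gt0_muleNy ?lte_fin.
Qed.

Lemma integral_cons d (h : 'rV[R]_d.+1 -> \bar R) :
  (mu d.+1).-integrable setT h ->
  (\int[mu d.+1]_x h x = \int[lebesgue_measure]_a \int[mu d]_v h (cons_rV (a, v)))%E.
Proof.
move=> ih; have mh := measurable_int _ ih.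
have mc := @measurable_cons_rV R d.
have ihc : (lebesgue_measure \x mu d)%E.-integrable setT (h \o @cons_rV R d).
  apply/integrableP; split; first exact: measurableT_comp.
  have /integrableP[_] := ih; apply: le_lt_trans.
  rewrite [leRHS](_ : _ = \int[image_measure (lebesgue_measure \x mu d)%E mc]_x `|h x|)%E//.
  rewrite ge0_integral_pushforward//.
  exact: measurableT_comp.
rewrite (_ : (\int[mu d.+1]_x h x = \int[image_measure (lebesgue_measure \x mu d) mc]_x h
    x)%E)//.
rewrite integral_pushforward// preimage_setT.
by rewrite -(integral12_prod_meas1 ihc).
Qed.

(** Integrability is used to subtract the integrals of the positive and
    negative parts after factoring out the determinant. *)
Lemma integral_affine d (r : R) (c : 'rV[R]_d) (h : 'rV[R]_d -> \bar R) :
  r != 0 -> (mu d).-integrable setT h ->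
  (\int[mu d]_x h x = (`|r| ^+ d)%:E * \int[mu d]_x h (r *: x + c)%R)%E.
Proof.
move=> r0 ih; have mh := measurable_int _ ih.
rewrite integralE [in RHS]integralE.
have rd : 0 < `|r| ^+ d by rewrite exprn_gt0// normr_gt0.
have Ep : (\int[mu d]_x h^\+ x = (`|r| ^+ d)%:E *
    \int[mu d]_x (fun x => h (r *: x + c)%R)^\+ x)%E.
  rewrite (ge0_integral_affine c r0)//; last exact: measurable_funepos.
  by congr (_ * _)%E; apply: eq_integral => x _; rewrite !funeposE.
have En : (\int[mu d]_x h^\- x = (`|r| ^+ d)%:E *
    \int[mu d]_x (fun x => h (r *: x + c)%R)^\- x)%E.
  rewrite (ge0_integral_affine c r0)//; last exact: measurable_funeneg.
  by congr (_ * _)%E; apply: eq_integral => x _; rewrite !funenegE.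
rewrite Ep En; apply/esym/muleBr => //; apply: fin_num_adde_defl; rewrite fin_numN.
have : (\int[mu d]_x h^\- x)%E \is a fin_num.
  by apply: integrable_neg_fin_num.
rewrite En !ge0_fin_numE ?mule_ge0 ?integral_ge0//=.
by rewrite lty_pmull.
Qed.

Lemma cintegrable_affine d (r : R) (c : 'rV[R]_d) (F : 'rV[R]_d -> R[i]) :
  r != 0 -> cintegrable (mu d) F -> cintegrable (mu d) (fun x => F (r *: x + c)).
Proof.
move=> r0 [mF iF]; split; first exact: cmeasurable_comp (measurable_rV_affine r c).
move: iF; rewrite (ge0_integral_affine c r0).
- by rewrite lty_pmull// exprn_gt0// normr_gt0.
- by apply/measurable_EFinP; exact: measurable_normc.
- by move=> x; rewrite lee_fin normc_ge0.
Qed.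

Lemma cint_affine d (r : R) (c : 'rV[R]_d) (F : 'rV[R]_d -> R[i]) :
  r != 0 -> cintegrable (mu d) F ->
  cint (mu d) F = (`|r| ^+ d)%:C * cint (mu d) (fun x => F (r *: x + c)).
Proof.
move=> r0 iF; have iFa := cintegrable_affine c r0 iF.
apply: complex_ext; rewrite ?ReM ?ImM /= mul0r ?subr0 ?addr0.
  rewrite /Rintegral (integral_affine c r0 (cintegrable_Re iF)) fineM//.
  exact: integrable_fin_num (cintegrable_Re iFa).
rewrite /Rintegral (integral_affine c r0 (cintegrable_Im iF)) fineM//.
exact: integrable_fin_num (cintegrable_Im iFa).
Qed.

End space_integrals.

(** * The Poisson kernel on R^d *)

Section dot_product.
Context {R : realType} (d : nat).
Implicit Types x y z : 'rV[R]_d.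

Lemma dotC x y : dot x y = dot y x.
Proof. by apply: eq_bigr => i _; exact: mulrC. Qed.

Lemma dotDl x y z : dot (x + y) z = dot x z + dot y z.
Proof. by rewrite -big_split; apply: eq_bigr => i _; rewrite mxE mulrDl. Qed.

Lemma dotZl (a : R) x z : dot (a *: x) z = a * dot x z.
Proof. by rewrite /dot mulr_sumr; apply: eq_bigr => i _; rewrite mxE mulrA. Qed.

Lemma dotNl x z : dot (- x) z = - dot x z.
Proof. by rewrite -scaleN1r dotZl mulN1r. Qed.

Lemma dotDr x y z : dot x (y + z) = dot x y + dot x z.
Proof. by rewrite dotC dotDl !(dotC x). Qed.

Lemma dotZr (a : R) x z : dot x (a *: z) = a * dot x z.
Proof. by rewrite dotC dotZl (dotC x). Qed.

Lemma dotNr x z : dot x (- z) = - dot x z.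
Proof. by rewrite dotC dotNl (dotC x). Qed.

Lemma measurable_dot dd (T : measurableType dd) (f g : T -> 'rV[R]_d) :
  measurable_fun setT f -> measurable_fun setT g ->
  measurable_fun setT (fun t => dot (f t) (g t)).
Proof.
move=> mf mg; rewrite /dot; elim: (index_enum _) => [|i s IH].
  by under eq_fun do rewrite big_nil; exact: measurable_cst.
under eq_fun do rewrite big_cons.
apply: measurable_funD => //; apply: measurable_funM.
  exact: (measurableT_comp (@measurable_coord _ R 1 d 0 i) mf).
exact: (measurableT_comp (@measurable_coord _ R 1 d 0 i) mg).
Qed.

Lemma measurable_dotl z : measurable_fun setT (fun x => dot x z).
Proof. by apply: measurable_dot => //; exact: measurable_cst. Qed.

Lemma measurable_dotr z : measurable_fun setT (dot z).
Proof. by apply: (@measurable_dot _ _ (cst z) id) => //; exact: measurable_cst. Qed.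

End dot_product.

Section poisson_space.
Context {R : realType}.
Local Notation mu d := (@lebesgue_rV R d).

(** Among the functions that can regularize a Fourier integral, this one has an
    elementary transform: a product of Poisson kernels in one variable each. *)
Definition poisson d (x : 'rV[R]_d) : R := expR (- \sum_(i < d) `|x 0 i|).

Lemma poissonE d (x : 'rV[R]_d) : poisson x = \prod_(i < d) expR (- `|x 0 i|).
Proof. by rewrite /poisson -sumrN expR_sum. Qed.

Lemma poisson_ge0 d (x : 'rV[R]_d) : 0 <= poisson x.
Proof. exact: expR_ge0. Qed.

Lemma poisson_le1 d (x : 'rV[R]_d) : poisson x <= 1.
Proof. by rewrite /poisson -expR0 ler_expR oppr_le0 sumr_ge0. Qed.

Lemma measurable_poisson d : measurable_fun setT (@poisson d).
Proof.
rewrite (_ : @poisson d = (fun x => \prod_(i < d) expR (- `|x 0 i|))).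
  by apply: (@measurable_rV_prod R d (fun t => expR (- `|t|))); exact: measurable_expRNabs.
by apply/funext => x; exact: poissonE.
Qed.

Lemma integral_poisson d : (\int[mu d]_x (poisson x)%:E = (2 ^+ d)%:E)%E.
Proof.
rewrite -(ge0_integral_rV_prod d measurable_expRNabs _ integral_expRNabs).
  by apply: eq_integral => x _; rewrite poissonE.
by move=> t; exact: expR_ge0.
Qed.

Lemma integrable_poissonM d (h : 'rV[R]_d -> R) : measurable_fun setT h ->
  (forall x, `|h x| <= 1) ->
  (mu d).-integrable setT (fun x => (poisson x * h x)%:E).
Proof.
move=> mh h1; apply/integrableP; split.
  by apply/measurable_EFinP; apply: measurable_funM => //; exact: measurable_poisson.
apply: (@le_lt_trans _ _ (\int[mu d]_x (poisson x)%:E)%E); last first.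
  by rewrite integral_poisson ltry.
apply: ge0_le_integral_EFin => //.
- apply: measurableT_comp => //.
  by apply: measurable_funM => //; exact: measurable_poisson.
- exact: measurable_poisson.
- by move=> x; rewrite normrM (ger0_norm (poisson_ge0 x)) ler_piMr// poisson_ge0.
Qed.

Let measurable_cos_dot d (r : 'rV[R]_d) : measurable_fun setT (fun x => cos (dot x r)).
Proof.
apply: measurableT_comp (measurable_dotl r).
by apply: continuous_measurable_fun; exact: continuous_cos.
Qed.

Let measurable_sin_dot d (r : 'rV[R]_d) : measurable_fun setT (fun x => sin (dot x r)).
Proof.
apply: measurableT_comp (measurable_dotl r).
by apply: continuous_measurable_fun; exact: continuous_sin.
Qed.

Lemma integrable_poisson_cos d (r : 'rV[R]_d) :
  (mu d).-integrable setT (fun x => (poisson x * cos (dot x r))%:E).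
Proof.
by apply: integrable_poissonM => // x; rewrite ler_norml cos_geN1 cos_le1.
Qed.

Lemma integrable_poisson_sin d (r : 'rV[R]_d) :
  (mu d).-integrable setT (fun x => (poisson x * sin (dot x r))%:E).
Proof.
by apply: integrable_poissonM => // x; rewrite ler_norml sin_geN1 sin_le1.
Qed.

Lemma integral_poisson_sin d (r : 'rV[R]_d) :
  (\int[mu d]_x (poisson x * sin (dot x r))%:E = 0)%E.
Proof.
have I := integrable_poisson_sin r.
have := integral_reflect 0 (measurable_int _ I).
under eq_integral => x _.
  rewrite sub0r dotNl sinN mulrN.
  rewrite (_ : poisson (- x) = poisson x); last first.
    by rewrite /poisson; under eq_bigr do rewrite mxE normrN.
  rewrite -mulN1r EFinM.
  over.
rewrite integralZl//; have := integrable_fin_num measurableT I.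
by case: (integral _ _ _) => // s _; rewrite -EFinM => -[H]; congr EFin; lra.
Qed.

(** Induction on d.  Expand cos(r_0 a + r'.v) by the addition formula: the sine
    terms integrate to zero by parity. *)
Lemma integral_poisson_cos d (r : 'rV[R]_d) :
  (\int[mu d]_x (poisson x * cos (dot x r))%:E =
   (\prod_(i < d) (2 * (1 + r 0 i ^+ 2)^-1))%:E)%E.
Proof.
elim: d r => [|d IH] r.
  rewrite big_ord0 integral_dirac// ?diracT ?mul1e.
    by rewrite /poisson /dot !big_ord0 oppr0 expR0 cos0 mulr1.
  exact: measurable_int (integrable_poisson_cos r).
rewrite integral_cons; last exact: integrable_poisson_cos.
pose r' : 'rV[R]_d := \row_j r 0 (lift 0 j).
set K := \prod_(i < d) (2 * (1 + r' 0 i ^+ 2)^-1).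
transitivity (\int[lebesgue_measure]_a ((expR (- `|a|) * cos (r 0 0 * a)) * K)%:E)%E.
  apply: eq_integral => a _.
  pose A := expR (- `|a|) * cos (r 0 0 * a).
  pose B := expR (- `|a|) * sin (r 0 0 * a).
  transitivity (\int[mu d]_v (A%:E * (poisson v * cos (dot v r'))%:E -
                             B%:E * (poisson v * sin (dot v r'))%:E))%E.
    apply: eq_integral => v _.
    have -> : poisson (cons_rV (a, v)) = expR (- `|a|) * poisson v.
      rewrite !poissonE big_ord_recl cons_rV0; congr (_ * _).
      by apply: eq_bigr => i _; rewrite cons_rVS.
    have -> : dot (cons_rV (a, v)) r = r 0 0 * a + dot v r'.
      rewrite /dot big_ord_recl cons_rV0 /= mulrC; congr (_ + _).
      by apply: eq_bigr => i _; rewrite cons_rVS mxE.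
    rewrite -!EFinM -EFinB; congr EFin.
    by rewrite cosD /A /B; ring.
  rewrite integralB//; last 2 first.
  - exact: integrableZl (integrable_poisson_cos r').
  - exact: integrableZl (integrable_poisson_sin r').
  rewrite !integralZl//; last 2 first.
  - exact: integrable_poisson_sin.
  - exact: integrable_poisson_cos.
  by rewrite IH integral_poisson_sin mule0 sube0 -EFinM.
under eq_integral do rewrite EFinM muleC.
rewrite integralZl//; last first.
  apply: le_integrable integrable_expRNabs => //.
    apply/measurable_EFinP; apply: measurable_funM; first exact: measurable_expRNabs.
    apply: measurableT_comp; first by apply: continuous_measurable_fun; exact:
        continuous_cos.
    exact: measurable_funM.
  move=> x _ /=; rewrite lee_fin normrM ler_piMr//.
  by rewrite ler_norml cos_geN1 cos_le1.
rewrite integral_expRNabs_cos -EFinM big_ord_recl mulrC; congr (_ * _)%:E.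
by apply: eq_bigr => i _; rewrite mxE.
Qed.

End poisson_space.

(** * Fourier inversion *)

Section fourier_inversion.
Context {R : realType} (d : nat).
Local Open Scope complex_scope.
Local Notation Re := complex.Re.
Local Notation Im := complex.Im.
Local Notation normc := Normc.normc.
Local Notation mu := (@lebesgue_rV R d).
Local Notation Rd := 'rV[R]_d.

Lemma cint_dct dd (T : measurableType dd) (m : {measure set T -> \bar R})
    (F_ : nat -> T -> R[i]) (F : T -> R[i]) (h : T -> R) :
  (forall n, cmeasurable (F_ n)) -> cmeasurable F ->
  (forall x, Re (F_ n x) @[n --> \oo] --> Re (F x)) ->
  (forall x, Im (F_ n x) @[n --> \oo] --> Im (F x)) ->
  measurable_fun setT h -> (\int[m]_x (h x)%:E < +oo)%E ->
  (forall n x, normc (F_ n x) <= h x) ->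
  (Re (cint m (F_ n)) @[n --> \oo] --> Re (cint m F)) /\
  (Im (cint m (F_ n)) @[n --> \oo] --> Im (cint m F)).
Proof.
move=> mF_ mF cR cI mh ih bF; split => /=.
  apply: (Rintegral_dct _ _ cR mh ih).
  - by move=> n; case: (mF_ n).
  - by case: mF.
  - by move=> n x; apply: le_trans (bF n x); exact: Re_le_normc.
apply: (Rintegral_dct _ _ cI mh ih).
- by move=> n; case: (mF_ n).
- by case: mF.
- by move=> n x; apply: le_trans (bF n x); exact: Im_le_normc.
Qed.

Lemma cintegrable_poisson (r : Rd) :
  cintegrable mu (fun x => (poisson x)%:C * cis (dot x r)).
Proof.
split.
  apply: cmeasurableM; first exact: cmeasurable_real (@measurable_poisson R d).
  by apply: cmeasurable_cis; exact: measurable_dotl.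
under eq_integral do rewrite Normc.normcM normc_cis mulr1 normc_real ger0_norm
    ?poisson_ge0//.
by rewrite integral_poisson ltry.
Qed.

Lemma cint_poisson (r : Rd) :
  cint mu (fun x => (poisson x)%:C * cis (dot x r)) =
  (\prod_(i < d) (2 * (1 + r 0 i ^+ 2)^-1))%:C.
Proof.
apply: complex_ext => /=.
  under eq_Rintegral do rewrite mul0r subr0.
  by rewrite /Rintegral integral_poisson_cos.
under eq_Rintegral do rewrite mul0r addr0.
by rewrite /Rintegral integral_poisson_sin.
Qed.

Lemma cint_poisson_scaled (N : R) (r : Rd) : 0 < N ->
  cint mu (fun x => (poisson (N^-1 *: x))%:C * cis (dot x r)) =
  (N ^+ d * \prod_(i < d) (2 * (1 + (N * r 0 i) ^+ 2)^-1))%:C.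
Proof.
move=> N0; have NV : N^-1 != 0 by rewrite invr_eq0 gt_eqF.
have := cint_affine 0 NV (cintegrable_poisson (N *: r)).
rewrite cint_poisson => /(congr1 (fun z => (N ^+ d)%:C * z)).
rewrite mulrA -rmorphM /= -rmorphM /= -exprMn gtr0_norm ?invr_gt0// divff ?gt_eqF//.
rewrite expr1n mul1r => H; rewrite (eq_bigr (fun i => 2 * (1 + (N *: r) 0 i ^+ 2)^-1)).
  rewrite {}H; apply: eq_cint => x; rewrite addr0; congr (_ * cis _).
  by rewrite dotZl dotZr mulrA mulVf ?mul1r// gt_eqF.
by move=> i _; rewrite mxE.
Qed.

Definition fourier (G : Rd -> R[i]) (eta : Rd) : R[i] :=
  cint mu (fun t => G t * cis (- (2 * pi * dot t eta))).

Lemma cmeasurable_fourier (G : Rd -> R[i]) : cmeasurable G -> cmeasurable (fourier G).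
Proof.
move=> mG; pose F (p : Rd * Rd) := G p.2 * cis (- (2 * pi * dot p.2 p.1)).
apply: (@cmeasurable_cint _ _ _ _ _ mu F).
apply: cmeasurableM; first exact: cmeasurable_comp measurable_snd.
apply: cmeasurable_cis; apply: measurableT_comp => //.
apply: measurable_funM => //; apply: measurable_dot.
  exact: measurable_snd.
exact: measurable_fst.
Qed.

Lemma cintegrableM_cis (G : Rd -> R[i]) (h : Rd -> R) :
  measurable_fun setT h -> cintegrable mu G ->
  cintegrable mu (fun t => G t * cis (h t)).
Proof.
move=> mh [mG iG]; split; first by apply: cmeasurableM => //; exact: cmeasurable_cis.
by under eq_integral do rewrite Normc.normcM normc_cis mulr1.
Qed.

Let Q (v : Rd) : R := \prod_(i < d) (1 + v 0 i ^+ 2)^-1.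

Let Q_ge0 v : 0 <= Q v.
Proof. by apply: prodr_ge0 => i _; rewrite invr_ge0 addr_ge0 ?sqr_ge0. Qed.

Let measurable_Q : measurable_fun setT Q.
Proof. exact: (@measurable_rV_prod R d _ oneDsqrV_measurable). Qed.

Let integral_Q : (\int[mu]_v (Q v)%:E = (pi ^+ d)%:E)%E.
Proof.
apply: (ge0_integral_rV_prod d oneDsqrV_measurable _ integral_oneDsqrV).
by move=> t; rewrite invr_ge0 addr_ge0 ?sqr_ge0.
Qed.

Variables (G : Rd -> R[i]) (M : R).
Hypotheses (GRe : continuous (fun x => Re (G x)))
  (GIm : continuous (fun x => Im (G x))) (GM : forall x, normc (G x) <= M)
  (iG : cintegrable mu G) (iFG : cintegrable mu (fourier G)).

Let mG : cmeasurable G. Proof. by case: iG. Qed.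

Let M_ge0 : 0 <= M.
Proof. by apply: le_trans (GM 0); exact: normc_ge0. Qed.

(* The inversion integral of G at t, regularized at scale N, and the same number
   as an average of G around t (regularizedE): as N tends to infinity the first
   tends to the inversion integral, the second to G t. *)
Let regularized (t : Rd) (N : R) := cint mu (fun eta =>
  fourier G eta * cis (2 * pi * dot t eta) * (poisson (N^-1 *: eta))%:C).

Let averaged (t : Rd) (N : R) := cint mu (fun v =>
  G (t - (2 * pi * N)^-1 *: v) * (pi ^- d * Q v)%:C).

Let cintegrable_averaged (t : Rd) (N : R) :
  cintegrable mu (fun v => G (t - (2 * pi * N)^-1 *: v) * (pi ^- d * Q v)%:C).
Proof.
apply: (@le_cintegrable _ _ _ _ _ (fun v => M * (pi ^- d * Q v))).
- apply: cmeasurableM.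
    apply: (cmeasurable_comp mG); under eq_fun do rewrite addrC -scaleNr.
    exact: measurable_rV_affine.
  by apply: cmeasurable_real; exact: measurable_funM.
- by apply: measurable_funM => //; exact: measurable_funM.
- move=> x; rewrite Normc.normcM normc_real ger0_norm; last first.
    by rewrite mulr_ge0 ?Q_ge0// invr_ge0 exprn_ge0// pi_ge0.
  by rewrite ler_wpM2r// mulr_ge0 ?Q_ge0// invr_ge0 exprn_ge0// pi_ge0.
- under eq_integral do rewrite mulrA EFinM.
  rewrite ge0_integralZl//.
  + by rewrite integral_Q -EFinM ltry.
  + exact/measurable_EFinP.
  + by move=> x _; rewrite lee_fin.
  + by rewrite lee_fin mulr_ge0// invr_ge0 exprn_ge0// pi_ge0.
Qed.

(* Exchanging the integrals leaves the transform of the regularizing factor,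
   which is a product of Poisson kernels of width 1 / (2 pi N); the substitution
   v = 2 pi N (t - s) brings it to a fixed width. *)
Let regularizedE (t : Rd) (N : R) : 0 < N -> regularized t N = averaged t N.
Proof.
move=> N0; have pi0 : (0 < pi :> R) := pi_gt0 R.
have c0 : 0 < 2 * pi * N by rewrite !mulr_gt0.
have c0' : - (2 * pi * N) != 0 by rewrite oppr_eq0 gt_eqF.
rewrite /averaged (cint_affine ((2 * pi * N) *: t) c0' (cintegrable_averaged t N)).
rewrite -cintMl; last exact: cintegrable_affine (cintegrable_averaged t N).
pose H (p : Rd * Rd) := G p.2 * ((poisson (N^-1 *: p.1))%:C *
  cis (dot p.1 ((2 * pi) *: (t - p.2)))).
have mPN : measurable_fun setT (fun eta : Rd => poisson (N^-1 *: eta)).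
  apply: (measurableT_comp (@measurable_poisson R d)).
  have := measurable_rV_affine N^-1 (0 : Rd).
  by under eq_fun do rewrite addr0.
transitivity (cint mu (fun eta => cint mu (fun s => H (eta, s)))).
  apply: eq_cint => eta; rewrite /fourier -mulrA -cintMr; last first.
    apply: cintegrableM_cis => //; apply: measurableT_comp => //.
    by apply: measurable_funM => //; exact: measurable_dotl.
  apply: eq_cint => s; rewrite /H /= -!mulrA; congr (_ * _).
  rewrite mulrA -cisD mulrC; congr (_ * cis _).
  by rewrite dotZr dotDr dotNr !(dotC eta); ring.
have mH : cmeasurable H.
  apply: cmeasurableM; first exact: cmeasurable_comp measurable_snd.
  apply: cmeasurableM.
    by apply: cmeasurable_real; exact: (measurableT_comp mPN measurable_fst).
  apply: cmeasurable_cis; apply: measurable_dot; first exact: measurable_fst.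
  under eq_fun do rewrite scalerBr addrC -scaleNr.
  exact: measurableT_comp (measurable_rV_affine _ _) measurable_snd.
have iPN : (\int[mu]_x (poisson (N^-1 *: x))%:E < +oo)%E.
  have NV : N^-1 != 0 by rewrite invr_eq0 gt_eqF.
  have := @integral_poisson R d; rewrite (ge0_integral_affine 0 NV); last 2 first.
  - by apply/measurable_EFinP; exact: measurable_poisson.
  - by move=> x; rewrite lee_fin poisson_ge0.
  under eq_integral do rewrite addr0.
  move=> E; rewrite -(@lty_pmull _ (`|N^-1| ^+ d)) ?exprn_gt0 ?normr_gt0//.
  by rewrite E ltry.
rewrite cint_fubini//; last first.
  under eq_integral => eta _.
    under eq_integral => s _.
      rewrite !Normc.normcM normc_cis mulr1 normc_real ger0_norm ?poisson_ge0//= EFinM.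
      over.
    rewrite ge0_integralZr//; last 3 first.
    - by apply/measurable_EFinP; exact: measurable_normc.
    - by move=> x _; rewrite lee_fin normc_ge0.
    - by rewrite lee_fin poisson_ge0.
    over.
  rewrite ge0_integralZl//; last 3 first.
  - exact/measurable_EFinP.
  - by move=> x _; rewrite lee_fin poisson_ge0.
  - by apply: integral_ge0 => x _; rewrite lee_fin normc_ge0.
  apply: lte_mul_pinfty => //.
    by apply: integral_ge0 => x _; rewrite lee_fin normc_ge0.
  have [_ iG2] := iG; rewrite ge0_fin_numE; first exact: iG2.
  by apply: integral_ge0 => x _; rewrite lee_fin normc_ge0.
apply: eq_cint => s; rewrite /H /= cintMl; last first.
  split; first by apply: (cmeasurableM (cmeasurable_real mPN)); apply: cmeasurable_cis;
      exact: measurable_dotl.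
  by under eq_integral do rewrite Normc.normcM normc_cis mulr1 normc_real ger0_norm
      ?poisson_ge0//.
rewrite cint_poisson_scaled// mulrCA; congr (G _ * _).
  rewrite scalerDr scaleNr scalerN opprD opprK.
  by rewrite !scalerA mulVf ?gt_eqF// !scale1r addrCA subrr addr0.
rewrite -rmorphM /=; congr (_ %:C).
rewrite normrN gtr0_norm// [in RHS]mulrA -[in RHS]exprVn -exprMn.
rewrite (_ : 2 * pi * N / pi = 2 * N); last by rewrite mulrAC mulfK ?gt_eqF.
rewrite big_split /= prodr_const card_ord exprMn mulrCA mulrA; congr (_ * _).
apply: eq_bigr => i _; congr (_ + _ ^+ 2)^-1; rewrite !mxE; ring.
Qed.

Let regularized_cvg (t : Rd) :
  let L := cint mu (fun eta => fourier G eta * cis (2 * pi * dot t eta)) in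
  (Re (regularized t n.+1%:R) @[n --> \oo] --> Re L) /\
  (Im (regularized t n.+1%:R) @[n --> \oo] --> Im L).
Proof.
have mE : cmeasurable (fun eta => fourier G eta * cis (2 * pi * dot t eta)).
  apply: cmeasurableM; first by case: iFG.
  by apply: cmeasurable_cis; apply: measurable_funM => //; exact: measurable_dotr.
have cP (eta : Rd) : poisson (n.+1%:R^-1 *: eta) @[n --> \oo] --> (1 : R).
  rewrite /poisson -[X in _ --> X](expR0 R).
  apply: (@continuous_cvg _ _ _ _ _ _ expR); first exact: continuous_expR.
  rewrite (_ : (fun n => _) = (fun n => n.+1%:R^-1 * - \sum_(i < d) `|eta 0 i|)).
    rewrite -[X in _ --> X](mul0r (- \sum_(i < d) `|eta 0 i|)).
    by apply: cvgMl; exact: cvg_harmonic.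
  apply/funext => n; rewrite mulrN mulr_sumr; congr (- _).
  by apply: eq_bigr => i _; rewrite mxE normrM ger0_norm ?invr_ge0.
apply: (@cint_dct _ _ _ _ _ (fun eta => normc (fourier G eta))).
- move=> n; apply: cmeasurableM => //; apply: cmeasurable_real.
  apply: (measurableT_comp (@measurable_poisson R d)).
  have := measurable_rV_affine n.+1%:R^-1 (0 : Rd).
  by under eq_fun do rewrite addr0.
- exact: mE.
- move=> eta; set z := fourier G eta * _.
  have H : Re z * poisson (n.+1%:R^-1 *: eta) @[n --> \oo] --> Re z * 1.
    by apply: cvgMr; exact: cP.
  by under eq_fun do rewrite ReMr; rewrite mulr1 in H; exact: H.
- move=> eta; set z := fourier G eta * _.
  have H : Im z * poisson (n.+1%:R^-1 *: eta) @[n --> \oo] --> Im z * 1.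
    by apply: cvgMr; exact: cP.
  by under eq_fun do rewrite ImMr; rewrite mulr1 in H; exact: H.
- by apply: measurable_normc; case: iFG.
- by case: iFG.
- move=> n eta; rewrite !Normc.normcM normc_cis mulr1 normc_real.
  by rewrite ger0_norm ?poisson_ge0// ler_piMr ?normc_ge0// poisson_le1.
Qed.

Let averaged_cvg (t : Rd) :
  (Re (averaged t n.+1%:R) @[n --> \oo] --> Re (G t)) /\
  (Im (averaged t n.+1%:R) @[n --> \oo] --> Im (G t)).
Proof.
have pi0 : (0 < pi :> R) := pi_gt0 R.
have ipQ : cintegrable mu (fun v => (pi ^- d * Q v)%:C).
  split; first by apply: cmeasurable_real; exact: measurable_funM.
  under eq_integral do rewrite normc_real ger0_norm ?mulr_ge0 ?Q_ge0 ?invr_ge0 ?exprn_ge0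
      ?pi_ge0// EFinM.
  rewrite ge0_integralZl//.
  + by rewrite integral_Q -EFinM ltry.
  + exact/measurable_EFinP.
  + by move=> x _; rewrite lee_fin.
  + by rewrite lee_fin invr_ge0 exprn_ge0// pi_ge0.
have GtE : G t = cint mu (fun v => G t * (pi ^- d * Q v)%:C).
  rewrite cintMl// -[LHS]mulr1; congr (_ * _); apply: complex_ext => /=.
    rewrite /Rintegral; under eq_integral do rewrite EFinM.
    rewrite ge0_integralZl//.
    + by rewrite integral_Q -EFinM /= mulVf// expf_neq0// gt_eqF.
    + exact/measurable_EFinP.
    + by move=> x _; rewrite lee_fin.
    + by rewrite lee_fin invr_ge0 exprn_ge0// pi_ge0.
  by rewrite Rintegral_cst// mul0r.
have ct (v : Rd) : t - (2 * pi * n.+1%:R)^-1 *: v @[n --> \oo] --> t.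
  have c0 : (2 * pi * n.+1%:R)^-1 @[n --> \oo] --> ((2 * pi)^-1 * 0 : R).
    under eq_fun do rewrite invfM.
    by apply: cvgMr; exact: cvg_harmonic.
  have cv : t - (2 * pi * n.+1%:R)^-1 *: v @[n --> \oo] --> t - ((2 * pi)^-1 * 0) *: v.
    by apply: cvgB; [exact: cvg_cst|apply: cvgZl].
  by move: cv; rewrite mulr0 scale0r subr0.
rewrite GtE.
apply: (@cint_dct _ _ _ _ _ (fun v => M * (pi ^- d * Q v))).
- by move=> n; case: (cintegrable_averaged t n.+1%:R).
- by apply: cmeasurableM; [exact: cmeasurable_cst|case: ipQ].
- move=> v; rewrite ReMr; under eq_fun do rewrite ReMr.
  have H : Re (G (t - (2 * pi * n.+1%:R)^-1 *: v)) @[n --> \oo] --> Re (G t).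
    by apply: (@continuous_cvg _ _ _ _ _ _ (fun x => Re (G x))); [exact: GRe|exact: ct].
  exact: (cvgMl H).
- move=> v; rewrite ImMr; under eq_fun do rewrite ImMr.
  have H : Im (G (t - (2 * pi * n.+1%:R)^-1 *: v)) @[n --> \oo] --> Im (G t).
    by apply: (@continuous_cvg _ _ _ _ _ _ (fun x => Im (G x))); [exact: GIm|exact: ct].
  exact: (cvgMl H).
- by apply: measurable_funM => //; exact: measurable_funM.
- under eq_integral do rewrite mulrA EFinM.
  rewrite ge0_integralZl//.
  + by rewrite integral_Q -EFinM ltry.
  + exact/measurable_EFinP.
  + by move=> x _; rewrite lee_fin.
  + by rewrite lee_fin mulr_ge0// invr_ge0 exprn_ge0// pi_ge0.
- move=> n v; rewrite Normc.normcM normc_real ger0_norm; last first.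
    by rewrite mulr_ge0 ?Q_ge0// invr_ge0 exprn_ge0// pi_ge0.
  by rewrite ler_wpM2r// mulr_ge0 ?Q_ge0// invr_ge0 exprn_ge0// pi_ge0.
Qed.

Theorem fourier_inversion (t : Rd) :
  cint mu (fun eta => fourier G eta * cis (2 * pi * dot t eta)) = G t.
Proof.
have [L1 L2] := regularized_cvg t; have [A1 A2] := averaged_cvg t.
have E : (fun n : nat => regularized t n.+1%:R) = (fun n => averaged t n.+1%:R).
  by apply/funext => n; exact: regularizedE.
have E1 := congr1 (fun u : nat -> R[i] => fun n => Re (u n)) E.
have E2 := congr1 (fun u : nat -> R[i] => fun n => Im (u n)) E.
rewrite /= in E1 E2.
apply: complex_ext.
  by move: L1; rewrite E1 => L1; exact: cvg_unique L1 A1.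
by move: L2; rewrite E2 => L2; exact: cvg_unique L2 A2.
Qed.

End fourier_inversion.

(** * Integration by parts and decay *)

Section directional_derivative.
Context {R : realType} (d : nat).
Local Notation mu := (@lebesgue_rV R d).
Local Notation Rd := 'rV[R]_d.

Lemma bracket_scale_le1 (V : normedModType R) (h : R) (e : V) : `|h| <= 1 ->
  bracket (h *: e) <= bracket e.
Proof. by move=> h1; rewrite /bracket lerD2l normrZ ler_piMl. Qed.

(** The difference quotients of H along e have integral zero by translation
    invariance.  They converge to H', and by the mean value theorem they are
    dominated by the weight that bounds H', up to the factor by which the weight
    varies over a segment of direction e. *)
Lemma integral_directional_derivative (H H' : Rd -> R) (e : Rd) (C : R) (m : nat) :
  (2 * d <= m)%N ->
  measurable_fun setT H -> measurable_fun setT H' ->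
  (forall (t : Rd) (h : R), is_derive h (1 : R) (fun h => H (t + h *: e)) (H' (t + h *:
      e))) ->
  (forall t, `|H t| <= C * (bracket t ^+ m)^-1) ->
  (forall t, `|H' t| <= C * (bracket t ^+ m)^-1) ->
  (\int[mu]_t H' t)%R = 0.
Proof.
move=> dm mH mH' lineH bH bH'.
have C0 : 0 <= C.
  have := le_trans (normr_ge0 _) (bH 0); rewrite pmulr_lge0//.
  by rewrite invr_gt0 exprn_gt0// bracket_gt0.
pose w (t : Rd) := (bracket t ^+ m)^-1.
have w0 t : 0 <= w t by rewrite invr_ge0 exprn_ge0 ?bracket_ge0.
have mw : measurable_fun setT w by exact: measurable_bracketV.
have iw (k : R) : 0 <= k -> (\int[mu]_t (k * w t)%:E < +oo)%E.
  by move=> k0; exact: integral_bracketM_lty.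
pose q (n : nat) (t : Rd) := n.+1%:R * (H (t + n.+1%:R^-1 *: e) - H t).
have mHs (c : Rd) : measurable_fun setT (fun t : Rd => H (t + c)).
  apply: (measurableT_comp mH); have := measurable_rV_affine 1 c.
  by under eq_fun do rewrite scale1r.
have iH : mu.-integrable setT (EFin \o H).
  apply/integrableP; split; first exact/measurable_EFinP.
  apply: le_lt_trans (iw _ C0); apply: ge0_le_integral_EFin => //.
  - exact: measurableT_comp.
  - exact: measurable_funM.
have q0 n : (\int[mu]_t q n t)%R = 0.
  have iHs : mu.-integrable setT (EFin \o (fun t : Rd => H (t + n.+1%:R^-1 *: e))).
    apply/integrableP; split; first exact/measurable_EFinP.
    have /integrableP[_] := iH; congr (_ < _)%E; apply/esym.
    apply: (@integral_shift _ _ (n.+1%:R^-1 *: e) (fun t => `|(EFin \o H) t|)%E).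
    apply/measurable_EFinP; exact: measurableT_comp.
  rewrite RintegralZl//; last exact: (integrableB measurableT iHs iH).
  rewrite RintegralB// (_ : (\int[mu]_t H (t + n.+1%:R^-1 *: e))%R = (\int[mu]_t H t)%R).
    by rewrite subrr mulr0.
  congr fine; apply: (@integral_shift _ _ (n.+1%:R^-1 *: e) (EFin \o H)).
  exact/measurable_EFinP.
have : (\int[mu]_t q n t)%R @[n --> \oo] --> (\int[mu]_t H' t)%R.
  apply: (@Rintegral_dct _ _ _ mu q H' (fun t => C * bracket e ^+ m * w t)) => //.
  - by move=> n; apply: measurable_funM => //; apply: measurable_funB.
  - move=> t; have -> : H' t = H' (t + 0 *: e) by rewrite scale0r addr0.
    have [dH <-] := lineH t 0.
    have K := (cvgr_dnbhsP _ _ _).1 dH (fun n => n.+1%:R^-1).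
    rewrite /q.
    have -> : (fun n : nat => n.+1%:R * (H (t + n.+1%:R^-1 *: e) - H t)) =
      (fun n : nat => (n.+1%:R^-1)^-1 *: (((fun h => H (t + h *: e)) \o shift 0)
          (n.+1%:R^-1 *: 1)
        - H (t + 0 *: e))).
      apply/funext => n; have s1 (x : R) : x *: (1 : R) = x.
        by rewrite /GRing.scale/= mulr1.
      by rewrite /= scale0r !addr0 s1 invrK.
    by apply: K; split; [move=> n; rewrite invr_eq0|exact: cvg_harmonic].
  - exact: measurable_funM.
  - by apply: iw; rewrite mulr_ge0// exprn_ge0// bracket_ge0.
  - move=> n t; rewrite /q.
    have n0 : 0 < n.+1%:R^-1 :> R by rewrite invr_gt0.
    have [c] : exists2 c, c \in `[0, n.+1%:R^-1] &
        H (t + n.+1%:R^-1 *: e) - H (t + 0 *: e) = H' (t + c *: e) * (n.+1%:R^-1 - 0).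
      apply: (@MVT_segment R (fun h => H (t + h *: e)) (fun h => H' (t + h *: e))).
      - exact: ltW.
      - apply: continuous_subspaceT => x; apply: differentiable_continuous.
        by apply/derivable1_diffP; case: (lineH t x).
    rewrite in_itv/= => /andP[c0 c1].
    rewrite scale0r addr0 subr0 => ->; rewrite mulrCA divff// mulr1.
    apply: le_trans (bH' _) _; rewrite -mulrA ler_wpM2l// /w.
    rewrite ler_pdivlMr ?exprn_gt0 ?bracket_gt0// mulrC.
    rewrite ler_pdivrMr ?exprn_gt0 ?bracket_gt0// -exprMn.
    apply: lerXn2r; rewrite ?nnegrE ?mulr_ge0 ?bracket_ge0//.
    rewrite -[X in bracket X <= _](addrK (c *: e)) mulrC.
    apply: le_trans (bracketD _ _) _; rewrite ler_wpM2l ?bracket_ge0// bracketN.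
    apply: bracket_scale_le1; rewrite ger0_norm// (le_trans c1)//.
    by rewrite invf_le1// ler1n.
have K1 : (\int[mu]_t q n t)%R @[n --> \oo] --> (0 : R).
  by under eq_fun do rewrite q0; exact: cvg_cst.
by move=> K2; exact: cvg_unique K2 K1.
Qed.

(** The norm is the maximum norm: at each point it is attained by one of the
    coordinates, for which the hypothesis applies.  The variable x may carry
    parameters besides the point P x, and then the bound is uniform in them. *)
Lemma bracket_decay (T : Type) (P : T -> Rd) (f w : T -> R) (k : nat) :
  (forall x, 0 <= w x) ->
  (exists C, forall x, `|f x| <= C * w x) ->
  (forall j, exists C, forall x, `|P x 0 j| ^+ k * `|f x| <= C * w x) ->
  exists2 C, 0 <= C & forall x, `|f x| <= C * w x * (bracket (P x) ^+ k)^-1.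
Proof.
move=> w0 [C0 HC0] /choice[C HC].
(* From (1 + s)^k <= 2^k (1 + s^k). *)
exists (2 ^+ k * (`|C0| + (`|C0| + \sum_j `|C j|))).
  by rewrite mulr_ge0 ?addr_ge0 ?sumr_ge0 ?exprn_ge0.
move=> x; rewrite ler_pdivlMr ?exprn_gt0 ?bracket_gt0// mulrC -mulrA.
have f0 := normr_ge0 (f x).
have HC0' : `|f x| <= `|C0| * w x.
  by apply: le_trans (HC0 x) _; rewrite ler_wpM2r// ler_norm.
have HCj j : `|P x 0 j| ^+ k * `|f x| <= (\sum_j `|C j|) * w x.
  apply: le_trans (HC j x) _; rewrite ler_wpM2r//.
  apply: le_trans (ler_norm _) _; rewrite (bigD1 j)//= lerDl.
  by rewrite sumr_ge0.
have S0 : 0 <= \sum_j `|C j| by rewrite sumr_ge0.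
have key : (bracket (P x)) ^+ k * `|f x| <=
    2 ^+ k * (`|f x| + `|P x| ^+ k * `|f x|).
  rewrite -[X in _ * (X + _)]mul1r -mulrDl mulrA ler_wpM2r//.
  have [P1|P1] := lerP `|P x| 1.
    apply: (@le_trans _ _ (2 ^+ k)); last by rewrite ler_peMr// lerDl exprn_ge0.
    by apply: lerXn2r; rewrite ?nnegrE ?bracket_ge0// /bracket; lra.
  apply: (@le_trans _ _ (2 ^+ k * `|P x| ^+ k)).
    rewrite -exprMn; apply: lerXn2r; rewrite ?nnegrE ?bracket_ge0 ?mulr_ge0//.
    by rewrite /bracket; lra.
  by rewrite ler_wpM2l// lerDr.
apply: le_trans key _; rewrite ler_wpM2l ?exprn_ge0// mulrDl lerD// mulrDl.
have [Px0|Px0] := eqVneq `|P x| 0.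
  rewrite Px0 -[leLHS]addr0 lerD ?mulr_ge0//.
  by apply: le_trans HC0'; rewrite ler_piMl// expr0n; case: (k == 0).
have [[i j] /= Pj] : exists i, mx_norm (P x) = `|P x i.1 i.2| by exact: mx_norm_neq0.
rewrite (_ : `|P x| = `|P x 0 j|); last by rewrite -(ord1 i).
by rewrite -[leLHS]add0r lerD// mulr_ge0.
Qed.

End directional_derivative.

(** * Schwartz functions evaluated at u + tau t and u - (1 - tau) t *)

Section schwartz_functions.
Context {R : realType} (d : nat).
Local Notation mu := (@lebesgue_rV R d).
Local Notation Rd := 'rV[R]_d.
Implicit Types (A B : Rd -> R).

Lemma real_schwartz_partial A j : real_schwartz A ->
  real_schwartz ('D_(delta_mx 0 j) A).
Proof.
have E s : iter_partial s ('D_(delta_mx 0 j) A) = iter_partial (rcons s j) A.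
  by rewrite /iter_partial foldr_rcons.
move=> [sA dA]; split=> [s x|a s]; first by rewrite E; exact: sA.
by rewrite E; exact: dA.
Qed.

Lemma real_schwartz_differentiable A x : real_schwartz A -> differentiable A x.
Proof. by move=> [sA _]; exact: (sA [::] x). Qed.

Lemma real_schwartz_continuous A : real_schwartz A -> continuous A.
Proof.
by move=> sA x; apply: differentiable_continuous; exact: real_schwartz_differentiable.
Qed.

Lemma real_schwartz_measurable A : real_schwartz A -> measurable_fun setT A.
Proof.
by move=> sA; apply: rV_continuous_measurable_fun; exact: real_schwartz_continuous.
Qed.

Lemma real_schwartz_decay A k : real_schwartz A ->
  exists2 C, 0 <= C & forall x, `|A x| <= C * (bracket x ^+ k)^-1.
Proof.
move=> [_ dA].
have [||| C C0 HC] := @bracket_decay R d Rd id A (fun=> 1) k.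
- by [].
- have [C HC] := dA (fun=> 0%N) [::]; exists C => x; have := HC x.
  by rewrite big1 ?mul1r ?mulr1// => i _; rewrite expr0.
- move=> j; have [C HC] := dA (fun i => if i == j then k else 0%N) [::].
  exists C => x; have := HC x; rewrite (bigD1 j)//= eqxx big1 ?mulr1.
    by rewrite normrM normrX.
  by move=> i /negPf ->; rewrite expr0.
by exists C => // x; have := HC x; rewrite mulr1.
Qed.

(** The difference quotients of the two sides coincide. *)
Lemma real_schwartz_line A j (p : Rd) (c h : R) : real_schwartz A ->
  is_derive h (1 : R) (fun h => A (p + h *: (c *: delta_mx 0 j)))
    (c * 'D_(delta_mx 0 j) A (p + h *: (c *: delta_mx 0 j))).
Proof.
move=> sA; set v := c *: _; set x := p + h *: v.
have dA : differentiable A x by exact: real_schwartz_differentiable.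
have -> : c * 'D_(delta_mx 0 j) A x = 'D_v A x.
  by rewrite !deriveE// /v linearZ.
have E : (fun k : R => k^-1 *: (((fun h => A (p + h *: v)) \o shift h) (k *: 1) - A x)) =
    (fun k => k^-1 *: ((A \o shift x) (k *: v) - A x)).
  apply/funext => k; congr (_ *: (A _ - _)).
  have s1 : k *: (1 : R) = k by rewrite /GRing.scale/= mulr1.
  by rewrite /= s1 scalerDl addrCA.
have dAv := @diff_derivable _ _ _ _ _ v dA.
split; first by move: dAv; rewrite /derivable -E.
by rewrite /derive E.
Qed.

Section ambiguity.
Variable tau : R.
Hypothesis htau : 0 < tau < 1.

Let tau_gt0 : 0 < tau. Proof. by case/andP: htau. Qed.
Let tau_lt1 : tau < 1. Proof. by case/andP: htau. Qed.

Let tau_norm : `|tau| <= 1. Proof. by rewrite ger0_norm ltW. Qed.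

Let tau1_norm : `|1 - tau| <= 1.
Proof.
have := tau_gt0; have := tau_lt1 => h1 h2.
by rewrite ger0_norm; lra.
Qed.

(** The integrands of the tau-Wigner distributions, in real-valued form. *)
Definition cross_product A B (u t : Rd) : R :=
  A (u + tau *: t) * B (u - (1 - tau) *: t).

(** Put p = u + tau t and q = u - (1 - tau) t.  Then u = (1 - tau) p + tau q and
    t = p - q, so that decay in p and in q gives decay in u and in t. *)
Lemma bracket_cross_u (u t : Rd) :
  bracket u <= bracket (u + tau *: t) * bracket (u - (1 - tau) *: t).
Proof.
set p := u + _; set q := u - _.
have -> : u = (1 - tau) *: p + tau *: q.
  rewrite /p /q scalerDr scalerBr !scalerA addrACA -scalerDl subrK scale1r.
  by rewrite mulrC subrr addr0.
apply: le_trans (bracketD _ _) _; apply: ler_pM; rewrite ?bracket_ge0//.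
  exact: bracket_scale_le1.
exact: bracket_scale_le1.
Qed.

Lemma bracket_cross_t (u t : Rd) :
  bracket t <= bracket (u + tau *: t) * bracket (u - (1 - tau) *: t).
Proof.
set p := u + _; set q := u - _.
have -> : t = p - q.
  rewrite /p /q opprB addrC addrA subrK -scalerDl.
  by rewrite subrK scale1r.
by rewrite -(bracketN q); exact: bracketD.
Qed.

Lemma cross_product_decay A B m k : real_schwartz A -> real_schwartz B ->
  exists2 C, 0 <= C & forall u t, `|cross_product A B u t| <=
    C * (bracket u ^+ m)^-1 * (bracket t ^+ k)^-1.
Proof.
move=> /(real_schwartz_decay (m + k))[CA CA0 HA].
move=> /(real_schwartz_decay (m + k))[CB CB0 HB].
exists (CA * CB); first exact: mulr_ge0.
move=> u t; rewrite /cross_product normrM.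
set p := u + _; set q := u - _.
apply: (@le_trans _ _ ((CA * CB) * ((bracket p * bracket q) ^+ (m + k))^-1)).
  rewrite exprMn invfM mulrACA; apply: ler_pM => //; exact: HA.
rewrite -[leRHS]mulrA -invfM ler_wpM2l ?mulr_ge0//.
rewrite lef_pV2 ?posrE ?mulr_gt0 ?exprn_gt0 ?mulr_gt0 ?bracket_gt0//.
rewrite exprD; apply: ler_pM; rewrite ?exprn_ge0 ?bracket_ge0//.
  by apply: lerXn2r; rewrite ?nnegrE ?mulr_ge0 ?bracket_ge0// bracket_cross_u.
by apply: lerXn2r; rewrite ?nnegrE ?mulr_ge0 ?bracket_ge0// bracket_cross_t.
Qed.

Lemma measurable_cross_product A B u : real_schwartz A -> real_schwartz B ->
  measurable_fun setT (cross_product A B u).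
Proof.
move=> sA sB; apply: measurable_funM.
  apply: (measurableT_comp (real_schwartz_measurable sA)).
  by under eq_fun do rewrite addrC; exact: measurable_rV_affine.
apply: (measurableT_comp (real_schwartz_measurable sB)).
by under eq_fun do rewrite addrC -scaleNr; exact: measurable_rV_affine.
Qed.

(** The phase beta makes one function serve as cosine and sine transform, since
    differentiation and passage from one to the other are quarter turns. *)
Definition phase_integral A B (u eta : Rd) (beta : R) : R :=
  (\int[mu]_t (cross_product A B u t * cos (2 * pi * dot t eta + beta)))%R.

Let measurable_phase (eta : Rd) beta :
  measurable_fun setT (fun t : Rd => cos (2 * pi * dot t eta + beta)).
Proof.
apply: measurableT_comp; first by apply: continuous_measurable_fun; exact: continuous_cos.
by apply: measurable_funD => //; apply: measurable_funM => //; exact: measurable_dotl.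
Qed.

Let cos_le1n (x : R) : `|cos x| <= 1.
Proof. by rewrite ler_norml cos_geN1 cos_le1. Qed.

Let sin_le1n (x : R) : `|sin x| <= 1.
Proof. by rewrite ler_norml sin_geN1 sin_le1. Qed.

Lemma phase_integrable A B (u eta : Rd) (beta : R) :
  real_schwartz A -> real_schwartz B ->
  mu.-integrable setT (fun t => (cross_product A B u t * cos (2 * pi * dot t eta +
      beta))%:E).
Proof.
move=> sA sB; have [C C0 HC] := cross_product_decay 0 (2 * d) sA sB.
have mF := measurable_cross_product u sA sB.
apply/integrableP; split; first by apply/measurable_EFinP; exact: measurable_funM.
apply: (@le_lt_trans _ _ (\int[mu]_t (C * (bracket t ^+ (2 * d))^-1)%:E)%E).
  apply: ge0_le_integral_EFin => //.
  - by apply: measurableT_comp => //; exact: measurable_funM.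
  - by apply: measurable_funM => //; exact: measurable_bracketV.
  move=> t; apply: le_trans (_ : `|cross_product A B u t| <= _).
    by rewrite normrM ler_piMr.
  by have := HC u t; rewrite expr0 invr1 mulr1.
under eq_integral do rewrite EFinM.
rewrite ge0_integralZl//; last 2 first.
- by apply/measurable_EFinP; exact: measurable_bracketV.
- by move=> t _; rewrite lee_fin invr_ge0 exprn_ge0 ?bracket_ge0.
by apply: lte_mul_pinfty => //; exact: integral_bracket_lty.
Qed.

(** The derivative of cross_product A B u t * cos (2 pi t.eta + beta) along the
    j-th coordinate has integral zero. *)
Lemma phase_integral_by_parts A B j (u eta : Rd) (beta : R) :
  real_schwartz A -> real_schwartz B ->
  2 * pi * eta 0 j * phase_integral A B u eta (beta - pi / 2) =
  tau * phase_integral ('D_(delta_mx 0 j) A) B u eta beta -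
  (1 - tau) * phase_integral A ('D_(delta_mx 0 j) B) u eta beta.
Proof.
move=> sA sB; pose e : Rd := delta_mx 0 j.
have sAj := real_schwartz_partial j sA; have sBj := real_schwartz_partial j sB.
pose x t := 2 * pi * dot t eta + beta.
pose H t := cross_product A B u t * cos (x t).
pose H' t := (tau * (cross_product ('D_e A) B u t * cos (x t)) -
  (1 - tau) * (cross_product A ('D_e B) u t * cos (x t))) -
  2 * pi * eta 0 j * (cross_product A B u t * cos (2 * pi * dot t eta + (beta - pi / 2))).
have i1 := phase_integrable u eta beta sAj sB.
have i2 := phase_integrable u eta beta sA sBj.
have i3 := phase_integrable u eta (beta - pi / 2) sA sB.
have : (\int[mu]_t H' t)%R = 0; last first.
  rewrite /H' RintegralB//; last 2 first.
  - exact: (integrableB measurableT (integrableZl measurableT _ i1)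
                                    (integrableZl measurableT _ i2)).
  - exact: (integrableZl measurableT _ i3).
  rewrite RintegralB//; last 2 first.
  - exact: (integrableZl measurableT _ i1).
  - exact: (integrableZl measurableT _ i2).
  by rewrite !RintegralZl// => /eqP; rewrite subr_eq0 => /eqP <-.
have [C1 C10 HC1] := cross_product_decay 0 (2 * d) sAj sB.
have [C2 C20 HC2] := cross_product_decay 0 (2 * d) sA sBj.
have [C3 C30 HC3] := cross_product_decay 0 (2 * d) sA sB.
pose K := C1 + C2 + (1 + `|2 * pi * eta 0 j|) * C3.
have mx : measurable_fun setT x.
  by apply: measurable_funD => //; apply: measurable_funM => //; exact: measurable_dotl.
apply: (@integral_directional_derivative R d H H' e K (2 * d)) => //.
- apply: measurable_funM; first exact: measurable_cross_product.
  exact: measurable_phase.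
- apply: measurable_funB; last first.
    by apply: measurable_funM => //; exact: measurable_funM (measurable_cross_product u
        sA sB) (measurable_phase eta _).
  apply: measurable_funB.
    by apply: measurable_funM => //; exact: measurable_funM (measurable_cross_product u
        sAj sB) (measurable_phase eta _).
  by apply: measurable_funM => //; exact: measurable_funM (measurable_cross_product u sA
      sBj) (measurable_phase eta _).
- move=> t h.
  have lA := real_schwartz_line j (u + tau *: t) tau h sA.
  have lB := real_schwartz_line j (u - (1 - tau) *: t) (- (1 - tau)) h sB.
  have lx : is_derive h (1 : R) (fun h : R => h * (2 * pi * dot e eta) + x t) (2 * pi *
      eta 0 j).
    apply: is_derive_eq; rewrite /GRing.scale/= mulr0 add0r addr0 mulr1.
    congr (_ * _); rewrite /dot (bigD1 j)//= big1 ?addr0.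
      by rewrite mxE !eqxx mul1r.
    by move=> i /negPf ij; rewrite mxE ij andbF mul0r.
  have lc := @is_derive1_comp _ cos (fun h : R => h * (2 * pi * dot e eta) + x t) h _ _
      (is_derive_cos _) lx.
  have E : (fun h => H (t + h *: e)) = (fun h =>
      A (u + tau *: t + h *: (tau *: delta_mx 0 j)) *
      B (u - (1 - tau) *: t + h *: (- (1 - tau) *: delta_mx 0 j)) *
      (cos \o (fun h : R => h * (2 * pi * dot e eta) + x t)) h).
    apply/funext => k; rewrite /H /cross_product /=; congr (_ * _ * _).
    + by congr A; rewrite scalerDr addrA !scalerA (mulrC tau).
    + by congr B; rewrite scalerDr opprD addrA !scalerA mulrN scaleNr (mulrC (1 - tau)).
    + by congr cos; rewrite /x dotDl dotZl; ring.
  rewrite E; apply: is_derive_eq.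
  rewrite /GRing.scale/= /H' /cross_product /x.
  rewrite (_ : cos (2 * pi * dot (t + h *: e) eta + (beta - pi / 2)) = sin (x (t + h *:
      e))); last first.
    by rewrite addrA -[in RHS](subrK (pi / 2) (x _)) sinDpihalf.
  rewrite (_ : h * (2 * pi * dot e eta) + (2 * pi * dot t eta + beta) = x (t + h *: e));
      last first.
    by rewrite /x dotDl dotZl; ring.
  rewrite (_ : u + tau *: t + h *: (tau *: delta_mx 0 j) = u + tau *: (t + h *: e)); last
      first.
    by rewrite scalerDr addrA !scalerA (mulrC tau).
  rewrite (_ : u - (1 - tau) *: t + h *: (- (1 - tau) *: delta_mx 0 j) =
      u - (1 - tau) *: (t + h *: e)); last first.
    by apply/rowP => i; rewrite !mxE; ring.
  rewrite -/(x _) -/e; ring.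
- move=> t; have := HC3 u t; rewrite expr0 invr1 mulr1 => H3.
  rewrite /H normrM; apply: (@le_trans _ _ `|cross_product A B u t|).
    by rewrite ler_piMr.
  apply: le_trans H3 _; rewrite ler_wpM2r ?invr_ge0 ?exprn_ge0 ?bracket_ge0//.
  rewrite /K mulrDl mul1r; have := mulr_ge0 (normr_ge0 (2 * pi * eta 0 j)) C30; lra.
- move=> t; have := HC3 u t; have := HC2 u t; have := HC1 u t.
  rewrite expr0 invr1 !mulr1 => H1 H2 H3.
  rewrite /H'; set w := (bracket t ^+ (2 * d))^-1 in H1 H2 H3 *.
  have -> : K * w = C1 * w + C2 * w + (C3 * w + `|2 * pi * eta 0 j| * (C3 * w)).
    by rewrite /K; ring.
  have w0 : 0 <= w by rewrite invr_ge0 exprn_ge0 ?bracket_ge0.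
  apply: le_trans (ler_normB _ _) _; apply: lerD.
    apply: le_trans (ler_normB _ _) _; apply: lerD.
      rewrite normrM [X in _ * X]normrM; apply: le_trans H1; rewrite -[leRHS]mul1r.
      by apply: ler_pM; [exact: normr_ge0|exact: mulr_ge0|exact: tau_norm|rewrite ler_piMr].
    rewrite normrM [X in _ * X]normrM; apply: le_trans H2; rewrite -[leRHS]mul1r.
    by apply: ler_pM; [exact: normr_ge0|exact: mulr_ge0|exact: tau1_norm|rewrite ler_piMr].
  rewrite -[leLHS]add0r; apply: lerD; first by rewrite mulr_ge0.
  rewrite normrM ler_wpM2l//; apply: le_trans H3.
  by rewrite normrM ler_piMr.
Qed.

End ambiguity.
End schwartz_functions.

(** * Decay of the ambiguity transform of the window *)

Section window.
Context {R : realType} (d : nat).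
Local Open Scope complex_scope.
Local Notation Re := complex.Re.
Local Notation Im := complex.Im.
Local Notation normc := Normc.normc.
Local Notation mu := (@lebesgue_rV R d).
Local Notation Rd := 'rV[R]_d.
Variable tau : R.
Hypothesis htau : 0 < tau < 1.
Implicit Types (A B : Rd -> R).

Let tau_gt0 : 0 < tau. Proof. by case/andP: htau. Qed.
Let tau_lt1 : tau < 1. Proof. by case/andP: htau. Qed.

Lemma phase_integral_decay_u A B m : real_schwartz A -> real_schwartz B ->
  exists C, forall u eta beta, `|phase_integral tau A B u eta beta| <= C * (bracket u ^+
      m)^-1.
Proof.
move=> sA sB; have [C C0 HC] := cross_product_decay htau m (2 * d) sA sB.
pose W := fine (\int[mu]_t ((bracket t ^+ (2 * d))^-1)%:E)%E.
have Wfin : (\int[mu]_t ((bracket t ^+ (2 * d))^-1)%:E)%E \is a fin_num.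
  rewrite ge0_fin_numE; first exact: integral_bracket_lty.
  by apply: integral_ge0 => t _; rewrite lee_fin invr_ge0 exprn_ge0 ?bracket_ge0.
exists (C * W) => u eta beta.
have bu : 0 <= (bracket u ^+ m)^-1 by rewrite invr_ge0 exprn_ge0 ?bracket_ge0.
have iJ := phase_integrable htau u eta beta sA sB.
rewrite -lee_fin EFin_normr_Rintegral//.
apply: le_trans (le_abse_integral _ _ _) _ => //; first exact: measurable_int iJ.
apply: (@le_trans _ _ (\int[mu]_t (C * (bracket u ^+ m)^-1 * (bracket t ^+ (2 *
    d))^-1)%:E)%E).
  apply: ge0_le_integral_EFin => //.
  - apply: measurableT_comp => //.
    by have /measurable_int/measurable_EFinP := iJ.
  - by apply: measurable_funM => //; exact: measurable_bracketV.
  move=> t; apply: le_trans (HC u t).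
  by rewrite normrM ler_piMr// ler_norml cos_geN1 cos_le1.
under eq_integral do rewrite EFinM.
rewrite ge0_integralZl//; last 3 first.
- by apply/measurable_EFinP; exact: measurable_bracketV.
- by move=> t _; rewrite lee_fin invr_ge0 exprn_ge0 ?bracket_ge0.
- by rewrite lee_fin mulr_ge0.
by rewrite -(fineK Wfin) -EFinM lee_fin mulrAC.
Qed.

(** Each integration by parts trades a factor eta_j for a derivative of A or of
    B.  The claim for k is about all pairs of Schwartz functions, so the
    induction never has to expand iterated derivatives of a product. *)
Lemma phase_integral_decay_coord (j : 'I_d) k m A B : real_schwartz A -> real_schwartz B ->
  exists C, forall u (eta : Rd) beta, `|eta 0 j| ^+ k * `|phase_integral tau A B u eta
      beta| <=
    C * (bracket u ^+ m)^-1.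
Proof.
elim: k A B => [|k IH] A B sA sB.
  have [C HC] := phase_integral_decay_u m sA sB; exists C => u eta beta.
  by rewrite expr0 mul1r.
have [C1 HC1] := IH _ _ (real_schwartz_partial j sA) sB.
have [C2 HC2] := IH _ _ sA (real_schwartz_partial j sB).
exists (C1 + C2) => u eta beta.
have := phase_integral_by_parts htau j u eta (beta + pi / 2) sA sB.
rewrite addrK; set J := phase_integral _ A B _ _ _; set J1 := phase_integral _ _ _ _ _ _.
set J2 := phase_integral _ _ _ _ _ _ => E.
have pi2 : 1 <= 2 * pi :> R by have := pi_ge2 R; lra.
have N : `|eta 0 j| * `|J| <= `|J1| + `|J2|.
  apply: (@le_trans _ _ (2 * pi * (`|eta 0 j| * `|J|))).
    by rewrite ler_peMl// mulr_ge0.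
  rewrite (_ : 2 * pi * _ = `|2 * pi * eta 0 j * J|); last first.
    by rewrite !normrM (ger0_norm (ler0n _ 2)) (ger0_norm (pi_ge0 R)) -!mulrA.
  rewrite E; apply: le_trans (ler_normB _ _) _; rewrite !normrM; apply: lerD.
    by rewrite ler_piMl// ger0_norm ltW.
  rewrite ler_piMl// ger0_norm; first by have := tau_gt0; lra.
  by have := tau_lt1; lra.
rewrite exprSr -mulrA; apply: (@le_trans _ _ (`|eta 0 j| ^+ k * (`|J1| + `|J2|))).
  by rewrite ler_wpM2l// exprn_ge0.
by rewrite mulrDr mulrDl; apply: lerD; [exact: HC1|exact: HC2].
Qed.

Lemma phase_integral_decay k m A B : real_schwartz A -> real_schwartz B ->
  exists2 C, 0 <= C & forall u (eta : Rd) beta, `|phase_integral tau A B u eta beta| <=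
    C * (bracket u ^+ m)^-1 * (bracket eta ^+ k)^-1.
Proof.
move=> sA sB.
have [||| C C0 HC] := @bracket_decay R d (Rd * Rd * R)%type (fun x => x.1.2)
  (fun x => phase_integral tau A B x.1.1 x.1.2 x.2) (fun x => (bracket x.1.1 ^+ m)^-1) k.
- by move=> x; rewrite invr_ge0 exprn_ge0 ?bracket_ge0.
- have [C HC] := phase_integral_decay_u m sA sB; exists C => -[[u eta] beta].
  exact: HC.
- move=> j; have [C HC] := phase_integral_decay_coord j k m sA sB.
  by exists C => -[[u eta] beta]; exact: HC.
by exists C => // u eta beta; exact: (HC (u, eta, beta)).
Qed.

Variable g : Rd -> R[i].
Hypothesis hg : schwartz g.
Let a (x : Rd) := Re (g x).
Let b (x : Rd) := Im (g x).
Let sa : real_schwartz a. Proof. by case: hg. Qed.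
Let sb : real_schwartz b. Proof. by case: hg. Qed.

(** Its Fourier transform in t is the tau-Wigner distribution of the window, up to
    conjugation and a reflection in the frequency. *)
Definition window_product (u t : Rd) : R[i] :=
  (g (u + tau *: t))^* * g (u - (1 - tau) *: t).

Let P := @cross_product R d tau.

Lemma Re_window_product u t : Re (window_product u t) = P a a u t + P b b u t.
Proof. by rewrite ReM ReJ ImJ /P /cross_product mulNr opprK. Qed.

Lemma Im_window_product u t : Im (window_product u t) = P a b u t - P b a u t.
Proof. by rewrite ImM ReJ ImJ /P /cross_product mulNr. Qed.

Lemma window_product_decay m k : exists2 C, 0 <= C & forall u t,
  normc (window_product u t) <= C * (bracket u ^+ m)^-1 * (bracket t ^+ k)^-1.
Proof.
have [C1 C10 H1] := cross_product_decay htau m k sa sa.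
have [C2 C20 H2] := cross_product_decay htau m k sb sb.
have [C3 C30 H3] := cross_product_decay htau m k sa sb.
have [C4 C40 H4] := cross_product_decay htau m k sb sa.
exists (C1 + C2 + (C3 + C4)); first by rewrite !addr_ge0.
move=> u t; apply: le_trans (normc_le_ReIm _) _.
rewrite Re_window_product Im_window_product !mulrDl.
apply: lerD.
  by apply: le_trans (ler_normD _ _) _; apply: lerD.
by apply: le_trans (ler_normB _ _) _; apply: lerD.
Qed.

Lemma cmeasurable_window_product u : cmeasurable (window_product u).
Proof.
split.
  under eq_fun do rewrite Re_window_product.
  by apply: measurable_funD; exact: measurable_cross_product.
under eq_fun do rewrite Im_window_product.
by apply: measurable_funB; exact: measurable_cross_product.
Qed.

Lemma cintegrable_window_product u : cintegrable mu (window_product u).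
Proof.
have [C C0 HC] := window_product_decay 0 (2 * d).
apply: (@le_cintegrable _ _ _ _ _ (fun t : Rd => C * (bracket t ^+ (2 * d))^-1)).
- exact: cmeasurable_window_product.
- by apply: measurable_funM => //; exact: measurable_bracketV.
- by move=> t; have := HC u t; rewrite expr0 invr1 mulr1.
- exact: integral_bracketM_lty.
Qed.

(** With a and b the real and imaginary parts of g, the real and imaginary parts
    of the transform are sums of phase integrals of pairs among a and b; the
    phase -pi/2 produces the sines. *)
Lemma fourier_window_product_decay m k : exists2 C, 0 <= C & forall u (eta : Rd),
  normc (fourier (window_product u) eta) <= C * (bracket u ^+ m)^-1 * (bracket eta ^+ k)^-1.
Proof.
have [C1 C10 H1] := phase_integral_decay k m sa sa.
have [C2 C20 H2] := phase_integral_decay k m sb sb.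
have [C3 C30 H3] := phase_integral_decay k m sa sb.
have [C4 C40 H4] := phase_integral_decay k m sb sa.
exists (C1 + C2 + (C3 + C4) + (C3 + C4 + (C1 + C2))); first by rewrite !addr_ge0.
move=> u eta; apply: le_trans (normc_le_ReIm _) _.
pose J A B beta := phase_integral tau A B u eta beta.
have EF t : window_product u t * cis (- (2 * pi * dot t eta)) = complex.Complex
   ((P a a u t * cos (2 * pi * dot t eta + 0) + P b b u t * cos (2 * pi * dot t eta + 0)) +
    (P a b u t * cos (2 * pi * dot t eta + - (pi / 2)) - P b a u t * cos (2 * pi * dot t
        eta + - (pi / 2))))
   ((P a b u t * cos (2 * pi * dot t eta + 0) - P b a u t * cos (2 * pi * dot t eta + 0)) -
    (P a a u t * cos (2 * pi * dot t eta + - (pi / 2)) + P b b u t * cos (2 * pi * dot t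
        eta + - (pi / 2)))).
  set x := 2 * pi * dot t eta.
  have -> : cos (x - pi / 2) = sin x by rewrite -[in RHS](subrK (pi / 2) x) sinDpihalf.
  rewrite addr0; apply: complex_ext.
    by rewrite ReM Re_window_product Im_window_product /= cosN sinN; ring.
  by rewrite ImM Re_window_product Im_window_product /= cosN sinN; ring.
have Iaa beta := phase_integrable htau u eta beta sa sa.
have Ibb beta := phase_integrable htau u eta beta sb sb.
have Iab beta := phase_integrable htau u eta beta sa sb.
have Iba beta := phase_integrable htau u eta beta sb sa.
have -> : Re (fourier (window_product u) eta) =
    J a a 0 + J b b 0 + (J a b (- (pi / 2)) - J b a (- (pi / 2))).
  rewrite /fourier /=; under eq_Rintegral do rewrite EF /=.
  rewrite RintegralD//; last 2 first.
  - exact: (integrableD measurableT (Iaa 0) (Ibb 0)).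
  - exact: (integrableB measurableT (Iab _) (Iba _)).
  rewrite RintegralD//; last 2 first.
  - exact: Iaa.
  - exact: Ibb.
  by rewrite RintegralB//; [exact: Iab|exact: Iba].
have -> : Im (fourier (window_product u) eta) =
    J a b 0 - J b a 0 - (J a a (- (pi / 2)) + J b b (- (pi / 2))).
  rewrite /fourier /=; under eq_Rintegral do rewrite EF /=.
  rewrite RintegralB//; last 2 first.
  - exact: (integrableB measurableT (Iab 0) (Iba 0)).
  - exact: (integrableD measurableT (Iaa _) (Ibb _)).
  rewrite RintegralB//; last 2 first.
  - exact: Iab.
  - exact: Iba.
  by rewrite RintegralD//; [exact: Iaa|exact: Ibb].
rewrite /J !mulrDl; apply: lerD.
  apply: le_trans (ler_normD _ _) _; apply: lerD.
    by apply: le_trans (ler_normD _ _) _; apply: lerD.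
  by apply: le_trans (ler_normB _ _) _; apply: lerD.
apply: le_trans (ler_normB _ _) _; apply: lerD.
  by apply: le_trans (ler_normB _ _) _; apply: lerD.
by apply: le_trans (ler_normD _ _) _; apply: lerD.
Qed.

Lemma cintegrable_fourier_window_product u :
  cintegrable mu (fourier (window_product u)).
Proof.
have [C C0 HC] := fourier_window_product_decay 0 (2 * d).
apply: (@le_cintegrable _ _ _ _ _ (fun t : Rd => C * (bracket t ^+ (2 * d))^-1)).
- exact/cmeasurable_fourier/cmeasurable_window_product.
- by apply: measurable_funM => //; exact: measurable_bracketV.
- by move=> t; have := HC u t; rewrite expr0 invr1 mulr1.
- exact: integral_bracketM_lty.
Qed.

Lemma window_product_inversion u t :
  cint mu (fun eta => fourier (window_product u) eta * cis (2 * pi * dot t eta)) =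
  window_product u t.
Proof.
have [C C0 HC] := window_product_decay 0 0.
have cP A B : real_schwartz A -> real_schwartz B -> continuous (P A B u).
  move=> sA sB x; rewrite /P /cross_product; apply: cvgM; first exact: nbhs_filter.
    apply: (@continuous_cvg _ _ _ _ (nbhs_filter x) _ A); first exact:
        real_schwartz_continuous sA _.
    by apply: cvgD; [exact: cvg_cst|exact: scaler_continuous].
  apply: (@continuous_cvg _ _ _ _ (nbhs_filter x) _ B); first exact:
      real_schwartz_continuous sB _.
  by apply: cvgB; [exact: cvg_cst|exact: scaler_continuous].
apply: (@fourier_inversion _ _ _ C).
- rewrite (_ : (fun x => _) = (fun x => P a a u x + P b b u x)).
    by move=> x; apply: cvgD; [exact: nbhs_filter|exact: cP|exact: cP].
  by apply/funext => x; rewrite Re_window_product.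
- rewrite (_ : (fun x => _) = (fun x => P a b u x - P b a u x)).
    by move=> x; apply: cvgB; [exact: nbhs_filter|exact: cP|exact: cP].
  by apply/funext => x; rewrite Im_window_product.
- by move=> x; have := HC u x; rewrite !expr0 invr1 !mulr1.
- exact: cintegrable_window_product.
- exact: cintegrable_fourier_window_product.
Qed.

End window.

(** * The spectrogram as a convolution with the tau-Wigner distribution *)

Section spectrogram.
Context {R : realType} (d : nat).
Local Open Scope complex_scope.
Local Notation Re := complex.Re.
Local Notation Im := complex.Im.
Local Notation normc := Normc.normc.
Local Notation mu := (@lebesgue_rV R d).
Local Notation Rd := 'rV[R]_d.
Variable tau : R.
Hypothesis htau : 0 < tau < 1.

Let tau_gt0 : 0 < tau. Proof. by case/andP: htau. Qed.
Let tau_lt1 : tau < 1. Proof. by case/andP: htau. Qed.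
Let taup_gt0 : 0 < 1 - tau. Proof. by rewrite subr_gt0. Qed.

Lemma measurable_addZ dd (T : measurableType dd) (f1 f2 : T -> Rd) (r : R) :
  measurable_fun setT f1 -> measurable_fun setT f2 ->
  measurable_fun setT (fun t => f1 t + r *: f2 t).
Proof.
move=> m1 m2; apply: measurable_fun_mx => i j.
under eq_fun do rewrite !mxE.
apply: measurable_funD; first exact: (measurableT_comp (measurable_coord i j) m1).
by apply: measurable_funM => //; exact: (measurableT_comp (measurable_coord i j) m2).
Qed.

Let measurable_subZ dd (T : measurableType dd) (f1 f2 : T -> Rd) (r : R) :
  measurable_fun setT f1 -> measurable_fun setT f2 ->
  measurable_fun setT (fun t => f1 t - r *: f2 t).
Proof.
by move=> m1 m2; under eq_fun do rewrite -scaleNr; exact: measurable_addZ.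
Qed.

(** The substitution s = y + tau t, s' = y - (1 - tau) t is the composite of the
    reflection s' = s - t for fixed s and of the translation s = y + tau t for
    fixed t, hence preserves the double integral. *)
Lemma cint_autocorrelation (p : Rd -> R[i]) : cintegrable mu p ->
  cint mu p * (cint mu p)^* =
  cint mu (fun y => cint mu (fun t => p (y + tau *: t) * (p (y - (1 - tau) *: t))^*)).
Proof.
move=> ip; have [mp fp] := ip; have ipJ := cintegrableJ ip.
have mnp := measurable_normc mp.
have msub : measurable_fun setT (fun q : Rd * Rd => q.1 - q.2).
  have := measurable_subZ 1 measurable_fst measurable_snd.
  by under eq_fun do rewrite scale1r.
have mF1 : cmeasurable (fun q : Rd * Rd => p q.1 * (p (q.1 - q.2))^*).
  apply: cmeasurableM; first exact: cmeasurable_comp mp measurable_fst.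
  by apply: cmeasurableJ; exact: cmeasurable_comp mp msub.
have fin1 : (\int[mu]_s \int[mu]_t (normc (p s * (p (s - t))^*))%:E < +oo)%E.
  under eq_integral => s _.
    under eq_integral => t _ do rewrite Normc.normcM normcJ EFinM.
    rewrite ge0_integralZl//; last 3 first.
    - apply/measurable_EFinP; apply: (measurableT_comp mnp).
      exact: (measurableT_comp msub (measurable_pair1 s)).
    - by move=> t _; rewrite lee_fin normc_ge0.
    - by rewrite lee_fin normc_ge0.
    rewrite (@integral_reflect _ _ s (fun t => (normc (p t))%:E)); last
        exact/measurable_EFinP.
    over.
  rewrite ge0_integralZr//; last 3 first.
  - exact/measurable_EFinP.
  - by move=> t _; rewrite lee_fin normc_ge0.
  - by apply: integral_ge0 => t _; rewrite lee_fin normc_ge0.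
  apply: lte_mul_pinfty => //.
    by apply: integral_ge0 => t _; rewrite lee_fin normc_ge0.
  by rewrite ge0_fin_numE//; apply: integral_ge0 => t _; rewrite lee_fin normc_ge0.
transitivity (cint mu (fun s => cint mu (fun t => p s * (p (s - t))^*))).
  rewrite -cintMr//; apply: eq_cint => s.
  rewrite num_conjE -(cintJ ip) -(cintMl _ ipJ).
  rewrite (@cint_reflect _ _ s (fun t => p s * (p t)^*))//.
  by apply: cmeasurableM; [exact: cmeasurable_cst|exact: cmeasurableJ].
rewrite (cint_fubini mF1 fin1).
have mF2 : cmeasurable (fun q : Rd * Rd =>
    p (q.2 + tau *: q.1) * (p (q.2 - (1 - tau) *: q.1))^*).
  apply: cmeasurableM.
    apply: (cmeasurable_comp mp).
    exact: measurable_addZ measurable_snd measurable_fst.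
  apply: cmeasurableJ; apply: (cmeasurable_comp mp).
  exact: measurable_subZ _ measurable_snd measurable_fst.
have E (y t : Rd) : y - (1 - tau) *: t = y + tau *: t - t.
  by rewrite scalerBl scale1r opprB addrA.
have shift (t : Rd) : cint mu (fun s => p s * (p (s - t))^*) =
    cint mu (fun y => p (y + tau *: t) * (p (y - (1 - tau) *: t))^*).
  rewrite -(@cint_shift _ _ (tau *: t)); last first.
    apply: cmeasurableM => //; apply: cmeasurableJ; apply: (cmeasurable_comp mp).
    exact: (measurableT_comp msub (measurable_pair2 t)).
  by apply: eq_cint => y; rewrite E.
rewrite (eq_cint _ shift).
apply: (cint_fubini (m1 := mu) (m2 := mu) mF2).
suff -> : (\int[mu]_t \int[mu]_y (normc (p (y + tau *: t) * (p (y - (1 - tau) *: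
    t))^*))%:E =
   \int[mu]_t \int[mu]_s (normc (p s * (p (s - t))^*))%:E)%E.
  pose K (q : Rd * Rd) := (normc (p q.1 * (p (q.1 - q.2))^*))%:E.
  have mK : measurable_fun setT K by apply/measurable_EFinP; exact: measurable_normc.
  have K0 q : (0 <= K q)%E by rewrite lee_fin normc_ge0.
  by move: fin1; rewrite (fubini_tonelli (m1 := mu) (m2 := mu) K mK K0).
apply: eq_integral => t _.
rewrite -[in RHS](@integral_shift _ _ (tau *: t)); last first.
  apply/measurable_EFinP; apply: measurable_normc.
  apply: cmeasurableM => //; apply: cmeasurableJ; apply: (cmeasurable_comp mp).
  exact: (measurableT_comp msub (measurable_pair2 t)).
by apply: eq_integral => y _ /=; rewrite E.
Qed.

Variable f : Rd -> R[i].
Hypothesis hf : L2 f.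

Let mf : cmeasurable f. Proof. by case: hf. Qed.

Let energy := fine (\int[mu]_x (normc (f x) ^+ 2)%:E)%E.

Let energy_ge0 : 0 <= energy.
Proof. by apply: fine_ge0; apply: integral_ge0 => x _; rewrite lee_fin sqr_ge0. Qed.

Let energyE : (\int[mu]_x (normc (f x) ^+ 2)%:E = energy%:E)%E.
Proof.
rewrite fineK// ge0_fin_numE; first by case: hf.
by apply: integral_ge0 => x _; rewrite lee_fin sqr_ge0.
Qed.

Let mf2 : measurable_fun setT (fun x => normc (f x) ^+ 2).
Proof. by apply: measurable_funX; exact: measurable_normc. Qed.

Let energy_affine (r : R) (c : Rd) : r != 0 ->
  (\int[mu]_t (normc (f (r *: t + c)) ^+ 2)%:E = (`|r| ^- d * energy)%:E)%E.
Proof.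
move=> r0; have rd : 0 < `|r| ^+ d by rewrite exprn_gt0// normr_gt0.
have := @ge0_integral_affine R d r c (fun x => (normc (f x) ^+ 2)%:E) r0.
rewrite energyE => H.
have {}H := H ((measurable_EFinP _ _).2 mf2) (fun x => sqr_ge0 _).
rewrite EFinM H muleA -EFinM mulVf ?mul1e//.
by rewrite gt_eqF.
Qed.

Definition pair_product (y t : Rd) : R[i] := f (y + tau *: t) * (f (y - (1 - tau) *: t))^*.

Lemma cmeasurable_pair_product2 : cmeasurable (fun q : Rd * Rd => pair_product q.1 q.2).
Proof.
apply: cmeasurableM.
  by apply: (cmeasurable_comp mf); exact: measurable_addZ measurable_fst measurable_snd.
apply: cmeasurableJ; apply: (cmeasurable_comp mf).
exact: measurable_subZ _ measurable_fst measurable_snd.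
Qed.

Lemma cmeasurable_pair_product y : cmeasurable (pair_product y).
Proof. exact: cmeasurable_comp cmeasurable_pair_product2 (measurable_pair1 y). Qed.

(** By 2ab <= a^2 + b^2 it suffices to integrate the squares of the two factors.
    Each is f composed with an affine map of ratio tau or -(1 - tau), neither of
    which is zero. *)
Lemma integral_pair_product_le : exists2 C, 0 <= C & forall y,
  (\int[mu]_t (normc (pair_product y t))%:E <= C%:E)%E.
Proof.
exists (`|tau| ^- d * energy + `|- (1 - tau)| ^- d * energy).
  by rewrite addr_ge0// mulr_ge0// invr_ge0 exprn_ge0.
move=> y; rewrite EFinD -(energy_affine y) ?gt_eqF// -(energy_affine y) ?oppr_eq0 ?gt_eqF//.
have ma (r : R) : measurable_fun setT (fun t : Rd => normc (f (r *: t + y)) ^+ 2).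
  exact: measurableT_comp mf2 (measurable_rV_affine r y).
rewrite -ge0_integralD//; last 4 first.
- by move=> t _; rewrite lee_fin sqr_ge0.
- exact/measurable_EFinP.
- by move=> t _; rewrite lee_fin sqr_ge0.
- exact/measurable_EFinP.
apply: ge0_le_integral_EFin.
- by apply: measurable_normc; exact: cmeasurable_pair_product.
- by apply: measurable_funD; exact: ma.
- by move=> t; exact: normc_ge0.
- move=> t; rewrite Normc.normcM normcJ scaleNr ![_ + y]addrC.
  set a := normc _; set b := normc _.
  have := sqr_ge0 (a - b); have := mulr_ge0 (normc_ge0 _ : 0 <= a) (normc_ge0 _ : 0 <= b).
  by nra.
Qed.

Lemma cintegrable_pair_product y : cintegrable mu (pair_product y).
Proof.
split; first exact: cmeasurable_pair_product.
have [C _ HC] := integral_pair_product_le.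
by apply: le_lt_trans (HC y) _; rewrite ltry.
Qed.

Lemma tau_wignerE y eta : tau_wigner tau f (y, eta) = fourier (pair_product y) eta.
Proof.
by apply: eq_cint => t /=; rewrite /pair_product [RHS]mulrC mulrA.
Qed.

Lemma tau_wigner_bounded : exists2 M, 0 <= M & forall w, normc (tau_wigner tau f w) <= M.
Proof.
have [C C0 HC] := integral_pair_product_le.
exists (2 * C); first exact: mulr_ge0.
move=> [y eta]; rewrite tau_wignerE -lee_fin.
have mW := (cintegrableM_cis (h := fun t : Rd => - (2 * pi * dot t eta)) _
  (cintegrable_pair_product y)).1.
apply: le_trans (normc_cint_le _ (mW _)) _.
  by apply: measurableT_comp => //; apply: measurable_funM => //; exact: measurable_dotl.
rewrite EFinM lee_wpmul2l//; apply: le_trans (HC y).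
by under eq_integral do rewrite Normc.normcM normc_cis mulr1.
Qed.

Lemma cmeasurable_tau_wigner : cmeasurable (tau_wigner tau f : Rd * Rd -> R[i]).
Proof.
pose F (q : (Rd * Rd) * Rd) := pair_product q.1.1 q.2 * cis (- (2 * pi * dot q.2 q.1.2)).
have -> : tau_wigner tau f = (fun w => cint mu (fun t => F (w, t))).
  by apply/funext => -[y eta]; rewrite tau_wignerE.
apply: cmeasurable_cint; apply: cmeasurableM.
  have mq : measurable_fun setT (fun q : (Rd * Rd) * Rd => (q.1.1, q.2)).
    apply/measurable_fun_pairP; split; last exact: measurable_snd.
    exact: measurableT_comp measurable_fst measurable_fst.
  exact: cmeasurable_comp cmeasurable_pair_product2 mq.
apply: cmeasurable_cis; apply: measurableT_comp => //.
apply: measurable_funM => //; apply: measurable_dot; first exact: measurable_snd.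
exact: measurableT_comp measurable_snd measurable_fst.
Qed.

Variable g : Rd -> R[i].
Hypothesis hg : schwartz g.

Lemma schwartz_decay k : exists2 C, 0 <= C & forall x, normc (g x) <= C * (bracket x ^+
    k)^-1.
Proof.
have [sa sb] := hg.
have [C1 C10 H1] := real_schwartz_decay k sa.
have [C2 C20 H2] := real_schwartz_decay k sb.
exists (C1 + C2); first exact: addr_ge0.
by move=> x; apply: le_trans (normc_le_ReIm _) _; rewrite mulrDl lerD.
Qed.

Lemma cmeasurable_schwartz : cmeasurable g.
Proof. by have [sa sb] := hg; split; exact: real_schwartz_measurable. Qed.

Definition stft_integrand (z : Rd * Rd) (s : Rd) : R[i] :=
  f s * (g (s - z.1))^* * cis (- (2 * pi * dot s z.2)).

Lemma cintegrable_stft_integrand z : cintegrable mu (stft_integrand z).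
Proof.
have ms : measurable_fun setT (fun s : Rd => s - z.1).
  have := measurable_rV_affine 1 (- z.1).
  by under eq_fun do rewrite scale1r.
apply: cintegrableM_cis.
  by apply: measurableT_comp => //; apply: measurable_funM => //; exact: measurable_dotl.
have [C C0 HC] := schwartz_decay (2 * d).
pose w (s : Rd) := C ^+ 2 * (bracket s ^+ (2 * d))^-1.
have mw : measurable_fun setT w.
  by apply: measurable_funM => //; exact: measurable_bracketV.
have w0 s : 0 <= w s by rewrite mulr_ge0 ?sqr_ge0// invr_ge0 exprn_ge0 ?bracket_ge0.
apply: (@le_cintegrable _ _ _ _ _ (fun s => normc (f s) ^+ 2 + w (s - z.1))).
- apply: cmeasurableM => //; apply: cmeasurableJ.
  exact: cmeasurable_comp cmeasurable_schwartz ms.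
- by apply: measurable_funD => //; exact: measurableT_comp mw ms.
- move=> s; rewrite Normc.normcM normcJ.
  set a := normc _; set b := normc _.
  have a0 : 0 <= a := normc_ge0 _; have b0 : 0 <= b := normc_ge0 _.
  apply: (@le_trans _ _ (a ^+ 2 + b ^+ 2)).
    by have := sqr_ge0 (a - b); have := mulr_ge0 a0 b0; nra.
  rewrite lerD2l /w; set B := bracket _ ^+ _.
  have B1 : 1 <= B by rewrite exprn_ege1// bracket_ge1.
  have B0 : 0 < B by exact: lt_le_trans B1.
  apply: (@le_trans _ _ ((C * B^-1) ^+ 2)).
    by apply: lerXn2r; rewrite ?nnegrE ?mulr_ge0 ?invr_ge0 ?(ltW B0)//; exact: HC.
  rewrite exprMn ler_wpM2l ?sqr_ge0// expr2 ler_piMr ?invr_ge0 ?(ltW B0)//.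
  by rewrite invf_le1.
- under eq_integral do rewrite EFinD.
  rewrite ge0_integralD//; last 4 first.
  + by move=> s _; rewrite lee_fin sqr_ge0.
  + exact/measurable_EFinP.
  + by move=> s _; rewrite lee_fin.
  + by apply/measurable_EFinP; exact: measurableT_comp mw ms.
  rewrite energyE lte_add_pinfty ?ltry//.
  rewrite (@integral_shift _ _ (- z.1) (fun s => (w s)%:E)); last exact/measurable_EFinP.
  by apply: integral_bracketM_lty => //; exact: sqr_ge0.
Qed.

Lemma stft_sqrE (x xi : Rd) :
  stft g f (x, xi) * (stft g f (x, xi))^* =
  cint mu (fun y => cint mu (fun t =>
    pair_product y t * cis (- (2 * pi * dot t xi)) * window_product tau g (y - x) t)).
Proof.
rewrite (cint_autocorrelation (cintegrable_stft_integrand (x, xi))).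
apply: eq_cint => y; apply: eq_cint => t.
rewrite /stft_integrand /pair_product /window_product /=.
rewrite !num_conjE !conjcM conjcK -cisN opprK.
have -> : y + tau *: t - x = y - x + tau *: t by rewrite addrAC.
have -> : y - (1 - tau) *: t - x = y - x - (1 - tau) *: t by rewrite addrAC.
set a := f _; set b := f _; set c := g _; set e := g _.
have -> : - (2 * pi * dot t xi) = - (2 * pi * dot (y + tau *: t) xi) +
    2 * pi * dot (y - (1 - tau) *: t) xi.
  by rewrite !dotDl dotNl !dotZl; ring.
by rewrite cisD; ring.
Qed.

(** Replace the window product by its Fourier inversion integral and exchange the
    integrals: multiplication in t becomes convolution in the frequency. *)
Lemma cint_pair_window_wignerE (x xi y : Rd) :
  cint mu (fun t =>
    pair_product y t * cis (- (2 * pi * dot t xi)) * window_product tau g (y - x) t) =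
  cint mu (fun eta =>
    fourier (window_product tau g (y - x)) eta * tau_wigner tau f (y, xi - eta)).
Proof.
set G := window_product tau g (y - x).
have iG := cintegrable_fourier_window_product htau hg (y - x).
have iP := cintegrable_pair_product y.
pose F (q : Rd * Rd) := pair_product y q.1 * cis (- (2 * pi * dot q.1 xi)) *
  (fourier G q.2 * cis (2 * pi * dot q.1 q.2)).
have mF : cmeasurable F.
  apply: cmeasurableM; apply: cmeasurableM.
  - exact: cmeasurable_comp iP.1 measurable_fst.
  - apply: cmeasurable_cis; apply: measurableT_comp => //; apply: measurable_funM => //.
    by apply: measurable_dot; [exact: measurable_fst|exact: measurable_cst].
  - exact: cmeasurable_comp iG.1 measurable_snd.
  - apply: cmeasurable_cis; apply: measurable_funM => //.
    by apply: measurable_dot; [exact: measurable_fst|exact: measurable_snd].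
have finF : (\int[mu]_t \int[mu]_eta (normc (F (t, eta)))%:E < +oo)%E.
  have nF t eta : normc (F (t, eta)) = normc (pair_product y t) * normc (fourier G eta).
    by rewrite /F !Normc.normcM !normc_cis !mulr1.
  under eq_integral => t _.
    under eq_integral => eta _ do rewrite nF EFinM.
    rewrite ge0_integralZl//; last 3 first.
    - by apply/measurable_EFinP; apply: measurable_normc; exact: iG.1.
    - by move=> eta _; rewrite lee_fin normc_ge0.
    - by rewrite lee_fin normc_ge0.
    over.
  rewrite ge0_integralZr//; last 3 first.
  - by apply/measurable_EFinP; apply: measurable_normc; exact: iP.1.
  - by move=> t _; rewrite lee_fin normc_ge0.
  - by apply: integral_ge0 => t _; rewrite lee_fin normc_ge0.
  apply: lte_mul_pinfty; last exact: iG.2.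
    by apply: integral_ge0 => t _; rewrite lee_fin normc_ge0.
  rewrite ge0_fin_numE; first exact: iP.2.
  by apply: integral_ge0 => t _; rewrite lee_fin normc_ge0.
transitivity (cint mu (fun t => cint mu (fun eta => F (t, eta)))).
  apply: eq_cint => t; rewrite /F /= cintMl; last first.
    by apply: cintegrableM_cis => //; apply: measurable_funM => //; exact: measurable_dotr.
  by rewrite window_product_inversion.
rewrite (cint_fubini mF finF); apply: eq_cint => eta.
rewrite tau_wignerE -cintMl; last first.
  apply: cintegrableM_cis => //.
  by apply: measurableT_comp => //; apply: measurable_funM => //; exact: measurable_dotl.
apply: eq_cint => t; rewrite /F [dot t (xi - eta)]dotDr dotNr.
have -> : - (2 * pi * (dot t xi - dot t eta)) =
    - (2 * pi * dot t xi) + 2 * pi * dot t eta by ring.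
by rewrite cisD [(_, _).1]/= [(_, _).2]/=; ring.
Qed.

(** The weights in y - x and in eta combine into one weight in phase space
    because bracket (p, q) <= bracket p * bracket q. *)
Lemma stft_sqr_le m : exists2 C, 0 <= C & forall z : Rd * Rd,
  ((normc (stft g f z) ^+ 2)%:E <=
   C%:E * \int[@lebesgue_phase R d]_w ((bracket (w - z) ^+ m)^-1 * normc (tau_wigner tau
       f w))%:E)%E.
Proof.
have [C C0 HC] := fourier_window_product_decay htau hg m m.
exists (4 * C); first exact: mulr_ge0.
move=> [x xi].
have mW := cmeasurable_tau_wigner; have mnW := measurable_normc mW.
have mnWm y : measurable_fun setT (fun eta : Rd => normc (tau_wigner tau f (y, eta))).
  exact: measurableT_comp mnW (measurable_pair1 y).
have -> : normc (stft g f (x, xi)) ^+ 2 = normc (stft g f (x, xi) * (stft g f (x, xi))^*).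
  by rewrite Normc.normcM normcJ expr2.
rewrite stft_sqrE.
have mI : cmeasurable (fun y => cint mu (fun t =>
    pair_product y t * cis (- (2 * pi * dot t xi)) * window_product tau g (y - x) t)).
  apply: (@cmeasurable_cint _ _ _ _ _ mu (fun q : Rd * Rd => pair_product q.1 q.2 *
    cis (- (2 * pi * dot q.2 xi)) * window_product tau g (q.1 - x) q.2)).
  apply: cmeasurableM.
    apply: cmeasurableM; first exact: cmeasurable_pair_product2.
    apply: cmeasurable_cis; apply: measurableT_comp => //; apply: measurable_funM => //.
    by apply: measurable_dot; [exact: measurable_snd|exact: measurable_cst].
  have mxx : measurable_fun setT (fun q : Rd * Rd => q.1 - x).
    have := measurableT_comp (measurable_rV_affine 1 (- x)) (@measurable_fst _ _ Rd Rd).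
    by rewrite /comp; under eq_fun do rewrite scale1r.
  apply: cmeasurableM.
    apply: cmeasurableJ; apply: (cmeasurable_comp cmeasurable_schwartz).
    exact: measurable_addZ mxx measurable_snd.
  apply: (cmeasurable_comp cmeasurable_schwartz).
  exact: measurable_subZ _ mxx measurable_snd.
apply: le_trans (normc_cint_le _ mI) _.
have Wge0 w : 0 <= (bracket (w - (x, xi)) ^+ m)^-1 * normc (tau_wigner tau f w).
  by rewrite mulr_ge0 ?normc_ge0// invr_ge0 exprn_ge0 ?bracket_ge0.
have mWw : measurable_fun setT (fun w : Rd * Rd =>
    (bracket (w - (x, xi)) ^+ m)^-1 * normc (tau_wigner tau f w)).
  by apply: measurable_funM => //; exact: measurable_bracketV_pair.
pose K w := ((bracket (w - (x, xi)) ^+ m)^-1 * normc (tau_wigner tau f w))%:E.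
have mK : measurable_fun setT K by exact/measurable_EFinP.
have K0 w : (0 <= K w)%E by rewrite lee_fin.
have mFK := measurable_fun_fubini_tonelli_F (m2 := mu) K mK K0.
rewrite (_ : 4 * C = 2 * (2 * C)); last by ring.
rewrite EFinM -muleA lee_wpmul2l// [leRHS](_ : _ = ((2 * C)%:E * \int[mu]_y \int[mu]_om
    ((bracket ((y, om) - (x, xi)) ^+ m)^-1 * normc (tau_wigner tau f (y, om)))%:E)%E);
        last first.
  by congr (_ * _)%E; exact: (fubini_tonelli1 (m1 := mu) (m2 := mu) K mK K0).
have FK0 y : (0 <= \int[mu]_om K (y, om))%E by apply: integral_ge0.
have C20 : (0 <= (2 * C)%:E)%E by rewrite lee_fin mulr_ge0.
rewrite -(ge0_integralZl mu measurableT mFK (fun y _ => FK0 y) C20).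
apply: ge0_le_integral => //.
- by move=> y _; rewrite lee_fin normc_ge0.
- by apply/measurable_EFinP; exact: measurable_normc.
- by apply: measurable_funeM; exact: mFK.
move=> y _; rewrite cint_pair_window_wignerE.
have iG := cintegrable_fourier_window_product htau hg (y - x).
have mxi : measurable_fun setT (fun eta : Rd => (y, xi - eta)).
  apply: (measurableT_comp (measurable_pair1 y)).
  have := measurable_rV_affine (- 1) xi.
  by under eq_fun do rewrite scaleN1r addrC.
have mWxi : cmeasurable (fun eta : Rd => tau_wigner tau f (y, xi - eta)).
  exact: (@cmeasurable_comp _ _ _ _ _ _ (fun eta : Rd => (y, xi - eta)) mW mxi).
apply: le_trans (normc_cint_le _ (cmeasurableM iG.1 mWxi)) _.
rewrite EFinM -muleA lee_wpmul2l//.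
pose h om := (bracket ((y, om) - (x, xi)) ^+ m)^-1 * normc (tau_wigner tau f (y, om)).
have mh : measurable_fun setT h.
  exact: measurableT_comp mWw (measurable_pair1 y).
have h0 om : 0 <= h om by exact: Wge0.
rewrite [X in (_ <= _ * X)%E](_ : _ = \int[mu]_eta (h (xi - eta))%:E)%E; last first.
  exact/esym/(@integral_reflect _ _ xi (EFin \o h) ((measurable_EFinP _ _).2 mh)).
have mhxi : measurable_fun setT (fun eta : Rd => h (xi - eta)).
  exact: measurableT_comp mWw mxi.
have hxi0 eta : (0 <= (h (xi - eta))%:E)%E by rewrite lee_fin.
have CE0 : (0 <= C%:E)%E by rewrite lee_fin.
rewrite -(ge0_integralZl mu measurableT ((measurable_EFinP _ _).2 mhxi) (fun eta _ =>
    hxi0 eta) CE0).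
apply: ge0_le_integral_EFin.
- by apply: measurable_normc; exact: cmeasurableM iG.1 mWxi.
- exact: measurable_funM.
- by move=> eta; exact: normc_ge0.
- move=> eta; rewrite Normc.normcM /h mulrA ler_wpM2r ?normc_ge0//.
  apply: le_trans (HC (y - x) eta) _; rewrite -mulrA ler_wpM2l// -invfM -exprMn.
  rewrite lef_pV2 ?posrE ?exprn_gt0 ?mulr_gt0 ?bracket_gt0//.
  apply: lerXn2r; rewrite ?nnegrE ?mulr_ge0 ?bracket_ge0//.
  have -> : (y, xi - eta) - (x, xi) = (y - x, - eta) :> Rd * Rd.
    by congr pair; rewrite addrAC subrr add0r.
  by rewrite -(bracketN eta); exact: bracket_pair_le.
Qed.

End spectrogram.

(** * Cones and weights in phase space *)

Section cones.
Context {R : realType} {V : normedModType R}.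

(** Let the ball of radius 2 delta around z0 lie in G, and let G' be the cone over
    the ball of radius delta, that is, the union of the balls of centre t z0 and
    radius t delta.  If z lies in the ball of parameter t and w is not in G, then
    |w - z| >= t delta by homogeneity, whereas |z| <= t (|z0| + delta). *)
Lemma cone_separation (z0 : V) (G : set V) :
  open G -> G z0 -> (forall (t : R) z, 0 < t -> G z -> G (t *: z)) ->
  exists (G' : set V) (c : R),
    [/\ open G', G' z0, (forall (t : R) z, 0 < t -> G' z -> G' (t *: z)), 0 < c <= 1 &
        forall z w, G' z -> ~ G w -> c * bracket z <= bracket (w - z)].
Proof.
move=> oG Gz0 cG.
have /nbhs_ballP[e /= e0 eG] := open_nbhs_nbhs (conj oG Gz0).
pose delta := e / 2; have d0 : 0 < delta by rewrite divr_gt0.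
pose G' : set V := \bigcup_(t in [set t : R | 0 < t]) ball (t *: z0) (t * delta).
have G'E z : G' z <-> exists2 t : R, 0 < t & `|t *: z0 - z| < t * delta.
  by split=> -[t t0]; [rewrite -ball_normE => H; exists t|move=> H; exists t => //;
      rewrite -ball_normE].
have s0 : 0 < `|z0| + delta by rewrite ltr_wpDl.
exists G', (delta / (`|z0| + delta)); split.
- by apply: bigcup_open => t _; exact: ball_open.
- by apply/G'E; exists 1 => //; rewrite scale1r subrr normr0 mul1r.
- move=> t z t0 /G'E[s s1 H]; apply/G'E; exists (t * s); first exact: mulr_gt0.
  by rewrite -scalerA -scalerBr normrZ gtr0_norm// -mulrA ltr_pM2l.
- by rewrite divr_gt0//= ler_pdivrMr// mul1r lerDr.
move=> z w /G'E[t t0 H] Gw.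
have tw : t * e <= `|t *: z0 - w|.
  rewrite leNgt; apply/negP => tw; apply: Gw.
  rewrite -(scale1r w) -(divff (lt0r_neq0 t0)) -scalerA; apply: cG => //; apply: eG.
  rewrite -ball_normE /= -(ltr_pM2l t0) -[X in X * `|_|](gtr0_norm t0) -normrZ.
  by rewrite scalerBr scalerA divff ?lt0r_neq0// scale1r.
have wz : t * delta <= `|w - z|.
  have := ler_distD z (t *: z0) w; rewrite (distrC z w) => H2.
  have -> : t * delta = t * e - t * delta by rewrite /delta; field.
  lra.
have zb : `|z| <= t * (`|z0| + delta).
  have := ler_distD (t *: z0) z 0; rewrite !subr0 normrZ (gtr0_norm t0) distrC mulrDr.
  lra.
rewrite /bracket mulrDr mulr1 lerD//.
  by rewrite ler_pdivrMr// mul1r lerDr.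
apply: le_trans wz; rewrite mulrAC ler_pdivrMr//.
rewrite (_ : t * delta * _ = delta * (t * (`|z0| + delta))); last by ring.
by rewrite ler_wpM2l ?(ltW d0).
Qed.

End cones.

Section phase_space.
Context {R : realType} (d : nat).
Local Open Scope complex_scope.
Local Notation normc := Normc.normc.
Local Notation mu := (@lebesgue_rV R d).
Local Notation ph := (@lebesgue_phase R d).
Local Notation Rd := 'rV[R]_d.
Local Notation R2d := (Rd * Rd)%type.

Lemma ge0_integral_phase_shift (z : R2d) (h : R2d -> \bar R) :
  measurable_fun setT h -> (forall w, 0 <= h w)%E ->
  (\int[ph]_w h (w - z)%R = \int[ph]_w h w)%E.
Proof.
move=> mh h0.
have ms (c : Rd) : measurable_fun setT (fun x : Rd => x - c).
  have := measurable_rV_affine 1 (- c).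
  by under eq_fun do rewrite scale1r.
have mz : measurable_fun setT (fun w : R2d => w - z).
  apply/measurable_fun_pairP; split.
    exact: (measurableT_comp (ms z.1) measurable_fst).
  exact: (measurableT_comp (ms z.2) measurable_snd).
pose hz w := h (w - z).
have mhz : measurable_fun setT hz by exact: measurableT_comp mh mz.
have hz0 w : (0 <= hz w)%E by exact: h0.
transitivity (\int[mu]_y \int[mu]_eta hz (y, eta))%E.
  exact: (fubini_tonelli1 (m1 := mu) (m2 := mu) hz mhz hz0).
transitivity (\int[mu]_y \int[mu]_eta h (y, eta))%E; last first.
  exact/esym/(fubini_tonelli1 (m1 := mu) (m2 := mu) h mh h0).
have mF := measurable_fun_fubini_tonelli_F (m2 := mu) h mh h0.
transitivity (\int[mu]_y \int[mu]_eta h ((y - z.1)%R, eta))%E; last first.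
  exact: (@integral_shift _ _ (- z.1) (fun y => \int[mu]_eta h (y, eta))%E mF).
apply: eq_integral => y _.
apply: (@integral_shift _ _ (- z.2) (fun eta => h (y - z.1, eta))).
exact: measurableT_comp mh (measurable_pair1 _).
Qed.

Lemma integral_phase_bracket_lty m : (4 * d <= m)%N ->
  (\int[ph]_z ((bracket z ^+ m)^-1)%:E < +oo)%E.
Proof.
move=> dm.
have mb : measurable_fun setT (fun w : R2d => (bracket w ^+ m)^-1).
  have := @measurable_bracketV_pair R d m 0.
  by under eq_fun do rewrite subr0.
pose u (x : Rd) := (bracket x ^+ (2 * d))^-1.
have mu0 : measurable_fun setT u by exact: measurable_bracketV.
have u0 x : 0 <= u x by rewrite invr_ge0 exprn_ge0 ?bracket_ge0.
pose U (w : R2d) := (u w.1 * u w.2)%:E.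
have mU : measurable_fun setT U.
  apply/measurable_EFinP; apply: measurable_funM.
    exact: measurableT_comp mu0 measurable_fst.
  exact: measurableT_comp mu0 measurable_snd.
have U0 w : (0 <= U w)%E by rewrite lee_fin mulr_ge0.
apply: (@le_lt_trans _ _ (\int[ph]_w U w)%E).
  apply: ge0_le_integral => //.
  - by move=> w _; rewrite lee_fin invr_ge0 exprn_ge0 ?bracket_ge0.
  - exact/measurable_EFinP.
  - move=> [x y] _; rewrite lee_fin /u /= -invfM.
    rewrite lef_pV2 ?posrE ?mulr_gt0 ?exprn_gt0 ?bracket_gt0//.
    apply: (@le_trans _ _ (bracket ((x, y) : R2d) ^+ (4 * d))); last first.
      by rewrite ler_weXn2l// bracket_ge1.
    rewrite (_ : (4 * d = 2 * d + 2 * d)%N); last by rewrite -mulnDl.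
    rewrite exprD; apply: ler_pM; rewrite ?exprn_ge0 ?bracket_ge0//.
      apply: lerXn2r; rewrite ?nnegrE ?bracket_ge0//.
      by rewrite /bracket lerD2l prod_normE le_max lexx.
    apply: lerXn2r; rewrite ?nnegrE ?bracket_ge0//.
    by rewrite /bracket lerD2l prod_normE le_max lexx orbT.
have I := @integral_bracket_lty R d (2 * d) (leqnn _).
rewrite [ltLHS](_ : _ = \int[mu]_x \int[mu]_y U (x, y))%E; last first.
  exact: (fubini_tonelli1 (m1 := mu) (m2 := mu) U mU U0).
have Ifin : (\int[mu]_y (u y)%:E)%E \is a fin_num.
  by rewrite ge0_fin_numE//; apply: integral_ge0 => y _; rewrite lee_fin.
rewrite (eq_integral (fun x => (fine (\int[mu]_y (u y)%:E) * u x)%:E)); last first.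
  move=> x _; rewrite mulrC EFinM fineK//.
  rewrite -(ge0_integralZl mu measurableT ((measurable_EFinP _ _).2 mu0)) ?lee_fin//.
  by move=> y _; rewrite lee_fin.
apply: (@integral_bracketM_lty R d _ (2 * d)) => //.
by apply: fine_ge0; apply: integral_ge0 => y _; rewrite lee_fin.
Qed.

Definition sqr_enorm (z : R2d) : R := dot z.1 z.1 + dot z.2 z.2.

Lemma dot_ge0 (x : Rd) : 0 <= dot x x.
Proof. by apply: sumr_ge0 => i _; rewrite -expr2 sqr_ge0. Qed.

Lemma sqr_enorm_ge0 z : 0 <= sqr_enorm z.
Proof. by rewrite addr_ge0 ?dot_ge0. Qed.

Lemma enorm_exp z n : enorm z ^+ (2 * n) = sqr_enorm z ^+ n.
Proof. by rewrite exprM sqr_sqrtr// sqr_enorm_ge0. Qed.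

Lemma dot_le_norm (x : Rd) : dot x x <= d%:R * `|x| ^+ 2.
Proof.
rewrite /dot mulr_natl -[X in _ *+ X](card_ord d) -sumr_const; apply: ler_sum => i _.
rewrite -expr2 -real_normK ?num_real//; apply: lerXn2r; rewrite ?nnegrE//.
exact: rV_coord_le_norm.
Qed.

Lemma norm_le_dot (x : Rd) : `|x| ^+ 2 <= dot x x.
Proof.
have [x0|x0] := eqVneq `|x| 0; first by rewrite x0 expr0n dot_ge0.
have [[i j] /= xj] : exists i, mx_norm x = `|x i.1 i.2| by exact: mx_norm_neq0.
rewrite (_ : `|x| = `|x 0 j|); last by rewrite -(ord1 i).
rewrite real_normK ?num_real// /dot (bigD1 j)//= -expr2 lerDl.
by apply: sumr_ge0 => k _; rewrite -expr2 sqr_ge0.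
Qed.

Lemma sqr_enorm_le_bracket z : sqr_enorm z <= (2 * d)%:R * bracket z ^+ 2.
Proof.
have H (x : Rd) : `|x| <= bracket z -> dot x x <= d%:R * bracket z ^+ 2.
  move=> xz; apply: le_trans (dot_le_norm x) _; rewrite ler_wpM2l//.
  by apply: lerXn2r; rewrite ?nnegrE ?bracket_ge0.
rewrite mul2n -addnn natrD mulrDl; apply: lerD; apply: H.
  by rewrite /bracket prod_normE; apply: le_trans (_ : _ <= Num.max `|z.1| `|z.2|) _;
      rewrite ?le_max ?lexx// lerDr.
by rewrite /bracket prod_normE; apply: le_trans (_ : _ <= Num.max `|z.1| `|z.2|) _;
    rewrite ?le_max ?lexx ?orbT// lerDr.
Qed.

Lemma bracket_le_sqr_enorm z n :
  bracket z ^+ (2 * n) <= 4 ^+ n * (1 + sqr_enorm z ^+ n).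
Proof.
have q0 := sqr_enorm_ge0 z.
have zq : `|z| ^+ 2 <= sqr_enorm z.
  rewrite prod_normE; case: (leP `|z.1| `|z.2|) => _.
    by apply: le_trans (norm_le_dot _) _; rewrite lerDr dot_ge0.
  by apply: le_trans (norm_le_dot _) _; rewrite lerDl dot_ge0.
have b2 : bracket z ^+ 2 <= 2 * (1 + sqr_enorm z).
  by rewrite /bracket; have := sqr_ge0 (1 - `|z|); nra.
rewrite exprM; have [q1|q1] := leP (sqr_enorm z) 1.
  apply: (@le_trans _ _ (4 ^+ n)); last by rewrite ler_peMr ?exprn_ge0// lerDl exprn_ge0.
  by apply: lerXn2r; rewrite ?nnegrE ?exprn_ge0 ?bracket_ge0//; lra.
apply: (@le_trans _ _ ((4 * sqr_enorm z) ^+ n)).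
  by apply: lerXn2r; rewrite ?nnegrE ?exprn_ge0 ?bracket_ge0 ?mulr_ge0//; lra.
by rewrite exprMn ler_wpM2l ?exprn_ge0// lerDr.
Qed.

Lemma measurable_sqr_enorm : measurable_fun setT sqr_enorm.
Proof.
apply: measurable_funD; apply: measurable_dot; solve [exact: measurable_fst|exact:
    measurable_snd].
Qed.

End phase_space.

(** * Transfer of rapid decay between cones *)

Section rapid_decay_transfer.
Context {R : realType} (d : nat).
Local Open Scope complex_scope.
Local Notation normc := Normc.normc.
Local Notation mu := (@lebesgue_rV R d).
Local Notation ph := (@lebesgue_phase R d).
Local Notation Rd := 'rV[R]_d.
Local Notation R2d := (Rd * Rd)%type.

Let measurable_bracket_phase : measurable_fun setT (@bracket R R2d).
Proof.
apply: (@open_continuous_measurable_comp _ _ _ R2d id (@bracket R R2d)) => [U|w].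
  exact: phase_open_measurable.
by apply: cvgD; [exact: cvg_cst|exact: norm_continuous].
Qed.

Let measurable_weight m : measurable_fun setT (fun w : R2d => (bracket w ^+ m)^-1).
Proof.
have := @measurable_bracketV_pair R d m 0.
by under eq_fun do rewrite subr0.
Qed.

Let weight_ge0 m (w : R2d) : 0 <= (bracket w ^+ m)^-1.
Proof. by rewrite invr_ge0 exprn_ge0 ?bracket_ge0. Qed.

(** Cauchy-Schwarz in the form ab <= a^2 + b^2, with a = bracket^L h and
    b = bracket^(-2d), where L = 2n + 2d makes the product ab the integrand, while
    b^2 = bracket^(-4d) is integrable over phase space. *)
Lemma weighted_L1_of_L2 (G : set R2d) (h : R2d -> R) :
  measurable G -> measurable_fun setT h -> (forall w, 0 <= h w) ->
  (forall N : nat, \int[ph]_(w in G) (enorm w ^+ (2 * N) * h w ^+ 2)%:E < +oo)%E ->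
  forall n, (\int[ph]_(w in G) (h w * bracket w ^+ (2 * n))%:E < +oo)%E.
Proof.
move=> mG mh h0 dG n; pose L := (2 * n + 2 * d)%N.
have mq := @measurable_sqr_enorm R d.
have mh2 : measurable_fun setT (fun w => h w ^+ 2) by exact: measurable_funX.
have mqh N : measurable_fun setT (fun w => sqr_enorm w ^+ N * h w ^+ 2).
  by apply: measurable_funM => //; exact: measurable_funX.
pose F (w : R2d) := 4 ^+ L * (h w ^+ 2 + sqr_enorm w ^+ L * h w ^+ 2) + (bracket w ^+ (4
    * d))^-1.
have F0 w : 0 <= 4 ^+ L * (h w ^+ 2 + sqr_enorm w ^+ L * h w ^+ 2).
  by rewrite mulr_ge0 ?exprn_ge0// addr_ge0 ?sqr_ge0// mulr_ge0 ?sqr_ge0// exprn_ge0//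
      sqr_enorm_ge0.
have mF1 : measurable_fun setT (fun w => 4 ^+ L * (h w ^+ 2 + sqr_enorm w ^+ L * h w ^+ 2)).
  by apply: measurable_funM => //; apply: measurable_funD.
have pw w : h w * bracket w ^+ (2 * n) <= F w.
  have b0 := bracket_gt0 w.
  have -> : bracket w ^+ (2 * n) = bracket w ^+ L * (bracket w ^+ (2 * d))^-1.
    by rewrite /L exprD mulfK// expf_neq0// gt_eqF.
  apply: (@le_trans _ _ ((h w * bracket w ^+ L) ^+ 2 + ((bracket w ^+ (2 * d))^-1) ^+ 2)).
    rewrite mulrA; set a := h w * _; set b := (_)^-1.
    have a0 : 0 <= a by rewrite mulr_ge0 ?h0// exprn_ge0// ltW.
    have b0' : 0 <= b by exact: weight_ge0.
    by have := sqr_ge0 (a - b); have := mulr_ge0 a0 b0'; nra.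
  apply: lerD; last by rewrite exprVn -exprM -mulnAC.
  rewrite exprMn -exprM (mulnC L) mulrC.
  apply: (@le_trans _ _ (4 ^+ L * (1 + sqr_enorm w ^+ L) * h w ^+ 2)).
    by rewrite ler_wpM2r ?sqr_ge0// bracket_le_sqr_enorm.
  by rewrite -mulrA mulrDl mul1r.
apply: (@le_lt_trans _ _ (\int[ph]_(w in G) (F w)%:E)%E).
  apply: ge0_le_integral => //.
  - by move=> w _; rewrite lee_fin mulr_ge0 ?h0// exprn_ge0// bracket_ge0.
  - apply/measurable_EFinP; apply: measurable_funTS; apply: measurable_funM => //.
    exact: measurable_funX.
  - apply/measurable_EFinP; apply: measurable_funTS.
    by apply: measurable_funD => //; exact: measurable_weight.
  - by move=> w _; rewrite lee_fin.
have T (k : R2d -> R) : measurable_fun setT k -> measurable_fun G (fun w => (k w)%:E).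
  by move=> mk; apply/measurable_EFinP; exact: measurable_funTS.
under eq_integral do rewrite EFinD.
rewrite ge0_integralD//; last 4 first.
- by move=> w _; rewrite lee_fin.
- exact: T mF1.
- by move=> w _; rewrite lee_fin.
- exact: T (measurable_weight _).
apply: lte_add_pinfty; last first.
  apply: le_lt_trans (integral_phase_bracket_lty (leqnn (4 * d)%N)).
  apply: ge0_subset_integral => //.
    by apply/measurable_EFinP; exact: measurable_weight.
  by move=> w _; rewrite lee_fin.
under eq_integral do rewrite EFinM.
have mS : measurable_fun setT (fun w => h w ^+ 2 + sqr_enorm w ^+ L * h w ^+ 2).
  by apply: measurable_funD.
have S0 w : 0 <= sqr_enorm w ^+ L * h w ^+ 2.
  by rewrite mulr_ge0 ?sqr_ge0// exprn_ge0// sqr_enorm_ge0.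
rewrite (ge0_integralZl ph mG (T _ mS)); last 2 first.
- by move=> w _; rewrite lee_fin addr_ge0 ?sqr_ge0.
- by rewrite lee_fin exprn_ge0.
apply: lte_mul_pinfty => //.
under eq_integral do rewrite EFinD.
rewrite ge0_integralD//; last 4 first.
- by move=> w _; rewrite lee_fin sqr_ge0.
- exact: T mh2.
- by move=> w _; rewrite lee_fin.
- exact: T (mqh L).
apply: lte_add_pinfty.
  rewrite (eq_integral (fun w => (enorm w ^+ (2 * 0) * h w ^+ 2)%:E)); first exact: dG.
  by move=> w _; rewrite enorm_exp expr0 mul1r.
rewrite (eq_integral (fun w => (enorm w ^+ (2 * L) * h w ^+ 2)%:E)); first exact: dG.
by move=> w _; rewrite enorm_exp.
Qed.

(** For w in G the weight bracket(w - z)^(-m) absorbs the ratio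
    (bracket z / bracket w)^(2N) by submultiplicativity, and leaves the integral of
    W bracket^(2N) over G.  For w outside G, and z in G', separation makes
    bracket(w - z)^(-m) decay in z as well, and W is merely bounded. *)
Lemma convolution_rapid_decay (G G' : set R2d) (c : R) (V W : R2d -> R) :
  measurable G -> measurable G' -> 0 < c <= 1 ->
  (forall z w, G' z -> ~ G w -> c * bracket z <= bracket (w - z)) ->
  measurable_fun setT V -> measurable_fun setT W ->
  (forall z, 0 <= V z) -> (forall w, 0 <= W w) ->
  (exists M, forall w, W w <= M) ->
  (forall m, exists2 C, 0 <= C & forall z, ((V z)%:E <=
     C%:E * \int[ph]_w ((bracket (w - z) ^+ m)^-1 * W w)%:E)%E) ->
  (forall N : nat, \int[ph]_(w in G) (enorm w ^+ (2 * N) * W w ^+ 2)%:E < +oo)%E ->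
  forall N : nat, (\int[ph]_(z in G') (enorm z ^+ (2 * N) * V z)%:E < +oo)%E.
Proof.
move=> mG mG' /andP[c0 c1] sep mV mW V0 W0 [M WM] conv dG N.
have M0 : 0 <= M by apply: le_trans (WM 0).
(* k makes bracket^(-k) integrable over phase space; of the exponent n2, the part
   2N absorbs the polynomial factor and the rest leaves bracket^(-k) in z. *)
pose k := (4 * d)%N; pose n2 := (2 * N + 4 * d)%N; pose m := (n2 + k)%N.
have [C C0 HC] := conv m.
pose K (w : R2d) := (bracket w ^+ k)^-1.
have mK : measurable_fun setT K by exact: measurable_weight.
have K0 w : 0 <= K w by exact: weight_ge0.
have KN w : K (- w) = K w by rewrite /K bracketN.
have IK : (\int[ph]_w (K w)%:E < +oo)%E by exact: integral_phase_bracket_lty.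
pose IKr := fine (\int[ph]_w (K w)%:E)%E.
have IK0 : 0 <= IKr.
  by apply: fine_ge0; apply: integral_ge0 => w _; rewrite lee_fin.
have IKE : (\int[ph]_w (K w)%:E = IKr%:E)%E.
  by rewrite fineK// ge0_fin_numE//; apply: integral_ge0 => w _; rewrite lee_fin.
(* The part of the convolution that comes from G. *)
pose psi (w : R2d) := \1_G w * (W w * bracket w ^+ (2 * N)).
have psi0 w : 0 <= psi w.
  by rewrite !mulr_ge0 ?W0// ?exprn_ge0 ?bracket_ge0// indicE ler0n.
have mpsi : measurable_fun setT psi.
  apply: measurable_funM; first exact: measurable_indic.
  by apply: measurable_funM => //; exact: measurable_funX.
have Ipsi : (\int[ph]_w (psi w)%:E < +oo)%E.
  rewrite (_ : (\int[ph]_w (psi w)%:E)%E = \int[ph]_(w in G) (W w * bracket w ^+ (2 *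
      N))%:E)%E.
    exact: weighted_L1_of_L2.
  rewrite [RHS]integral_mkcond; apply: eq_integral => w _.
  rewrite patchE /psi indicE; case: (w \in G); first by rewrite mul1r.
  by rewrite mul0r.
pose B := M * (c ^+ n2)^-1.
have B0 : 0 <= B by rewrite mulr_ge0// invr_ge0 exprn_ge0// ltW.
have key z w : G' z -> bracket z ^+ (2 * N) * ((bracket (w - z) ^+ m)^-1 * W w) <=
    psi w * K (w - z) + B * K z * K (w - z).
  move=> Gz; have bz := bracket_gt0 z; have bwz := bracket_gt0 (w - z); have bw :=
      bracket_gt0 w.
  have Kwz := K0 (w - z).
  rewrite /psi indicE; have [wG|wG] := boolP (w \in G).
    rewrite mul1r -[leLHS]addr0; apply: lerD; last first.
      by apply: mulr_ge0 => //; exact: mulr_ge0.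
    rewrite [X in X <= _](_ : _ = W w * (bracket z ^+ (2 * N) * (bracket (w - z) ^+
        m)^-1)); last by ring.
    rewrite -[leRHS]mulrA ler_wpM2l ?W0// /K ler_pdivlMr ?exprn_gt0//.
    rewrite mulrAC ler_pdivrMr ?exprn_gt0//.
    apply: (@le_trans _ _ ((bracket w * bracket (w - z)) ^+ (2 * N) * bracket (w - z) ^+
        k)).
      rewrite ler_wpM2r ?exprn_ge0 ?(ltW bwz)//.
      apply: lerXn2r; rewrite ?nnegrE ?mulr_ge0 ?(ltW bz) ?(ltW bw) ?(ltW bwz)//.
      have := bracketD w (z - w); rewrite addrC subrK -(bracketN (z - w)) opprB.
      exact.
    rewrite exprMn -mulrA ler_wpM2l ?exprn_ge0 ?(ltW bw)// -exprD.
    rewrite ler_weXn2l ?bracket_ge1// /m /n2 /k.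
    by rewrite -addnA leq_add2l leq_addr.
  rewrite mul0r mul0r add0r.
  have nG : ~ G w by move=> Gw; move: wG; rewrite mem_set.
  have cb := sep z w Gz nG.
  have H : bracket z ^+ (2 * N) * (bracket (w - z) ^+ n2)^-1 <= (c ^+ n2)^-1 * K z.
    rewrite /K ler_pdivrMr ?exprn_gt0// -mulrA.
    rewrite [X in _ <= _ * X]mulrC.
    rewrite -ler_pdivrMl ?invr_gt0 ?exprn_gt0// invrK.
    rewrite ler_pdivlMr ?exprn_gt0// -mulrA -exprD -/n2 -exprMn.
    by apply: lerXn2r; rewrite ?nnegrE ?mulr_ge0 ?(ltW c0) ?(ltW bz) ?(ltW bwz).
  rewrite (_ : (bracket (w - z) ^+ m)^-1 = (bracket (w - z) ^+ n2)^-1 * K (w - z)); last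
      first.
    by rewrite /m exprD invfM.
  rewrite (_ : _ * _ = (bracket z ^+ (2 * N) * (bracket (w - z) ^+ n2)^-1) * (W w * K (w
      - z))); last by ring.
  rewrite (_ : B * K z * K (w - z) = (c ^+ n2)^-1 * K z * (M * K (w - z))); last by
      rewrite /B; ring.
  apply: ler_pM => //.
  - by apply: mulr_ge0; rewrite ?exprn_ge0 ?(ltW bz).
  - by rewrite mulr_ge0 ?W0.
  - by rewrite ler_wpM2r.
pose Phi (q : R2d * R2d) := (psi q.2 * K (q.2 - q.1))%:E.
have msub : measurable_fun setT (fun q : R2d * R2d => q.2 - q.1).
  have ms2 : measurable_fun setT (fun p : Rd * Rd => p.2 - p.1).
    have := measurable_addZ (-1) (@measurable_snd _ _ Rd Rd) (@measurable_fst _ _ Rd Rd).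
    by under eq_fun do rewrite scaleN1r.
  apply/measurable_fun_pairP; split.
    apply: (measurableT_comp ms2 (_ : measurable_fun setT (fun q : R2d * R2d => (q.1.1,
        q.2.1)))).
    apply/measurable_fun_pairP; split.
      exact: measurableT_comp measurable_fst measurable_fst.
    exact: measurableT_comp measurable_fst measurable_snd.
  apply: (measurableT_comp ms2 (_ : measurable_fun setT (fun q : R2d * R2d => (q.1.2,
      q.2.2)))).
  apply/measurable_fun_pairP; split.
    exact: measurableT_comp measurable_snd measurable_fst.
  exact: measurableT_comp measurable_snd measurable_snd.
have mPhi : measurable_fun setT Phi.
  apply/measurable_EFinP; apply: measurable_funM.
    exact: measurableT_comp mpsi measurable_snd.
  exact: measurableT_comp mK msub.
have Phi0 q : (0 <= Phi q)%E by rewrite lee_fin mulr_ge0.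
pose A z := (\int[ph]_w Phi (z, w))%E.
have mA : measurable_fun setT A.
  exact: (measurable_fun_fubini_tonelli_F (m2 := ph) Phi mPhi Phi0).
have A0 z : (0 <= A z)%E by apply: integral_ge0.
have mKz (z : R2d) : measurable_fun setT (fun w : R2d => K (w - z)).
  exact: (measurable_bracketV_pair k z).
have IA : (\int[ph]_z A z < +oo)%E.
  rewrite /A (fubini_tonelli (m1 := ph) (m2 := ph) Phi mPhi Phi0).
  rewrite (eq_integral (fun w => IKr%:E * (psi w)%:E)%E); last first.
    move=> w _; under eq_integral do rewrite /Phi /= EFinM.
    have mKw : measurable_fun setT (fun z : R2d => K (w - z)).
      by under eq_fun do rewrite -KN opprB; exact: mKz.
    rewrite (ge0_integralZl ph measurableT ((measurable_EFinP _ _).2 mKw)) ?lee_fin//;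
        last first.
      by move=> z _; rewrite lee_fin.
    rewrite muleC; congr (_ * _)%E; rewrite -IKE.
    rewrite -(@ge0_integral_phase_shift R d w (fun z => (K z)%:E)).
    - by apply: eq_integral => z _; rewrite -KN opprB.
    - exact/measurable_EFinP.
    - by move=> z; rewrite lee_fin.
  rewrite (ge0_integralZl ph measurableT ((measurable_EFinP _ _).2 mpsi)) ?lee_fin//.
    by apply: lte_mul_pinfty.
  by move=> w _; rewrite lee_fin.
pose D := (2 * d)%:R ^+ N * C.
have D0 : 0 <= D by rewrite mulr_ge0// exprn_ge0.
pose rhs z := (D%:E * (A z + (B * IKr)%:E * (K z)%:E))%E.
have BI0 : (0 <= (B * IKr)%:E)%E by rewrite lee_fin mulr_ge0.
have AK0 z : (0 <= A z + (B * IKr)%:E * (K z)%:E)%E.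
  by rewrite adde_ge0// mule_ge0// lee_fin.
have mEK : measurable_fun setT (fun z => (B * IKr)%:E * (K z)%:E)%E.
  by apply: measurable_funeM; exact/measurable_EFinP.
have mAK : measurable_fun setT (fun z => A z + (B * IKr)%:E * (K z)%:E)%E.
  exact: emeasurable_funD.
have mrhs : measurable_fun setT rhs by exact: measurable_funeM.
have rhs0 z : (0 <= rhs z)%E by rewrite mule_ge0 ?lee_fin.
have bound z : G' z -> ((enorm z ^+ (2 * N) * V z)%:E <= rhs z)%E.
  move=> Gz; have bz := bracket_gt0 z.
  have mk1 : measurable_fun setT (fun w : R2d => (bracket (w - z) ^+ m)^-1 * W w).
    by apply: measurable_funM => //; exact: measurable_bracketV_pair.
  have E0 : enorm z ^+ (2 * N) <= (2 * d)%:R ^+ N * bracket z ^+ (2 * N).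
    rewrite enorm_exp exprM -exprMn; apply: lerXn2r; rewrite ?nnegrE ?sqr_enorm_ge0//.
      by rewrite mulr_ge0// exprn_ge0// ltW.
    exact: sqr_enorm_le_bracket.
  apply: (@le_trans _ _ ((2 * d)%:R ^+ N * bracket z ^+ (2 * N) * V z)%:E).
    by rewrite lee_fin ler_wpM2r.
  rewrite /rhs /D [X in (_ <= X * _)%E]EFinM -mulrA EFinM -muleA.
  rewrite lee_wpmul2l ?lee_fin ?exprn_ge0//.
  rewrite EFinM; apply: (@le_trans _ _ ((bracket z ^+ (2 * N))%:E *
      (C%:E * \int[ph]_w ((bracket (w - z) ^+ m)^-1 * W w)%:E))%E).
    by rewrite lee_wpmul2l// lee_fin exprn_ge0// ltW.
  rewrite muleCA lee_wpmul2l ?lee_fin//.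
  rewrite -(ge0_integralZl ph measurableT ((measurable_EFinP _ _).2 mk1)); last 2 first.
  - by move=> w _; rewrite lee_fin mulr_ge0.
  - by rewrite lee_fin exprn_ge0// ltW.
  apply: (@le_trans _ _ (\int[ph]_w (Phi (z, w) + (B * K z)%:E * (K (w - z))%:E))%E).
    apply: ge0_le_integral => //.
    - by move=> w _; rewrite mule_ge0 ?lee_fin ?exprn_ge0 ?(ltW bz)// mulr_ge0.
    - by apply: measurable_funeM; exact/measurable_EFinP.
    - apply: emeasurable_funD.
        exact: measurableT_comp mPhi (measurable_pair1 z).
      by apply: measurable_funeM; exact/measurable_EFinP.
    - by move=> w _; rewrite /Phi -!EFinM -EFinD lee_fin; exact: key.
  rewrite ge0_integralD//; last 3 first.
  - exact: measurableT_comp mPhi (measurable_pair1 z).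
  - by move=> w _; rewrite mule_ge0 ?lee_fin// mulr_ge0.
  - by apply: measurable_funeM; exact/measurable_EFinP.
  rewrite leeD2l// (ge0_integralZl ph measurableT ((measurable_EFinP _ _).2 (mKz z)));
      last 2 first.
  - by move=> w _; rewrite lee_fin.
  - by rewrite lee_fin mulr_ge0.
  rewrite (@ge0_integral_phase_shift R d z (fun w => (K w)%:E)); last 2 first.
  - exact/measurable_EFinP.
  - by move=> w; rewrite lee_fin.
  by rewrite IKE -!EFinM lee_fin mulrAC.
apply: (@le_lt_trans _ _ (\int[ph]_(z in G') rhs z)%E).
  apply: ge0_le_integral => //.
  - by move=> z _; rewrite lee_fin mulr_ge0// enorm_exp exprn_ge0// sqr_enorm_ge0.
  - apply/measurable_EFinP; apply: measurable_funTS; apply: measurable_funM => //.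
    under eq_fun do rewrite enorm_exp.
    by apply: measurable_funX; exact: measurable_sqr_enorm.
  - exact: measurable_funTS.
apply: (@le_lt_trans _ _ (\int[ph]_z rhs z)%E).
  exact: ge0_subset_integral.
rewrite (ge0_integralZl ph measurableT mAK (fun z _ => AK0 z)) ?lee_fin//.
apply: lte_mul_pinfty; rewrite ?lee_fin//.
rewrite ge0_integralD//; last by move=> z _; rewrite mule_ge0// lee_fin.
apply: lte_add_pinfty => //.
rewrite (ge0_integralZl ph measurableT ((measurable_EFinP _ _).2 mK)) ?lee_fin//.
  by rewrite IKE -EFinM ltry.
by move=> z _; rewrite lee_fin.
Qed.

Lemma cmeasurable_stft (f g : Rd -> R[i]) : cmeasurable f -> cmeasurable g ->
  cmeasurable (stft g f : R2d -> R[i]).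
Proof.
move=> mf mg; pose F (q : R2d * Rd) := f q.2 * (g (q.2 - q.1.1))^* *
  cis (- (2 * pi * dot q.2 q.1.2)).
apply: (@cmeasurable_cint _ _ _ _ _ mu F); apply: cmeasurableM.
  apply: cmeasurableM; first exact: cmeasurable_comp mf measurable_snd.
  apply: cmeasurableJ; apply: (cmeasurable_comp mg).
  have := measurable_addZ (-1) (@measurable_snd _ _ R2d Rd)
    (measurableT_comp (@measurable_fst _ _ Rd Rd) (@measurable_fst _ _ R2d Rd)).
  by under eq_fun do rewrite scaleN1r.
apply: cmeasurable_cis; apply: measurableT_comp => //; apply: measurable_funM => //.
apply: measurable_dot; first exact: measurable_snd.
exact: measurableT_comp measurable_snd measurable_fst.
Qed.

End rapid_decay_transfer.

Theorem theorem5p4 (R : realType) (d : nat) (g f : 'rV[R]_d -> R[i]) (tau : R)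
    (hg : schwartz g) (hg0 : g <> (fun=> 0)) (hf : L2 f)
    (htau : 0 < tau < 1) :
  WF_G g f `<=` WF_tau tau f.
Proof.
move=> z0 [z00 nG].
split; first exact: z00.
move=> [G [[oG Gz0 cG] dG]].
apply: nG.
have [G' [c [oG' G'z0 cG' c01 sep]]] := cone_separation oG Gz0 cG.
exists G'; split; first by split.
have [M M0 WM] := tau_wigner_bounded htau hf.
have mf : cmeasurable f by case: hf.
have mg := cmeasurable_schwartz hg.
apply: (@convolution_rapid_decay R d G G' c (fun z => Normc.normc (stft g f z) ^+ 2)
  (fun w => Normc.normc (tau_wigner tau f w))) => //.
- exact: phase_open_measurable.
- exact: phase_open_measurable.
- by apply: measurable_funX; apply: measurable_normc; exact: cmeasurable_stft.
- by apply: measurable_normc; exact: cmeasurable_tau_wigner.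
- by move=> z; exact: sqr_ge0.
- by move=> w; exact: normc_ge0.
- by exists M.
- exact: (stft_sqr_le htau hf hg).
Qed.
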